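(* Let $\mathrm{E}$ be a Banach space, let $2\le p<3$ and $p-2<\rho\le 1$, and let $\mathbf V=(V_{ts},\mathbb V_{ts})_{0\le s\le t\le T}$ be a weak geometric $(p,\rho)$-rough driver on $\mathrm{E}$. Assume $\rho>\frac p3$. Then the differential equation on flows $$d\varphi=\mathbf V(\varphi\,;dt)$$ has a unique solution flow $\varphi=(\varphi_{ts})_{0\le s\le t\le T}$. It takes values in the space of uniformly $\mathcal C^\rho$ homeomorphisms of $\mathrm{E}$, with uniformly $\mathcal C^\rho$ inverses, and $\varphi$ depends continuously on $\mathbf V$ in the topology of uniform convergence.
   Context: $T>0$ is a fixed finite time horizon. Differentiability on Banach spaces is in the Fréchet sense. For $n\in\mathbb N_0$, $\rho\in(0,1]$, $$\|f\|_{\mathcal C^{n+\rho}}:=\sum_{i=0}^n\sup_x\|D^if(x)\|+\sup_{0<\|x-y\|\le1}\frac{\|D^nf(x)-D^nf(y)\|}{\|x-y\|^\rho}.$$ Vector fields are identified with the first order differential operators they define: $(Vf)(x)=(D_xf)(V(x))$; products such as $V_{us}V_{tu}$ are compositions of operators, $(V_{us}V_{tu})f=V_{us}(V_{tu}f)$. Weak geometric $(p,\rho)$-rough driver: a family $\mathbf V_{ts}=(V_{ts},\mathbb V_{ts})$, $0\le s\le t\le T$, where each $V_{ts}$ is a vector field on $\mathrm{E}$ and $\mathbb V_{ts}$ a second order differential operator, such that (i) $V_{ts}=V_{tu}+V_{us}$ for all $s<u<t$, and $\sup_{0\le s<t\le T}\|V_{ts}\|_{\mathcal C^{2+\rho}}/|t-s|^{1/p}<\infty$;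 (ii) the operators $W_{ts}:=\mathbb V_{ts}-\frac12V_{ts}V_{ts}$ are vector fields, and $\sup_{0\le s<t\le T}\|W_{ts}\|_{\mathcal C^{1+\rho}}/|t-s|^{2/p}<\infty$; (iii) $\mathbb V_{ts}=\mathbb V_{tu}+V_{us}V_{tu}+\mathbb V_{us}$ for all $0\le s\le u\le t\le T$. The set of rough drivers is equipped with the (pseudo-)metric $$d_{p,\rho}(\mathbf V,\mathbf V')=\sup_{0\le s<t\le T}\left\{\frac{\|V_{ts}-V'_{ts}\|_{\mathcal C^{2+\rho}}}{|t-s|^{1/p}}\vee\frac{\|W_{ts}-W'_{ts}\|_{\mathcal C^{1+\rho}}}{|t-s|^{2/p}}\right\}.$$ For $0\le s\le t\le T$, $\mu_{ts}:\mathrm{E}\to\mathrm{E}$ is the time-$1$ map of the ordinary differential equation $\dot y_u=V_{ts}(y_u)+W_{ts}(y_u)$, $0\le u\le1$ (it maps $x$ to $y_1$ where $y_0=x$). A flow on $\mathrm{E}$ is a family $(\varphi_{ts})_{0\le s\le t\le T}$ of maps from $\mathrm{E}$ to itself with $\varphi_{tt}=\mathrm{Id}$ and $\varphi_{tu}\circ\varphi_{us}=\varphi_{ts}$ for all $0\le s\le u\le t\le T$. A flow $\varphi$ solves $d\varphi=\mathbf V(\varphi;dt)$ if there are positive constants $\delta$ and $C$, possibly depending on $\mathbf V$, such that $\|\varphi_{ts}-\mu_{ts}\|_\infty\le C|t-s|^{3/p}$ for all $0\le s\le t\le T$ with $t-s\le\delta$. A family of maps is uniformly $\mathcal C^\rho$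 if it has uniformly bounded $\mathcal C^\rho$-norm; for maps that are perturbations of the identity, the norm of $f$ is understood as that of $f-\mathrm{Id}$. Continuous dependence on $\mathbf V$ in the topology of uniform convergence means continuity of $\mathbf V\mapsto\varphi$ with respect to $d_{p,\rho}$ and uniform convergence over $0\le s\le t\le T$ and $x\in\mathrm{E}$. *)

(* Defs.v *)
From HB Require Import structures.
From mathcomp Require Import all_boot all_order all_algebra.
From mathcomp Require Import all_classical all_reals all_analysis.
Import numFieldNormedType.Exports.

Set Implicit Arguments.
Unset Strict Implicit.
Unset Printing Implicit Defensive.
Import Order.TTheory GRing.Theory Num.Theory.
Local Open Scope classical_set_scope.
Local Open Scope ring_scope.

Section ContinuousLinear.
Context {R : realType} (E F : normedModType R).

Definition contlin : {pred E -> F} :=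
  fun f => `[< linear f /\ continuous f >].

Lemma contlin_submod_closed : GRing.submod_closed contlin.
Proof.
split.
  apply/asboolP; split; last by move=> x; exact: cvg_cst.
  by move=> a x y; rewrite /GRing.zero /= scaler0 addr0.
move=> a f g /asboolP[lf cf] /asboolP[lg cg]; apply/asboolP; split.
  move=> b x y; rewrite !fctE lf lg.
  rewrite !scalerDr !scalerA [a * b]mulrC -!addrA; congr (_ + _).
  by rewrite addrCA.
move=> x; apply: cvgD; last exact: cg.
by apply: cvgZl_tmp; exact: cf.
Qed.

HB.instance Definition _ := GRing.isSubmodClosed.Build R (E -> F) contlin
  contlin_submod_closed.

Record clin := Clin { clin_fun :> E -> F; _ : clin_fun \in contlin }.

HB.instance Definition _ := [isSub for clin_fun].
HB.instance Definition _ := [Choice of clin by <:].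
HB.instance Definition _ := [SubChoice_isSubLmodule of clin by <:].

Lemma clin_linear (f : clin) : linear f.
Proof. by case: f => f /= /asboolP[]. Qed.

Lemma clin_continuous (f : clin) : continuous f.
Proof. by case: f => f /= /asboolP[]. Qed.

HB.instance Definition _ (f : clin) :=
  GRing.isLinear.Build R E F *:%R f (clin_linear f).

Definition opnorm (f : clin) : R := sup [set `|f x| | x in [set x | `|x| <= 1]].

Lemma opnorm_has_sup (f : clin) :
  has_sup [set `|f x| | x in [set x | `|x| <= 1]].
Proof.
split; first by exists `|f 0|, 0 => //=; rewrite normr0.
have /linear_bounded_continuous/bounded_funP/(_ 1)[M fM] := @clin_continuous f.
by exists M => _ /= [x x1 <-]; exact: fM.
Qed.

Lemma opnorm_ub (f : clin) x : `|x| <= 1 -> `|f x| <= opnorm f.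
Proof. by move=> x1; apply: ub_le_sup; [case: (opnorm_has_sup f)|exists x]. Qed.

Lemma opnorm_le (f : clin) M : (forall x, `|x| <= 1 -> `|f x| <= M) ->
  opnorm f <= M.
Proof.
move=> fM; apply: ge_sup; first by case: (opnorm_has_sup f).
by move=> _ [x x1 <-]; exact: fM.
Qed.

Lemma opnormD f g : opnorm (f + g) <= opnorm f + opnorm g.
Proof.
apply: opnorm_le => x x1; rewrite (le_trans (ler_normD _ _))//.
by rewrite lerD// opnorm_ub.
Qed.

Lemma opnormZ (l : R) f : opnorm (l *: f) = `|l| * opnorm f.
Proof.
have le (a : R) g : opnorm (a *: g) <= `|a| * opnorm g.
  apply: opnorm_le => x x1; rewrite [leLHS]normrZ.
  by rewrite ler_wpM2l// opnorm_ub.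
apply/eqP; rewrite eq_le le /=.
have [->|l0] := eqVneq l 0.
  rewrite normr0 mul0r (le_trans _ (@opnorm_ub _ 0 _)) ?normr0//.
rewrite -ler_pdivlMl ?normr_gt0// -normfV -[in leLHS](scale1r f).
by rewrite -(mulVf l0) -scalerA.
Qed.

Lemma opnorm0_eq0 f : opnorm f = 0 -> f = 0.
Proof.
move=> f0; apply/val_inj/funext => x /=; apply/eqP.
have [->|x0] := eqVneq x 0; first by rewrite linear0.
have : `|f (`|x|^-1 *: x)| <= 0.
  by rewrite -f0 opnorm_ub// normrZ normfV normr_id mulVf ?normr_eq0.
rewrite linearZ normrZ normfV normr_id pmulr_rle0 ?invr_gt0 ?normr_gt0//.
by rewrite normr_le0.
Qed.

HB.instance Definition _ :=
  Lmodule_isNormed.Build R clin opnormD opnormZ opnorm0_eq0.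

End ContinuousLinear.

Section Calculus.
Context {R : realType} (E F : normedModType R).

(* L(E, L(E, ..., L(E, F))), with n copies of E *)
Fixpoint multilin (n : nat) : normedModType R :=
  if n is n'.+1 then clin E (multilin n') else F.

(* insubd replaces the differential by 0 at the points where it fails to be a
   continuous linear map; this never happens where g is differentiable. *)
Definition Dmap (G : normedModType R) (g : E -> G) (x : E) : clin E G :=
  insubd (0 : clin E G) ('d g x : E -> G).

Fixpoint iterDmap (f : E -> F) (n : nat) : E -> multilin n :=
  if n is n'.+1 then Dmap (iterDmap f n') else f.

Definition ntimes_differentiable (n : nat) (f : E -> F) : Prop :=
  forall i : nat, (i < n)%N -> forall x, differentiable (iterDmap f i) x.

Definition is_Cn (n : nat) (f : E -> F) : Prop :=
  ntimes_differentiable n f /\ continuous (iterDmap f n).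

Definition supnorm (G : normedModType R) (g : E -> G) : \bar R :=
  ereal_sup [set `|g x|%:E | x in [set: E]].

(* 0 is added to the set because there is no pair x <> y when E is trivial *)
Definition holder_seminorm (rho : R) (G : normedModType R) (g : E -> G) :
    \bar R :=
  ereal_sup (0%E |`
    [set (`|g z.1 - g z.2| / `|z.1 - z.2| `^ rho)%:E
       | z in [set z : E * E | 0 < `|z.1 - z.2| <= 1]]).

(* The C^(n+rho) norm; it is +oo for maps that are not n times differentiable *)
Definition Cnorm (n : nat) (rho : R) (f : E -> F) : \bar R :=
  if `[< ntimes_differentiable n f >] then
    (\sum_(i < n.+1) supnorm (iterDmap f i) + holder_seminorm rho (iterDmap f n))%E
  else +oo%E.

Definition vfop (V : E -> E) (f : E -> F) : E -> F := fun x => 'd f x (V x).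

End Calculus.

Section DiffOp.
Context {R : realType} (E : normedModType R).

(* P is given at each x by a continuous linear functional of the 2-jet
   (f(x), D_x f, D^2_x f), for all test functions f of class C^2. *)
Definition second_order_op (P : (E -> R^o) -> E -> R^o) : Prop :=
  exists A : E ->
      clin (R^o * clin E R^o * clin E (clin E R^o))%type R^o,
    forall f : E -> R^o, is_Cn 2 f -> forall x,
      P f x = A x (f x, iterDmap f 1 x, iterDmap f 2 x).

End DiffOp.

Section RoughDriver.
Context {R : realType}.

Definition sup_incr (T : R) (F : R -> R -> \bar R) : \bar R :=
  ereal_sup [set F z.2 z.1
    | z in [set z : R * R | [&& 0 <= z.1, z.1 < z.2 & z.2 <= T]]].

(* In all two-parameter families the later time comes first: rd_V t s is V_{ts}.
   Values outside 0 <= s <= t <= T are irrelevant.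
   rd_W is determined by rd_V and rd_VV through rd_WE, since a vector field is
   determined by its action on test functions.
   rd_V_diff has content for s = t only, where rd_V_fin says nothing; it is what
   gives a meaning to the products V_{uu}V_{tu}, V_{us}V_{uu} and V_{uu}V_{uu}
   occurring in rd_chen. *)
Record rough_driver (E : normedModType R) (T p rho : R) := RoughDriver {
  rd_V : R -> R -> E -> E;
  rd_VV : R -> R -> (E -> R^o) -> E -> R^o;
  rd_W : R -> R -> E -> E;
  rd_V_diff : forall s t, 0 <= s -> s <= t -> t <= T ->
    forall x, differentiable (rd_V t s) x;
  rd_VV_op : forall s t, 0 <= s -> s <= t -> t <= T ->
    second_order_op (rd_VV t s);
  rd_V_add : forall s u t, 0 <= s -> s < u -> u < t -> t <= T ->
    forall x, rd_V t s x = rd_V t u x + rd_V u s x;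
  rd_V_fin : (sup_incr T (fun t s =>
    Cnorm 2 rho (rd_V t s) * ((t - s) `^ (1 / p))^-1%:E) < +oo)%E;
  rd_WE : forall s t, 0 <= s -> s <= t -> t <= T ->
    forall f : E -> R^o, is_Cn 2 f -> forall x,
      rd_VV t s f x - 2^-1 * vfop (rd_V t s) (vfop (rd_V t s) f) x
      = vfop (rd_W t s) f x;
  rd_W_fin : (sup_incr T (fun t s =>
    Cnorm 1 rho (rd_W t s) * ((t - s) `^ (2 / p))^-1%:E) < +oo)%E;
  rd_chen : forall s u t, 0 <= s -> s <= u -> u <= t -> t <= T ->
    forall f : E -> R^o, is_Cn 2 f -> forall x,
      rd_VV t s f x =
        rd_VV t u f x + vfop (rd_V u s) (vfop (rd_V t u) f) x + rd_VV u s f x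
}.

Definition driver_dist (E : normedModType R) (T p rho : R)
    (V V' : rough_driver E T p rho) : \bar R :=
  sup_incr T (fun t s => maxe
    (Cnorm 2 rho (rd_V V t s \- rd_V V' t s)%R * ((t - s) `^ (1 / p))^-1%:E)
    (Cnorm 1 rho (rd_W V t s \- rd_W V' t s)%R * ((t - s) `^ (2 / p))^-1%:E))%E.

End RoughDriver.

Section Flows.
Context {R : realType} {E : normedModType R}.

(* The time-1 map of y' = F(y). Solutions on [0, 1] are taken as restrictions of
   maps defined on R, so that the derivatives at 0 and 1 are two-sided; every
   solution on [0, 1] has such an extension. *)
Definition time1_map (F : E -> E) (x : E) : E :=
  get [set z : E | exists y : R^o -> E, [/\ y 0 = x, y 1 = z &
    forall u : R^o, 0 <= u -> u <= 1 -> is_derive u 1 y (F (y u))]].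

Definition mu_map (T p rho : R) (V : rough_driver E T p rho) (t s : R) : E -> E :=
  time1_map (rd_V V t s \+ rd_W V t s).

Definition is_flow (T : R) (phi : R -> R -> E -> E) : Prop :=
  (forall t, 0 <= t -> t <= T -> forall x, phi t t x = x) /\
  (forall s u t, 0 <= s -> s <= u -> u <= t -> t <= T ->
    forall x, phi t u (phi u s x) = phi t s x).

Definition solution_flow (T p rho : R) (V : rough_driver E T p rho)
    (phi : R -> R -> E -> E) : Prop :=
  is_flow T phi /\
  exists delta C : R, [/\ 0 < delta, 0 < C &
    forall s t, 0 <= s -> s <= t -> t <= T -> t - s <= delta ->
      (supnorm (phi t s \- mu_map V t s)%R <= (C * (t - s) `^ (3 / p))%:E)%E].

Definition uniformly_holder_homeos (T rho : R) (phi : R -> R -> E -> E) :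
    Prop :=
  exists K : R, forall s t, 0 <= s -> s <= t -> t <= T ->
    exists psi : E -> E,
      [/\ cancel (phi t s) psi, cancel psi (phi t s),
          continuous (phi t s) & continuous psi] /\
      (Cnorm 0 rho (phi t s \- id)%R <= K%:E)%E /\
      (Cnorm 0 rho (psi \- id)%R <= K%:E)%E.

End Flows.

(* Main.v *)
From HB Require Import structures.
Require Import Defs.
From mathcomp Require Import all_boot all_order all_algebra.
From mathcomp Require Import all_classical all_reals all_analysis.
From mathcomp Require Import ring lra zify.
Import Order.TTheory GRing.Theory Num.Theory.
Import numFieldNormedType.Exports.
Local Open Scope classical_set_scope.
Local Open Scope ring_scope.
Set Implicit Arguments.
Unset Strict Implicit.
Unset Printing Implicit Defensive.

(** The solution flow is sewn together from explicit approximate steps.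

    Replace the time-1 map mu_ts of V_ts + W_ts by Davie's map
      nu_ts(x) = x + V_ts(x) + W_ts(x) + 1/2 D_x V_ts (V_ts(x)).
    A Taylor expansion along the differential equation gives
    |mu_ts - nu_ts| <= c (t-s)^(3/p) ([time1_davie]), so mu and nu have the
    same solution flows ([solution_flowP]).  The differential equation enters
    only through the existence of its solutions.

    Chen's relation, tested on continuous linear functionals, becomes the
    identity W_ts = W_tu + W_us + 1/2 (DV_tu V_us - DV_us V_tu) between vector
    fields ([rd_chen_W]; the Hahn-Banach theorem provides enough functionals).
    It makes the terms of first and second order of nu_tu o nu_us and of nu_ts
    cancel, so the defect nu_tu o nu_us - nu_ts is of size (t-s)^(3/p); since V
    is of class C^(2+rho) and W of class C^(1+rho), its Lipschitz constant is of
    size (t-s)^((2+rho)/p) ([davie_comp]).  Both exponents exceed 1, the second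
    one because rho > p - 2.

    The regularity C^(1+rho) enters only through the four-point estimate
      |f a - f b - f c + f d| <= k (|a-b-c+d| + m^rho |b-d|),
      where |a-b| <= m and |c-d| <= m
    ([fourpt]).  It is stable under sums and products and compares compositions
    of maps without any derivative of a composition.

    Compositions of the steps nu along a grid then stay close to nu, both
    uniformly and in Lipschitz constant ([discrete_sewing]): cut the interval in
    its middle; as the exponents exceed 1, the errors of the two halves add up
    to a fraction of the admissible error, which leaves room for the defect.
    Composing with nu_tu an error of size (t-s)^(3/p) changes the Lipschitz
    constant by (t-s)^(1/p) ((t-s)^(3/p))^rho, and 1 + 3 rho >= 2 + rho because
    rho > p/3 >= 2/3.  So the compositions are uniformly Lipschitz, and they
    converge under refinement to a Lipschitz flow ([sewing]).  The same theorem,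
    applied to the Euler maps x + (t-s) F(x), solves ordinary differential
    equations ([ode_solution]).

    The rest is telescoping along a subdivision.  If one of two flows is
    Lipschitz and they differ by e on each of n small intervals, they differ by
    at most n L e ([flow_compare]).  With e = O(n^(-3/p)) this gives uniqueness;
    with e = O(n^(-3/p)) + O(distance of the drivers) it gives continuity, the
    constants being uniform over drivers with a common bound.  The reversed
    driver -V_(T-s,T-t), -W_(T-s,T-t) has a flow as well, and telescoping shows
    that it inverts the first one ([flow_inverse]).  Finally a Lipschitz map at
    bounded distance from the identity is C^rho for every rho <= 1. *)

(** * The Hahn-Banach theorem for the norm *)

Section HahnBanach.
Context {R : realType} (E : normedModType R).
Implicit Types (G : set (E * R)) (x y : E) (a r s : R).

(** Graph of a linear functional, dominated by the norm, on a subspace of E.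
    It is functional because (0, r) and (0, -r) in the graph force r <= 0 and
    -r <= 0.  Graphs are convenient for Zorn's lemma:
    the upper bound of a chain is its union. *)
Definition dominated_graph G : Prop :=
  (forall a x y r s, G (x, r) -> G (y, s) -> G (a *: x + y, a * r + s)) /\
  (forall x r, G (x, r) -> r <= `|x|).

Definition line_graph (x0 : E) : set (E * R) :=
  [set z | exists a, z = (a *: x0, a * `|x0|)].

Lemma dominated_line x0 : dominated_graph (line_graph x0).
Proof.
split=> [a _ _ _ _ [b [-> ->]] [c [-> ->]]|_ _ [b [-> ->]]].
  by exists (a * b + c); rewrite scalerDl scalerA mulrDl mulrA.
by rewrite normrZ ler_wpM2r// ler_norm.
Qed.

(** The one-dimensional extension step: the value c at z must lie above every
    r - |x - z| and below every |y + z| - s, for (x, r) and (y, s) in the graph;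
    the triangle inequality leaves room for such a c. *)
Lemma dominated_extend G z : dominated_graph G -> G (0, 0) ->
  exists c, dominated_graph
    [set w : E * R | exists a x r, G (x, r) /\ w = (x + a *: z, r + a * c)].
Proof.
move=> [Glin Gle] G0.
pose S := [set w | exists x r, G (x, r) /\ w = r - `|x - z|].
have SU y s w : G (y, s) -> S w -> w <= `|y + z| - s.
  move=> Gy [x [r [Gx ->]]].
  have /Gle := Glin 1 _ _ _ _ Gx Gy; rewrite scale1r mul1r => h.
  have : `|x + y| <= `|x - z| + `|y + z|.
    by rewrite (le_trans _ (ler_normD _ _))// addrACA addNr addr0.
  lra.
have supS : has_sup S.
  split; first by exists (0 - `|0 - z|); exists 0, 0.
  by exists (`|0 + z| - 0) => w; apply: SU.
exists (sup S); split=> [a x y r s|x r].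
  move=> [a1 [x1 [r1 [G1 [-> ->]]]]] [a2 [x2 [r2 [G2 [-> ->]]]]].
  exists (a * a1 + a2), (a *: x1 + x2), (a * r1 + r2); split; first exact: Glin.
  congr (_, _); last by ring.
  by rewrite scalerDr scalerDl scalerA addrACA.
move=> [a [{}x [{}r [Gx [-> ->]]]]].
have Gs b : G (b *: x, b * r).
  by have := Glin b _ _ _ _ Gx G0; rewrite !addr0.
have [a0|a0|->] := ltgtP a 0; last by rewrite scale0r mul0r !addr0 Gle.
- have : S (((- a)^-1 * r) - `|((- a)^-1 *: x) - z|) by do 2!eexists; split.
  move=> /(ub_le_sup supS.2) h.
  have na0 : 0 < - a by rewrite oppr_gt0.
  have -> : x + a *: z = (- a) *: ((- a)^-1 *: x - z).
    by rewrite scalerBr scalerA divff ?gt_eqF// scale1r scaleNr opprK.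
  rewrite normrZ gtr0_norm//.
  have : (- a) * ((- a)^-1 * r - `|(- a)^-1 *: x - z|) <= (- a) * sup S.
    by rewrite ler_wpM2l// ltW.
  by rewrite mulrBr mulrA divff ?gt_eqF// mul1r; lra.
- have h : sup S <= `|(a^-1 *: x) + z| - a^-1 * r.
    by apply: ge_sup; [exact: supS.1|move=> w; apply: SU].
  have -> : x + a *: z = a *: (a^-1 *: x + z).
    by rewrite scalerDr scalerA divff ?gt_eqF// scale1r.
  rewrite normrZ gtr0_norm//.
  have : a * sup S <= a * (`|(a^-1 *: x) + z| - a^-1 * r).
    by rewrite ler_wpM2l// ltW.
  by rewrite mulrBr mulrA divff ?gt_eqF// mul1r; lra.
Qed.

(** Zorn's lemma is applied to the dominated graphs that contain the line of
    x0, together with the empty one, because the union of the empty chain is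
    empty. *)
Lemma norming_functional x0 : exists f : E -> R^o,
  [/\ linear f, (forall x, `|f x| <= `|x|) & f x0 = `|x0|].
Proof.
(* the empty graph accounts for the empty chain *)
pose P G := G = set0 \/ (dominated_graph G /\ line_graph x0 `<=` G).
have [|A [PA Amax]] := @Zorn_bigcup _ P.
  move=> F FP Ftot.
  (* a chain of empty graphs, or a chain with a member above the line *)
  have [F0|] := pselect (forall G, F G -> G = set0).
    by left; apply/seteqP; split=> // z [G /F0 ->].
  move=> /existsNP[G1 /not_implyP[FG1 G1n0]]; right; split; last first.
    have [//|[_ h]] := FP _ FG1; by move=> z /h hz; exists G1.
  split=> [a x y r s [G FG Gx] [G' FG' Gy]|x r [G FG Gx]].
    have [GG'|G'G] := Ftot _ _ FG FG'.
      exists G' => //; have [h|[[h _] _]] := FP _ FG'; first by rewrite h in Gy.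
      by apply: h => //; exact: GG'.
    exists G => //; have [h|[[h _] _]] := FP _ FG; first by rewrite h in Gx.
    by apply: h => //; exact: G'G.
  have [h|[[_ h] _]] := FP _ FG; first by rewrite h in Gx.
  exact: h.
have line0 : line_graph x0 (0, 0) by exists 0; rewrite scale0r mul0r.
have [A0|[dA lA]] := PA.
  exfalso; apply: (Amax (line_graph x0)); last first.
    by right; split => //; exact: dominated_line.
  by rewrite A0; split=> // /(_ _ line0).
have A0 : A (0, 0) by exact: lA.
have Atot z : exists r, A (z, r).
  apply: contrapT => /forallNP nAz.
  have [c dc] := dominated_extend z dA A0.
  apply: (Amax _ _ (or_intror (conj dc _))).
    split; first by move=> [x r] Axr; exists 0, x, r; rewrite scale0r mul0r !addr0.
    move=> /(_ (z, c)); apply: contra_not (nAz c) => /(_ _); apply.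
    by exists 1, 0, 0; rewrite scale1r mul1r !add0r.
  by move=> [x r] /lA Axr; exists 0, x, r; rewrite scale0r mul0r !addr0.
have [f Af] := choice Atot.
have [Alin Ale] := dA.
have Auniq z r s : A (z, r) -> A (z, s) -> r = s.
  have le r' s' : A (z, r') -> A (z, s') -> r' <= s'.
    move=> h1 h2; have /Ale := Alin (- 1) _ _ _ _ h2 h1.
    by rewrite scaleN1r addNr normr0; lra.
  by move=> h1 h2; apply/le_anti/andP; split; exact: le.
have flin : linear f.
  move=> a x y; apply: Auniq (Af _) _; exact: Alin.
exists f; split => //.
  move=> x; rewrite ler_norml (Ale _ _ (Af x)) andbT.
  have := Ale _ _ (Alin (-1) _ _ _ _ (Af x) A0).
  by rewrite scaleN1r !addr0 normrN mulN1r; lra.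
apply: Auniq (Af _) _; apply: lA; exists 1; by rewrite scale1r mul1r.
Qed.

Lemma eq_functionals (x y : E) :
  (forall f : {linear E -> R^o}, f x = f y) -> x = y.
Proof.
move=> fxy; have [f [flin _ fxy0]] := norming_functional (x - y).
pose fL := GRing.isLinear.Build _ _ _ _ f flin.
pose g : {linear E -> R^o} := HB.pack f fL.
apply/eqP; rewrite -subr_eq0 -normr_eq0 -fxy0.
have -> : f (x - y) = g x - g y by rewrite -linearB.
by rewrite fxy subrr.
Qed.

End HahnBanach.

Section Functional.
Context {R : realType} {E : normedModType R} (f : {linear E -> R^o}).

Lemma functionalD x y : f (x + y) = f x + f y. Proof. exact: linearD. Qed.
Lemma functionalN x : f (- x) = - f x. Proof. exact: linearN. Qed.
Lemma functionalZ (a : R) x : f (a *: x) = a * f x. Proof. exact: linearZ. Qed.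
Lemma functional0 : f 0 = 0. Proof. exact: linear0. Qed.

End Functional.

(** Identities between vectors are proved on their images by linear
    functionals, where they become identities between real numbers.  The images
    of the atoms are generalized, so that the decision procedure never has to
    compare two vectors up to conversion. *)
Ltac vscalar :=
  let f := fresh "f" in
  apply: eq_functionals => f;
  rewrite ?(functionalD f, functionalN f, functionalZ f, functional0 f);
  repeat match goal with |- context [f ?x] => generalize (f x); intro end.

Ltac vring := vscalar; ring.

Ltac vfield := vscalar; field => //.

(** * Velocities of curves and the mean value inequality *)

Section Triangle.
Context {R : realType} {F : normedModType R}.

Lemma ler_norm3 (a b c : F) : `|a + b + c| <= `|a| + `|b| + `|c|.
Proof. by do 2 (apply: le_trans (ler_normD _ _) _; apply: lerD => //). Qed.

Lemma ler_norm4 (a b c d : F) : `|a + b + c + d| <= `|a| + `|b| + `|c| + `|d|.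
Proof. by do 3 (apply: le_trans (ler_normD _ _) _; apply: lerD => //). Qed.

End Triangle.

Section Curves.
Context {R : realType} (F : normedModType R).
Implicit Types (y z : R -> F) (u : R).

(** Differentiability of a curve in the epsilon-delta form, which is the one
    that the mean value inequality and the flows below produce and consume. *)
Definition has_velocity y u (v : F) : Prop :=
  forall e : R, 0 < e -> exists2 d : R, 0 < d &
    forall h : R, `|h| < d -> `|y (u + h) - y u - h *: v| <= e * `|h|.

Lemma has_velocity_cst c u : has_velocity (fun=> c) u 0.
Proof.
move=> e e0; exists 1 => // h _.
by rewrite scaler0 !subrr normr0 mulr_ge0// ltW.
Qed.

Lemma has_velocityZ (c : F) u : has_velocity (fun u => u *: c) u c.
Proof.
move=> e e0; exists 1 => // h _.
have -> : (u + h) *: c - u *: c - h *: c = 0 by vring.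
by rewrite normr0 mulr_ge0// ltW.
Qed.

Lemma has_velocity_sqr (c : F) u :
  has_velocity (fun u => (u ^+ 2 / 2) *: c) u (u *: c).
Proof.
move=> e e0; exists (e / (`|c| + 1)); first by rewrite divr_gt0// ltr_wpDl.
move=> h hd.
rewrite scalerA -scalerBl -scalerBl normrZ.
have -> : (u + h) ^+ 2 / 2 - u ^+ 2 / 2 - h * u = h * (h / 2) by field.
rewrite normrM -mulrA mulrC ler_wpM2r//.
rewrite normrM (ger0_norm (_ : 0 <= 2^-1)) ?invr_ge0//.
move: hd; rewrite ltr_pdivlMr ?ltr_wpDl//.
have := normr_ge0 h; have := normr_ge0 c; nra.
Qed.

Lemma has_velocityD y z u v w : has_velocity y u v -> has_velocity z u w ->
  has_velocity (fun u => y u + z u) u (v + w).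
Proof.
move=> yv zw e e0; have e2 : 0 < e / 2 by rewrite divr_gt0.
have [d1 d10 h1] := yv _ e2; have [d2 d20 h2] := zw _ e2.
exists (Num.min d1 d2); first by rewrite lt_min d10.
move=> h; rewrite lt_min => /andP[/h1 hy /h2 hz].
have -> : y (u + h) + z (u + h) - (y u + z u) - h *: (v + w) =
  (y (u + h) - y u - h *: v) + (z (u + h) - z u - h *: w).
  by vring.
rewrite (le_trans (ler_normD _ _))//; lra.
Qed.

Lemma has_velocityN y u v : has_velocity y u v ->
  has_velocity (fun u => - y u) u (- v).
Proof.
move=> yv e /yv[d d0 hd]; exists d => // h /hd.
by rewrite scalerN -!opprD normrN.
Qed.

Lemma has_velocityB y z u v w : has_velocity y u v -> has_velocity z u w ->
  has_velocity (fun u => y u - z u) u (v - w).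
Proof. by move=> yv /has_velocityN; apply: has_velocityD. Qed.

(** Let c be the supremum of the times up to which the inequality holds with
    M + e in place of M.  The velocity at c carries it up to c, then strictly
    beyond c unless c = 1. *)
Lemma mean_value_ineq_at y (M t : R) : 0 <= t <= 1 ->
  (forall u, 0 <= u <= 1 -> exists2 v, has_velocity y u v & `|v| <= M) ->
  `|y t - y 0| <= M * t.
Proof.
move=> /andP[t0 t1] yM; apply/ler_addgt0Pr => e e0; set M' := M + e.
pose S := [set t : R | 0 <= t <= 1 /\
  forall s : R, 0 <= s <= t -> `|y s - y 0| <= M' * s].
(* local form of the inequality, on both sides of u *)
have step u : 0 <= u <= 1 -> exists2 d : R, 0 < d & forall h : R, `|h| < d ->
    `|y (u + h) - y u| <= M' * `|h|.
  move=> /yM[v yv vM]; have [d d0 hd] := yv _ e0; exists d => // h /hd H.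
  rewrite -(subrK (h *: v) (_ - _)) (le_trans (ler_normD _ _))// normrZ.
  by have := normr_ge0 h; rewrite /M'; nra.
have S0 : S 0.
  split; first by rewrite lexx ler01.
  by move=> s; rewrite -eq_le => /eqP <-; rewrite subrr normr0 mulr0.
have supS : has_sup S by split; [exists 0|exists 1 => z [/andP[]]].
set c := sup S.
have c01 : 0 <= c <= 1.
  apply/andP; split; first exact: (ub_le_sup supS.2 S0).
  by apply: ge_sup; [exists 0|move=> z [/andP[]]].
have below s : 0 <= s < c -> `|y s - y 0| <= M' * s.
  move=> /andP[s0 /(sup_gt supS.1)[z [_ St] st]]; apply: St.
  by rewrite s0 ltW.
have Sc : S c.
  split=> // s /andP[s0]; rewrite le_eqVlt => /orP[/eqP ->|sc]; last first.
    by apply: below; rewrite s0.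
  have [d d0 hd] := step _ c01.
  have [c0|c0] := leP c 0.
    have -> : c = 0 by apply/le_anti; rewrite c0; case/andP: c01.
    by rewrite subrr normr0 mulr0.
  pose h := Num.min (d / 2) c.
  have h0 : 0 < h by rewrite lt_min c0 divr_gt0.
  have hc : h <= c by rewrite ge_min lexx orbT.
  have hd2 : h < d by rewrite gt_min ltr_pdivrMr// ltr_pMr// ltr1n.
  have /hd : `|- h| < d by rewrite normrN gtr0_norm.
  rewrite normrN (gtr0_norm h0) distrC => H1.
  have H2 : `|y (c - h) - y 0| <= M' * (c - h).
    by apply: below; rewrite subr_ge0 hc /= ltrBlDr ltrDl.
  rewrite -(subrKA (y (c - h))) (le_trans (ler_normD _ _))//; lra.
have [c1|c1] := ltP c 1; last first.
  apply: (@le_trans _ _ (M' * t)); last first.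
    by rewrite mulrDl lerD2l ler_piMr// ltW.
  by case: Sc => _; apply; rewrite t0 (le_trans t1).
exfalso.
have [d d0 hd] := step _ c01.
pose h := Num.min (d / 2) (1 - c).
have h0 : 0 < h by rewrite lt_min subr_gt0 c1 divr_gt0.
have hc : h <= 1 - c by rewrite ge_min lexx orbT.
have hd2 : h < d by rewrite gt_min ltr_pdivrMr// ltr_pMr// ltr1n.
have : c + h <= c; last by rewrite gerDl leNgt h0.
apply: (ub_le_sup supS.2); split.
  by case/andP: c01 => ? ?; apply/andP; split; lra.
move=> s /andP[s0 sch]; have [sc|cs] := leP s c.
  by case: Sc => _; apply; rewrite s0.
have /hd : `|s - c| < d by rewrite gtr0_norm ?subr_gt0//; lra.
rewrite (addrC c) subrK gtr0_norm ?subr_gt0// => H1.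
have H2 : `|y c - y 0| <= M' * c by case: Sc => _; apply; rewrite lexx andbT; case/andP: c01.
rewrite -(subrKA (y c)) (le_trans (ler_normD _ _))//; lra.
Qed.

Lemma mean_value_ineq y (M : R) :
  (forall u, 0 <= u <= 1 -> exists2 v, has_velocity y u v & `|v| <= M) ->
  `|y 1 - y 0| <= M.
Proof.
by move=> yM; rewrite -[leRHS]mulr1 mean_value_ineq_at// ler01 lexx.
Qed.

End Curves.

Section Frechet.
Context {R : realType} (E F : normedModType R).
Implicit Types (f : E -> F) (x : E).

Lemma differentiable_eps f x : differentiable f x ->
  forall e : R, 0 < e -> exists2 d : R, 0 < d &
    forall v, `|v| < d -> `|f (x + v) - f x - 'd f x v| <= e * `|v|.
Proof.
move=> /diff_locally/eqaddoP h e e0; have := h e e0.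
move=> /nbhs_ballP[d /= d0 hd]; exists d => // v vd.
have := hd v; rewrite -ball_normE /= sub0r normrN => /(_ vd).
by rewrite /= !fctE (addrC x) opprD addrA.
Qed.

Lemma has_velocity_line f x v u :
  differentiable f (x + u *: v) ->
  has_velocity (fun u => f (x + u *: v)) u ('d f (x + u *: v) v).
Proof.
move=> /differentiable_eps df e e0.
have e'0 : 0 < e / (`|v| + 1) by rewrite divr_gt0// ltr_wpDl.
have [d d0 hd] := df _ e'0.
exists (d / (`|v| + 1)); first by rewrite divr_gt0// ltr_wpDl.
move=> h; rewrite ltr_pdivlMr ?ltr_wpDl// => hlt.
have /hd : `|h *: v| < d.
  rewrite normrZ (le_lt_trans _ hlt)// ler_wpM2l// lerDl//.
rewrite linearZ scalerDl addrA => /le_trans; apply.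
rewrite normrZ mulrAC ler_pdivrMr ?ltr_wpDl// -mulrA ler_wpM2l ?(ltW e0)//.
by rewrite ler_wpM2l// lerDl.
Qed.

Lemma DmapE f x v : differentiable f x -> Dmap f x v = 'd f x v.
Proof.
move=> fx; rewrite /Dmap insubdK//; apply/asboolP; split.
  by move=> a b c; rewrite linearP.
exact: diff_continuous.
Qed.

Lemma clin_apply_le (f : clin E F) v : `|f v| <= `|f| * `|v|.
Proof.
have [->|v0] := eqVneq v 0; first by rewrite linear0 !normr0 mulr0.
have nv : `|v| != 0 by rewrite normr_eq0.
rewrite -ler_pdivrMr ?normr_gt0//.
have /(opnorm_ub f) : `| `|v|^-1 *: v| <= 1.
  by rewrite normrZ normfV normr_id mulVf.
by rewrite linearZ normrZ normfV normr_id mulrC.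
Qed.

Lemma clin_apply_bound (f : clin E F) v (m n : R) :
  `|f| <= m -> `|v| <= n -> `|f v| <= m * n.
Proof. by move=> fm vn; rewrite (le_trans (clin_apply_le _ _))// ler_pM. Qed.

Lemma clin_addE (f g : clin E F) v : (f + g) v = f v + g v.
Proof. by []. Qed.

Lemma clin_oppE (f : clin E F) v : (- f) v = - f v.
Proof. by []. Qed.

Lemma clinD (f : clin E F) v w : f (v + w) = f v + f w.
Proof. by rewrite linearD. Qed.

Lemma clinN (f : clin E F) v : f (- v) = - f v.
Proof. by rewrite linearN. Qed.

Lemma clinZ (f : clin E F) r v : f (r *: v) = r *: f v.
Proof. by rewrite linearZ. Qed.

End Frechet.

Definition clinE := (@clin_addE, @clin_oppE, @clinD, @clinN, @clinZ).

(** * Four-point estimates *)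

Section Powers.
Context {R : realType}.
Implicit Types (x y r m : R).

Lemma powR_ge_id x r : 0 < r <= 1 -> 0 <= x <= 1 -> x <= x `^ r.
Proof.
move=> /andP[r0 r1] /andP[x0 x1]; have [->|xn0] := eqVneq x 0.
  by rewrite powR_ge0.
by rewrite ger1_powR// lt_neqAle eq_sym xn0 x0.
Qed.

Lemma powR_ge_one x r : 0 < r -> 1 <= x -> 1 <= x `^ r.
Proof.
move=> r0 x1; have := @ge0_ler_powR _ r (ltW r0) 1 x.
by rewrite !nnegrE ler01 powR1; apply=> //; exact: le_trans x1.
Qed.

Lemma interpolate_powR (k m r t : R) : 0 < r <= 1 -> 0 <= k -> 0 <= m ->
  t <= k -> t <= k * m -> t <= k * m `^ r.
Proof.
move=> r01 k0 m0 tk tkm; have [m1|m1] := leP m 1.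
  by rewrite (le_trans tkm)// ler_wpM2l// powR_ge_id// m0.
rewrite (le_trans tk)// ler_peMr// powR_ge_one//; first by case/andP: r01.
exact: ltW.
Qed.

End Powers.

Section FourPoint.
Context {R : realType} (rho : R).
Hypothesis rho01 : 0 < rho <= 1.

Section FourPointDefs.
Context {E F : normedModType R}.
Implicit Types (k : R) (f : E -> F).

(** The form in which C^(1+rho) regularity is used.  For b = d it says that f
    is k-Lipschitz. *)
Definition fourpt k f := forall (a b c d : E) (m : R),
  `|a - b| <= m -> `|c - d| <= m ->
  `|f a - f b - f c + f d| <= k * (`|a - b - c + d| + m `^ rho * `|b - d|).

(** A single constant k for the size and the regularity of f.  All the fields of
    a driver are tame with a power of (t-s)^(1/p) in place of k. *)
Definition tame k f := [/\ 0 <= k, forall x, `|f x| <= k & fourpt k f].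

Lemma tame_ge0 k f : tame k f -> 0 <= k. Proof. by case. Qed.
Lemma tame_le k f x : tame k f -> `|f x| <= k. Proof. by case. Qed.

Lemma fourpt_lip k f x y : fourpt k f -> `|f x - f y| <= k * `|x - y|.
Proof.
move=> /(_ x y y y `|x - y|); rewrite lexx subrr normr0 normr_ge0 !subrK.
by rewrite mulr0 addr0; apply.
Qed.

Lemma tame_lip k f x y : tame k f -> `|f x - f y| <= k * `|x - y|.
Proof. by case=> _ _; apply: fourpt_lip. Qed.

(** A bounded Lipschitz map is also Hoelder, at all distances. *)
Lemma tame_lip_powR k f x y m : tame k f -> `|x - y| <= m ->
  `|f x - f y| <= 2 * k * m `^ rho.
Proof.
move=> tf xm; have k0 := tame_ge0 tf; have m0 := le_trans (normr_ge0 _) xm.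
apply: interpolate_powR => //; first by lra.
  rewrite (le_trans (ler_normB _ _))//.
  have := tame_le x tf; have := tame_le y tf; lra.
have := tame_lip x y tf; have := ler_wpM2l k0 xm; nra.
Qed.

Lemma tame_mono k k' f : k <= k' -> tame k f -> tame k' f.
Proof.
move=> kk' [k0 bf pf]; split; first exact: le_trans kk'.
  by move=> x; apply: le_trans kk'.
move=> a b c d m h1 h2; rewrite (le_trans (pf a b c d m h1 h2))// ler_wpM2r//.
by rewrite addr_ge0// mulr_ge0// powR_ge0.
Qed.

Lemma tameD k k' f g : tame k f -> tame k' g ->
  tame (k + k') (fun x => f x + g x).
Proof.
move=> [k0 bf pf] [k0' bg pg]; split; first exact: addr_ge0.
  by move=> x; rewrite (le_trans (ler_normD _ _))// lerD.
move=> a b c d m h1 h2; rewrite mulrDl.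
apply: le_trans (lerD (pf a b c d m h1 h2) (pg a b c d m h1 h2)).
apply: le_trans (ler_normD _ _); rewrite le_eqVlt; apply/orP; left; apply/eqP.
by congr (`|_|); vring.
Qed.

Lemma tameZ k r f : tame k f -> tame (`|r| * k) (fun x => r *: f x).
Proof.
move=> [k0 bf pf]; split; first exact: mulr_ge0.
  by move=> x; rewrite normrZ ler_wpM2l.
move=> a b c d m h1 h2; rewrite -mulrA.
have -> : r *: f a - r *: f b - r *: f c + r *: f d =
  r *: (f a - f b - f c + f d) by vring.
by rewrite normrZ ler_wpM2l// pf.
Qed.

Lemma tameN k f : tame k f -> tame k (fun x => - f x).
Proof.
move=> /(tameZ (-1)); rewrite normrN normr1 mul1r => h.
by have -> : (fun x => - f x) = (fun x => -1 *: f x)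
  by apply/funext => x; rewrite scaleN1r.
Qed.

Lemma tame0 f : (forall x, f x = 0) -> tame 0 f.
Proof.
move=> f0; split=> // [x|a b c d m _ _]; first by rewrite f0 normr0.
by rewrite !f0 !subrr addr0 normr0 mul0r.
Qed.

End FourPointDefs.

(** The Lipschitz estimate of the displacement x |-> f (x + g x) - f x. *)
Lemma fourpt_shift (E F : normedModType R) k l m (f : E -> F) (g : E -> E) x y :
  tame k f -> fourpt l g -> (forall x, `|g x| <= m) ->
  `|f (x + g x) - f x - f (y + g y) + f y| <= k * (l + m `^ rho) * `|x - y|.
Proof.
move=> [k0 _ pf] lg gm; have := pf (x + g x) x (y + g y) y m.
have e z : z + g z - z = g z by rewrite addrAC subrr add0r.
rewrite !e => /(_ (gm _) (gm _)) /le_trans; apply.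
rewrite -mulrA ler_wpM2l// mulrDl lerD2r.
by rewrite (_ : _ + y = g x - g y) ?fourpt_lip//; vring.
Qed.


(** Leibniz rule for four-point differences: the product splits into two terms
    where one factor carries the whole difference, and two cross terms where
    each factor carries a two-point difference; in a cross term one of the two
    differences is estimated by m^rho. *)
Lemma tame_apply (E F G : normedModType R) k l (M : E -> clin F G) (w : E -> F) :
  tame k M -> tame l w -> tame (6 * k * l) (fun x => M x (w x)).
Proof.
move=> tM tw; have k0 := tame_ge0 tM; have l0 := tame_ge0 tw.
split; first by rewrite !mulr_ge0.
  move=> x; rewrite (le_trans (clin_apply_le _ _))//.
  have := tame_le x tM; have := tame_le x tw; have := normr_ge0 (w x); nra.
move=> a b c d m h1 h2.
have -> : M a (w a) - M b (w b) - M c (w c) + M d (w d) =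
  (M a - M b - M c + M d) (w a) + (M c - M d) (w a - w c) +
  (M b - M d) (w a - w b) + M d (w a - w b - w c + w d).
  by rewrite !clinE; vring.
set X := `|a - b - c + d|; set Y := `|b - d|; set P := m `^ rho.
have X0 : 0 <= X by exact: normr_ge0. have Y0 : 0 <= Y by exact: normr_ge0.
have P0 : 0 <= P by exact: powR_ge0.
have Yac : `|a - c| <= X + Y.
  by rewrite (_ : a - c = (a - b - c + d) + (b - d)) ?ler_normD//; vring.
have h3 : `|M a - M b - M c + M d| * `|w a| <= k * (X + P * Y) * l.
  by rewrite ler_pM// ?(tame_le _ tw)//; case: tM => _ _ h; exact: h.
have h4 : `|M c - M d| * `|w a - w c| <= 2 * k * l * X + 2 * k * P * (l * Y).
  have q1 : `|w a - w c| <= l * X + l * Y.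
    by rewrite -mulrDr (le_trans (tame_lip _ _ tw))// ler_wpM2l.
  have q2 : `|M c - M d| <= 2 * k * P by exact: tame_lip_powR.
  have q3 : `|M c - M d| <= 2 * k.
    rewrite (le_trans (ler_normB _ _))//.
    by have := tame_le c tM; have := tame_le d tM; lra.
  have lX : 0 <= l * X by rewrite mulr_ge0.
  have lY : 0 <= l * Y by rewrite mulr_ge0.
  rewrite (le_trans (ler_wpM2l _ q1))// mulrDr lerD//.
    by rewrite -(mulrA _ l) ler_wpM2r.
  by rewrite ler_wpM2r.
have h5 : `|M b - M d| * `|w a - w b| <= k * Y * (2 * l * P).
  by rewrite ler_pM// ?(tame_lip _ _ tM)// tame_lip_powR.
have h6 : `|M d| * `|w a - w b - w c + w d| <= k * (l * (X + P * Y)).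
  by rewrite ler_pM// ?(tame_le _ tM)//; case: tw => _ _ h; exact: h.
apply: le_trans (ler_norm4 _ _ _ _) _.
apply: le_trans (lerD (lerD (lerD (clin_apply_le _ _) (clin_apply_le _ _))
  (clin_apply_le _ _)) (clin_apply_le _ _)) _.
apply: le_trans (lerD (lerD (lerD h3 h4) h5) h6) _.
rewrite [leRHS](_ : _ = k * (X + P * Y) * l + (2 * k * l * X + 2 * k * P * (l * Y)) +
  k * Y * (2 * l * P) + k * (l * (X + P * Y)) + 2 * (k * l * X)); last by ring.
by rewrite lerDl !mulr_ge0.
Qed.

Section C1.
Context {E F : normedModType R} (f : E -> F) (k : R).
Hypothesis df : forall x, differentiable f x.
Hypothesis bD : forall x, `|Dmap f x| <= k.

Lemma lip_of_Dmap x y : `|f x - f y| <= k * `|x - y|.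
Proof.
have := @mean_value_ineq _ _ (fun u => f (y + u *: (x - y))) (k * `|x - y|).
rewrite scale1r scale0r addr0 subrKC; apply => u _.
exists ('d f (y + u *: (x - y)) (x - y)); first exact: has_velocity_line.
by rewrite -DmapE// (le_trans (clin_apply_le _ _))// ler_wpM2r.
Qed.

Hypothesis hD : forall x y, `|Dmap f x - Dmap f y| <= k * `|x - y| `^ rho.

(** Apply the mean value inequality to f along the segment from c to a minus f
    along the segment from d to b; the two current points stay at distance at
    most m, whence the factor m^rho. *)
Lemma C1_fourpt : fourpt k f.
Proof.
move=> a b c d m h1 h2.
have k0 : 0 <= k by apply: le_trans (bD 0).
have m0 : 0 <= m by apply: le_trans h1.
pose P u := c + u *: (a - c); pose Q u := d + u *: (b - d).
have := @mean_value_ineq _ _ (fun u => f (P u) - f (Q u))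
  (k * (`|a - b - c + d| + m `^ rho * `|b - d|)).
rewrite /P /Q !scale1r !scale0r !addr0 !subrKC.
rewrite (_ : f a - f b - (f c - f d) = f a - f b - f c + f d); last by vring.
apply=> u /andP[u0 u1]; rewrite -/(P u) -/(Q u).
exists ('d f (P u) (a - c) - 'd f (Q u) (b - d)).
  by apply: has_velocityB; exact: has_velocity_line.
rewrite -!DmapE//.
have -> : Dmap f (P u) (a - c) - Dmap f (Q u) (b - d) =
   Dmap f (P u) (a - b - c + d) + (Dmap f (P u) - Dmap f (Q u)) (b - d).
  by move: (Dmap f (P u)) (Dmap f (Q u)) => M1 M2; rewrite !clinE; vring.
rewrite (le_trans (ler_normD _ _))// mulrDr lerD//.
  by rewrite (le_trans (clin_apply_le _ _))// ler_wpM2r.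
rewrite (le_trans (clin_apply_le _ _))// mulrA ler_wpM2r//.
rewrite (le_trans (hD _ _))// ler_wpM2l// ge0_ler_powR ?nnegrE//.
  by case/andP: rho01 => /ltW.
have -> : P u - Q u = (1 - u) *: (c - d) + u *: (a - b) by rewrite /P /Q; vring.
rewrite (le_trans (ler_normD _ _))// !normrZ !ger0_norm ?subr_ge0//.
nra.
Qed.

End C1.
End FourPoint.

(** * Compositions of approximate steps *)

Section Discrete.
Context {R : realType} {E : normedModType R}.
Implicit Types (N F G : nat -> E -> E).

Fixpoint iter_steps N (i d : nat) (x : E) : E :=
  if d is d'.+1 then iter_steps N i.+1 d' (N i x) else x.

Lemma iter_steps_add N i d e x :
  iter_steps N i (d + e) x = iter_steps N (i + d) e (iter_steps N i d x).
Proof.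
elim: d i x => [|d IH] i x; first by rewrite add0n addn0.
by rewrite addSn /= IH addSnnS.
Qed.

(** Replace the steps of G by those of F one at a time: each replacement costs
    e, amplified by the Lipschitz constant of the remaining steps of F. *)
Lemma telescoping F G (L e : R) (i d : nat) :
  (forall j k x y, (j + k <= i + d)%N ->
    `|iter_steps F j k x - iter_steps F j k y| <= L * `|x - y|) ->
  (forall k x, (i <= k < i + d)%N -> `|F k x - G k x| <= e) ->
  0 <= L ->
  forall x, `|iter_steps F i d x - iter_steps G i d x| <= d%:R * (L * e).
Proof.
elim: d i => [|d IH] i Flip FG L0 x /=.
  by rewrite subrr normr0 mul0r.
rewrite -(subrKA (iter_steps F i.+1 d (G i x))) (le_trans (ler_normD _ _))//.
rewrite -natr1 mulrDl mul1r addrC lerD//.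
  apply: IH => // [j k y z jk|k y ik]; first by apply: Flip; rewrite addSnnS in jk.
  by apply: FG; case/andP: ik => /ltnW -> ; rewrite addSnnS.
rewrite (le_trans (Flip _ _ _ _ _)) ?addSnnS// ler_wpM2l// FG//.
by rewrite leqnn -[X in (X < _)%N]addn0 ltn_add2l.
Qed.

End Discrete.

Section Glue.
Context {R : realType} {E : normedModType R} (rho : R).
Hypothesis rho01 : 0 < rho <= 1.
Implicit Types (f g n : E -> E).

Definition close_maps (e l : R) f g : Prop :=
  (forall x, `|f x - g x| <= e) /\
  (forall x y, `|(f x - g x) - (f y - g y)| <= l * `|x - y|).

Lemma close_maps_refl f : close_maps 0 0 f f.
Proof. by split=> [x|x y]; rewrite !subrr normr0// mul0r. Qed.

Lemma close_maps_le e e' l l' f g : e <= e' -> l <= l' ->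
  close_maps e l f g -> close_maps e' l' f g.
Proof.
move=> ee ll [h1 h2]; split=> [x|x y]; first exact: le_trans ee.
by rewrite (le_trans (h2 x y))// ler_wpM2r.
Qed.

Lemma tame_id_lip k n x y : tame rho k (fun x => n x - x) ->
  `|n x - n y| <= (1 + k) * `|x - y|.
Proof.
move=> /(tame_lip x y) h; rewrite (_ : n x - n y = (x - y) + ((n x - x) - (n y - y))).
  by rewrite (le_trans (ler_normD _ _))// mulrDl mul1r lerD2l.
by vring.
Qed.

Lemma close_maps_lip e l k f n x y : close_maps e l f n ->
  tame rho k (fun x => n x - x) -> `|f x - f y| <= (1 + k + l) * `|x - y|.
Proof.
move=> [_ fn] /(tame_id_lip x y) nl.
rewrite (_ : f x - f y = (n x - n y) + ((f x - n x) - (f y - n y))).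
  by rewrite (le_trans (ler_normD _ _))// mulrDl lerD.
by vring.
Qed.

(** Error propagation for one composition.  Writing f2 o f1 - n as
    (f2 - n2) o f1 + (n2 o f1 - n2 o n1) + (n2 o n1 - n), the middle term is the
    only nonlinear one: its Lipschitz constant is controlled by the four-point
    estimate of n2 - id, which produces the power e1^rho of the uniform error. *)
Lemma close_maps_comp k eps e1 l1 e2 l2 e l f1 n1 f2 n2 n :
  0 <= l2 ->
  tame rho k (fun x => n1 x - x) -> tame rho k (fun x => n2 x - x) ->
  close_maps e1 l1 f1 n1 -> close_maps e2 l2 f2 n2 ->
  close_maps e l (n2 \o n1) n -> 0 <= l1 -> k + l1 <= eps ->
  close_maps (e2 + (1 + eps) * e1 + e)
    ((1 + eps) * l2 + ((1 + eps) * l1 + (1 + eps) * (k * e1 `^ rho) + l))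
    (f2 \o f1) n.
Proof.
move=> l20 t1 t2 c1 c2 [ce cl] l10 kl.
have k0 := tame_ge0 t1.
have e10 : 0 <= e1 by apply: le_trans (c1.1 0).
have e0 : 0 <= 1 + eps by lra.
have lf1 x y : `|f1 x - f1 y| <= (1 + eps) * `|x - y|.
  by rewrite (le_trans (close_maps_lip _ _ c1 t1))// ler_wpM2r//; lra.
have ln1 x y : `|n1 x - n1 y| <= (1 + eps) * `|x - y|.
  by rewrite (le_trans (tame_id_lip _ _ t1))// ler_wpM2r//; lra.
have ln2 x y : `|n2 x - n2 y| <= (1 + eps) * `|x - y|.
  by rewrite (le_trans (tame_id_lip _ _ t2))// ler_wpM2r//; lra.
case: (c1) (c2) => ce1 cl1 [ce2 cl2].
split=> [x|x y] /=.
  have -> : f2 (f1 x) - n x =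
    (f2 (f1 x) - n2 (f1 x)) + (n2 (f1 x) - n2 (n1 x)) + (n2 (n1 x) - n x).
    by vring.
  apply: le_trans (ler_normD _ _) _; apply: lerD; last exact: ce.
  apply: le_trans (ler_normD _ _) _; apply: lerD; first exact: ce2.
  by rewrite (le_trans (ln2 _ _))// ler_wpM2l//; lra.
have -> : f2 (f1 x) - n x - (f2 (f1 y) - n y) =
   (f2 (f1 x) - n2 (f1 x) - (f2 (f1 y) - n2 (f1 y))) +
   (n2 (f1 x) - n2 (n1 x) - n2 (f1 y) + n2 (n1 y)) +
   (n2 (n1 x) - n x - (n2 (n1 y) - n y)) by vring.
have b1 : `|f2 (f1 x) - n2 (f1 x) - (f2 (f1 y) - n2 (f1 y))| <=
    l2 * ((1 + eps) * `|x - y|).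
  by rewrite (le_trans (cl2 _ _))// ler_wpM2l.
have b3 := cl x y; rewrite /= in b3.
suff b2 : `|n2 (f1 x) - n2 (n1 x) - n2 (f1 y) + n2 (n1 y)| <=
    ((1 + eps) * l1 + (1 + eps) * (k * e1 `^ rho)) * `|x - y|.
  apply: le_trans (ler_normD _ _) _.
  apply: le_trans (lerD (ler_normD _ _) (lexx _)) _.
  lra.
set D := f1 x - n1 x - f1 y + n1 y.
have hD : `|D| <= l1 * `|x - y|.
  by rewrite (_ : D = f1 x - n1 x - (f1 y - n1 y)) ?cl1// /D; vring.
have -> : n2 (f1 x) - n2 (n1 x) - n2 (f1 y) + n2 (n1 y) = D +
  ((n2 (f1 x) - f1 x) - (n2 (n1 x) - n1 x) - (n2 (f1 y) - f1 y) + (n2 (n1 y) - n1 y)).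
  by rewrite /D; vring.
have [_ _ /(_ _ _ _ _ e1 (ce1 x) (ce1 y)) h4] := t2.
rewrite -/D in h4.
apply: le_trans (ler_normD _ _) _.
have P0 : 0 <= k * e1 `^ rho by rewrite mulr_ge0// powR_ge0.
have := ler_wpM2l P0 (ln1 x y).
have := normr_ge0 (x - y); have := normr_ge0 D.
move: h4 hD k0 P0 kl l10.
set P := e1 `^ rho; set X := `|x - y|; set Y := `|n1 x - n1 y|; set dd := `|D|.
move=> h4 hD k0 P0 kl l10 d0 X0 h5.
have q1 : k * dd <= eps * (l1 * X).
  by apply: ler_pM => //; lra.
nra.
Qed.

End Glue.

Section SewingConstants.
Context {R : realType}.
Implicit Types (a b q K M N A B : R).

Lemma half_powR_lt1 a : 1 < a -> 0 < (2^-1 : R) `^ (a - 1) < 1.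
Proof.
move=> a1; rewrite powR_gt0//=.
have := @gt0_ltr_powR R (a - 1) _ (2^-1) 1.
by rewrite powR1; apply; rewrite ?subr_gt0// ?nnegrE ?invf_lt1// ?ltr1n.
Qed.

(** An interval of at most half the length has an error smaller by the factor
    2^(-b) <= q / 2, where q = 2^(1-a) < 1. *)
Lemma half_powR a b x t : 1 < a -> a <= b -> 0 <= x -> x <= t / 2 ->
  x `^ b <= ((2^-1 : R) `^ (a - 1)) / 2 * t `^ b.
Proof.
move=> a1 ab x0 xt; have t0 : 0 <= t by lra.
have b0 : 0 <= b by lra.
apply: (@le_trans _ _ ((t / 2) `^ b)).
  by rewrite ge0_ler_powR ?nnegrE//; lra.
rewrite powRM//.
rewrite mulrC ler_wpM2r ?powR_ge0//.
have -> : (2^-1 : R) `^ (a - 1) / 2 = 2^-1 `^ a.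
  by rewrite mulrC mulr_powRB1//; lra.
by rewrite ger_powR// invr_gt0 ltr0n/= invf_le1// ler1n.
Qed.

Lemma small_power g c : 0 < g -> 0 < c ->
  exists2 d : R, 0 < d <= 1 & d `^ g <= c.
Proof.
move=> g0 c0; exists (Num.min 1 (c `^ g^-1)).
  by rewrite lt_min ltr01 powR_gt0//= ge_min lexx.
have m0 : 0 <= Num.min 1 (c `^ g^-1) by rewrite le_min ler01 powR_ge0.
have ec : (c `^ g^-1) `^ g = c by rewrite -powRrM mulVf ?gt_eqF// powRr1// ltW.
by rewrite -[leRHS]ec ge0_ler_powR ?nnegrE ?powR_ge0// ?(ltW g0)// ge_min lexx orbT.
Qed.

(** The error M B is reproduced by the middle-splitting argument: the two halves
    contribute at most q M B, up to the factors 1 + eps, and the choice of M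
    makes the remaining fraction of M B absorb the defects K B. *)
Lemma sewing_closure q eps K M B e1 : 0 <= q <= 1 -> 0 <= eps ->
  eps <= (1 - q) / 8 -> 0 <= K -> 0 <= B -> 0 <= M ->
  M * (1 - q) = 6 * K -> e1 <= (1 + eps) * (M * (q / 2 * B)) + K * B ->
  (1 + eps) * (M * (q / 2 * B)) + ((1 + eps) * e1 + K * B) <= M * B.
Proof.
move=> /andP[q0 q1] e0 eq K0 B0 M0 hM he1.
have KB0 : 0 <= K * B by exact: mulr_ge0.
have MB0 : 0 <= M * B by exact: mulr_ge0.
have MBq0 : 0 <= M * B * q by exact: mulr_ge0.
have hMB : M * B * (1 - q) = 6 * (K * B) by rewrite mulrAC hM mulrA.
have e1' : (1 + eps) * e1 <= (1 + eps) * ((1 + eps) * (M * (q / 2 * B)) + K * B).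
  by rewrite ler_wpM2l//; lra.
move: MB0 MBq0 hMB KB0 e1'.
set X := M * B; set Y := K * B => MB0 MBq0 hMB KB0 e1'.
have -> : M * (q / 2 * B) = X * q / 2 by rewrite /X; field.
have e18 : eps <= 1 / 8 by lra.
have e2 : (1 + eps) * (1 + eps) <= 1 + 3 * eps by nra.
have h1 : (1 + eps) * ((1 + eps) * (X * q / 2)) <= (1 + 3 * eps) * (X * q / 2).
  by rewrite mulrA ler_wpM2r//; lra.
have h2 : eps * (X * q) <= (1 - q) / 8 * X.
  apply: ler_pM => //; nra.
have h3 : eps * Y <= 1 / 8 * Y by rewrite ler_wpM2r.
move: e1'; rewrite (_ : M * (q / 2 * B) = X * q / 2); last by rewrite /X; field.
lra.
Qed.

End SewingConstants.

(** * Sewing on a grid *)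

Section AlmostFlow.
Context {R : realType} {E : normedModType R}.
Variables (T K a b gam rho : R).

(** The properties of nu from which a flow can be sewn.  The exponents are: gam
    for the size of a step, b for the uniform size of the defect, a for its
    Lipschitz constant.  Time continuity allows arbitrary times to be replaced by
    grid points. *)
Record almost_flow (nu : R -> R -> E -> E) : Prop := AlmostFlow {
  af_id : forall t x, 0 <= t -> t <= T -> nu t t x = x;
  af_tame : forall s t : R, 0 <= s -> s <= t -> t <= T -> t - s <= 1 ->
    tame rho (K * (t - s) `^ gam) (fun x => nu t s x - x);
  af_defect : forall s u t : R, 0 <= s -> s <= u -> u <= t -> t <= T -> t - s <= 1 ->
    close_maps (K * (t - s) `^ b) (K * (t - s) `^ a)
      (nu t u \o nu u s) (nu t s);
  af_time : forall s s' t t' h x, 0 <= s' -> s' <= s -> s <= t' -> t' <= t ->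
    t <= T -> t - s' <= 1 -> s - s' <= h -> t - t' <= h ->
    `|nu t s x - nu t' s' x| <= K * h `^ gam
}.

Definition grid_step (nu : R -> R -> E -> E) (h : R) (k : nat) : E -> E :=
  nu (k.+1%:R * h) (k%:R * h).

End AlmostFlow.

Section Constants.
Context {R : realType}.
Variables (K a gam rho : R).
Hypothesis a1 : 1 < a.
Hypothesis gam0 : 0 < gam.
Hypothesis K0 : 0 <= K.

(** Order of the choices: q from the exponent, then the uniform constant M, then
    the Lipschitz constant N, which depends on M through M^rho, then the scale
    d below which all the Lipschitz constants are within eps of 1. *)
Lemma sewing_constants : exists q eps M N d : R,
  [/\ 0 < q < 1, q = 2^-1 `^ (a - 1), 0 <= eps & eps <= (1 - q) / 8] /\
  [/\ 0 <= M, 0 <= N, M * (1 - q) = 6 * K &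
      N * (1 - q) = 6 * (K * (2 * M `^ rho + 1))] /\
  0 < d <= 1 /\
  forall t : R, 0 <= t -> t <= d -> K * t `^ gam + N * t `^ a <= eps.
Proof.
have := half_powR_lt1 a1; set q := _ `^ _ => /andP[q0 q1].
exists q, ((1 - q) / 8), (6 * K / (1 - q)).
set M := 6 * K / (1 - q).
have M0 : 0 <= M by rewrite divr_ge0 ?mulr_ge0// subr_ge0 ltW.
have c0 : 0 <= 6 * (K * (2 * M `^ rho + 1)).
  by rewrite !mulr_ge0// addr_ge0// mulr_ge0// powR_ge0.
have [N NE] : exists N, N * (1 - q) = 6 * (K * (2 * M `^ rho + 1)).
  exists (6 * (K * (2 * M `^ rho + 1)) / (1 - q)).
  by rewrite divfK// gt_eqF// subr_gt0.
have N0 : 0 <= N by rewrite -(pmulr_lge0 _ (_ : 0 < 1 - q)) ?subr_gt0// NE.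
have e0 : 0 < (1 - q) / 8 by rewrite divr_gt0// subr_gt0.
have KN : 0 < K + N + 1 by rewrite ltr_wpDl// addr_ge0.
have : 0 < (1 - q) / 8 / (K + N + 1) by rewrite divr_gt0.
have : (1 - q) / 8 = (K + N + 1) * ((1 - q) / 8 / (K + N + 1)).
  by rewrite [RHS]mulrC divfK// gt_eqF.
move: ((1 - q) / 8 / (K + N + 1)) => c cE c0'.
have [d /andP[d0 d1] dg] := small_power gam0 c0'.
have [d' /andP[d'0 d'1] dg'] := small_power (lt_trans ltr01 a1) c0'.
exists N, (Num.min d d'); split; first by split=> //; [rewrite q0|exact: ltW].
split; first by split=> //; rewrite /M divfK// gt_eqF// subr_gt0.
split; first by rewrite lt_min d0 d'0 ge_min d1.
move=> t t0; rewrite le_min => /andP[td td'].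
have h1 : t `^ gam <= c.
  by rewrite (le_trans _ dg)// ge0_ler_powR ?nnegrE// ?ltW.
have h2 : t `^ a <= c.
  by rewrite (le_trans _ dg')// ge0_ler_powR ?nnegrE// ?ltW// (lt_trans ltr01).
have := ler_wpM2l K0 h1; have := ler_wpM2l N0 h2; lra.
Qed.

End Constants.

(** Split n + 1 steps into m steps, a single step and e steps, such that neither
    m nor e exceeds half of the total.  A plain splitting into two parts would
    leave one part longer than half when n + 1 is odd. *)
Lemma split_middle n : exists m e,
  [/\ n.+1 = (m + 1 + e)%N, (2 * m <= n.+1)%N & (2 * e <= n.+1)%N].
Proof. by exists n./2, (n - n./2)%N; split; lia. Qed.

Section DiscreteSewing.
Context {R : realType} {E : normedModType R}.
Variables (T K a b gam rho : R).
Hypothesis rho01 : 0 < rho <= 1.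
Hypothesis a1 : 1 < a.
Hypothesis ab : a <= b.
Hypothesis gam0 : 0 < gam.
Hypothesis agr : a <= gam + rho * b.
Hypothesis K0 : 0 <= K.

Variables q eps M N d : R.
Hypothesis q01 : 0 < q < 1.
Hypothesis qE : q = 2^-1 `^ (a - 1).
Hypothesis eps0 : 0 <= eps.
Hypothesis eps_le : eps <= (1 - q) / 8.
Hypothesis M0 : 0 <= M.
Hypothesis N0 : 0 <= N.
Hypothesis ME : M * (1 - q) = 6 * K.
Hypothesis NE : N * (1 - q) = 6 * (K * (2 * M `^ rho + 1)).
Hypothesis d01 : 0 < d <= 1.
Hypothesis dP : forall t : R, 0 <= t -> t <= d -> K * t `^ gam + N * t `^ a <= eps.
Variable nu : R -> R -> E -> E.
Hypothesis nuP : almost_flow T K a b gam rho nu.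

(** The composition estimate for an almost flow at scale d, where the nonlinear
    contribution k e1^rho is absorbed in (t-s)^a thanks to a <= gam + rho b. *)
Lemma sewing_glue (s u t e1 l1 e2 l2 : R) f1 f2 : 0 <= s -> s <= u -> u <= t ->
  t <= T -> t - s <= d -> 0 <= l1 -> 0 <= l2 ->
  l1 <= N * (t - s) `^ a -> e1 <= M * (t - s) `^ b ->
  close_maps e1 l1 f1 (nu u s) -> close_maps e2 l2 f2 (nu t u) ->
  close_maps (e2 + ((1 + eps) * e1 + K * (t - s) `^ b))
    ((1 + eps) * l2 + ((1 + eps) * l1 + K * (2 * M `^ rho + 1) * (t - s) `^ a))
    (f2 \o f1) (nu t s).
Proof.
move=> s0 su ut tT tsd l10 l20 l1N e1M c1 c2.
move: (K0) (a1) (ab) (gam0) (eps0) (eps_le) (M0) (N0) => K_ge0 a_gt1 a_le_b gam_gt0 eps_ge0 eps_small M_ge0 N_ge0.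
have /andP[d0 d1] := d01; have /andP[r0 r1] := rho01.
have ts0 : 0 <= t - s by lra.
have ts1 : t - s <= 1 by lra.
have e10 : 0 <= e1 by apply: le_trans (c1.1 0).
have mono x : 0 <= x -> x <= t - s -> K * x `^ gam <= K * (t - s) `^ gam.
  by move=> x0 xt; rewrite ler_wpM2l// ge0_ler_powR ?nnegrE// ltW.
have t1 : tame rho (K * (t - s) `^ gam) (fun x => nu u s x - x).
  by apply: tame_mono (af_tame nuP _ _ _ _); rewrite ?mono//; lra.
have t2 : tame rho (K * (t - s) `^ gam) (fun x => nu t u x - x).
  by apply: tame_mono (af_tame nuP _ _ _ _); rewrite ?mono//; lra.
have keps := dP ts0 tsd.
have e1' : eps <= 1 by case/andP: q01 => ? ?; lra.
have kl : K * (t - s) `^ gam + l1 <= eps by lra.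
apply: close_maps_le (close_maps_comp l20 t1 t2 c1 c2
  (af_defect nuP s0 su ut tT ts1) l10 kl); first by rewrite addrA.
rewrite lerD2l -addrA lerD2l.
have Z : K * (t - s) `^ gam * e1 `^ rho <= K * M `^ rho * (t - s) `^ a.
  rewrite -!mulrA ler_wpM2l//.
  apply: (@le_trans _ _ ((t - s) `^ gam * (M * (t - s) `^ b) `^ rho)).
    rewrite ler_wpM2l ?powR_ge0// ge0_ler_powR ?nnegrE// ?(ltW r0)//.
    by rewrite mulr_ge0// powR_ge0.
  rewrite powRM ?powR_ge0// mulrCA ler_wpM2l ?powR_ge0//.
  have [->|tsn0] := eqVneq (t - s) 0.
    by rewrite powR0 ?gt_eqF// mul0r powR_ge0.
  rewrite -powRrM (mulrC b) -powRD; last by apply/implyP.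
  by rewrite ger_powR// lt_neqAle eq_sym tsn0 ts0.
have Z0 : 0 <= K * (t - s) `^ gam * e1 `^ rho.
  by rewrite !mulr_ge0// powR_ge0.
nra.
Qed.

(** Strong induction on the number of steps.  The single step in the middle is
    exact, so only the two outer parts carry an error. *)
Lemma discrete_sewing (h : R) i n : 0 <= h -> (i + n)%:R * h <= T -> n%:R * h <= d ->
  close_maps (M * (n%:R * h) `^ b) (N * (n%:R * h) `^ a)
    (iter_steps (grid_step nu h) i n) (nu ((i + n)%:R * h) (i%:R * h)).
Proof.
move: (K0) (a1) (ab) (gam0) (eps0) (eps_le) (M0) (N0) => K_ge0 a_gt1 a_le_b gam_gt0 eps_ge0 eps_small M_ge0 N_ge0.
move=> h0; elim/ltn_ind: n i => n IH i iT nd.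
have /andP[q0 q1] := q01.
have p0 (k : nat) : 0 <= k%:R * h by rewrite mulr_ge0.
have le_h (k l : nat) : (k <= l)%N -> k%:R * h <= l%:R * h.
  by move=> kl; rewrite ler_wpM2r// ler_nat.
case: n IH iT nd => [|n] IH iT nd.
  split=> [x|x y] /=; rewrite addn0 !(af_id nuP) ?subrr ?normr0 ?mulr_ge0 ?powR_ge0//;
  by rewrite addn0 in iT.
have [m [e [nme m2 e2]]] := split_middle n.
have mn : (m < n.+1)%N by clear -nme; lia.
have en : (e < n.+1)%N by clear -nme; lia.
have half (k : nat) c : (2 * k <= n.+1)%N -> a <= c ->
    (k%:R * h) `^ c <= q / 2 * (n.+1%:R * h) `^ c.
  move=> kn ac; rewrite qE; apply: half_powR => //.
  rewrite ler_pdivlMr// mulrAC -natrM.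
  by rewrite ler_wpM2r// ler_nat mulnC.
have diff (k l : nat) : ((k + l)%:R * h - k%:R * h = l%:R * h) by rewrite natrD mulrDl addrAC subrr add0r.
have cm : close_maps (M * (m%:R * h) `^ b) (N * (m%:R * h) `^ a)
    (iter_steps (grid_step nu h) i m) (nu ((i + m)%:R * h) (i%:R * h)).
  apply: IH => //.
    by apply: le_trans iT; apply: le_h; clear -nme; lia.
  by apply: le_trans nd; apply: le_h; clear -nme; lia.
have ce : close_maps (M * (e%:R * h) `^ b) (N * (e%:R * h) `^ a)
    (iter_steps (grid_step nu h) (i + (m + 1)) e)
    (nu ((i + n.+1)%:R * h) ((i + (m + 1))%:R * h)).
  have ie : (i + n.+1 = i + (m + 1) + e)%N by rewrite nme addnA.
  rewrite ie; apply: IH => //; first by rewrite -ie.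
  by apply: le_trans nd; apply: le_h; clear -nme; lia.
have c1 : close_maps 0 0 (grid_step nu h (i + m))
   (nu ((i + (m + 1))%:R * h) ((i + m)%:R * h)).
  by rewrite addn1 addnS; exact: close_maps_refl.
set B := (n.+1%:R * h) `^ b; set A := (n.+1%:R * h) `^ a.
have B0 : 0 <= B by exact: powR_ge0.
have A0 : 0 <= A by exact: powR_ge0.
have hm : close_maps (M * (q / 2 * B)) (N * (q / 2 * A))
    (iter_steps (grid_step nu h) i m) (nu ((i + m)%:R * h) (i%:R * h)).
  by apply: close_maps_le cm; rewrite ler_wpM2l// half//.
have he : close_maps (M * (q / 2 * B)) (N * (q / 2 * A))
    (iter_steps (grid_step nu h) (i + (m + 1)) e)
    (nu ((i + n.+1)%:R * h) ((i + (m + 1))%:R * h)).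
  by apply: close_maps_le ce; rewrite ler_wpM2l// half//.
have qB : q / 2 * B <= B by rewrite ler_piMl//; lra.
have qA : q / 2 * A <= A by rewrite ler_piMl//; lra.
have MqB0 : 0 <= M * (q / 2 * B) by rewrite !mulr_ge0// ltW.
have NqA0 : 0 <= N * (q / 2 * A) by rewrite !mulr_ge0// ltW.
have K'0 : 0 <= K * (2 * M `^ rho + 1).
  by rewrite mulr_ge0// addr_ge0// mulr_ge0// powR_ge0.
have KB0 : 0 <= K * B by rewrite mulr_ge0.
have K'A0 : 0 <= K * (2 * M `^ rho + 1) * A by rewrite mulr_ge0.
have q01' : 0 <= q <= 1 by rewrite !ltW.
set e12 := (1 + eps) * (M * (q / 2 * B)) + K * B.
set l12 := (1 + eps) * (N * (q / 2 * A)) + K * (2 * M `^ rho + 1) * A.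
have e120 : 0 <= e12 by rewrite addr_ge0// mulr_ge0// addr_ge0.
have l120 : 0 <= l12 by rewrite addr_ge0// mulr_ge0// addr_ge0.
have closeB := sewing_closure q01' eps_ge0 eps_small K_ge0 B0 M_ge0 ME (lexx e12).
have closeA := sewing_closure q01' eps_ge0 eps_small K'0 A0 N_ge0 NE (lexx l12).
have ee0 : 0 <= eps * e12 by rewrite mulr_ge0.
have el0 : 0 <= eps * l12 by rewrite mulr_ge0.
have eB0 : 0 <= (1 + eps) * (M * (q / 2 * B)) by rewrite mulr_ge0// addr_ge0.
have eA0 : 0 <= (1 + eps) * (N * (q / 2 * A)) by rewrite mulr_ge0// addr_ge0.
have e12M : e12 <= M * B by lra.
have l12N : l12 <= N * A by lra.
have powm (k l : nat) c : (k <= l)%N -> a <= c ->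
    (k%:R * h) `^ c <= (l%:R * h) `^ c.
  move=> kl ac; rewrite ge0_ler_powR ?nnegrE// ?le_h//.
  by rewrite (le_trans _ ac)// (le_trans ler01)// ltW.
have c12 : close_maps e12 l12
    (grid_step nu h (i + m) \o iter_steps (grid_step nu h) i m)
    (nu ((i + (m + 1))%:R * h) (i%:R * h)).
  have i1 : i%:R * h <= (i + m)%:R * h by apply: le_h; clear; lia.
  have i2 : (i + m)%:R * h <= (i + (m + 1))%:R * h by apply: le_h; clear; lia.
  have i3 : (i + (m + 1))%:R * h <= T.
    by apply: le_trans iT; apply: le_h; clear -nme; lia.
  have i4 : (i + (m + 1))%:R * h - i%:R * h <= d.
    by rewrite diff; apply: le_trans nd; apply: le_h; clear -nme; lia.
  have mm1 : (m <= m + 1)%N by exact: leq_addr.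
  have m1n : (m + 1 <= n.+1)%N by rewrite nme leq_addr.
  have j1 : N * (m%:R * h) `^ a <= N * ((i + (m + 1))%:R * h - i%:R * h) `^ a.
    by rewrite diff ler_wpM2l// powm.
  have j2 : M * (m%:R * h) `^ b <= M * ((i + (m + 1))%:R * h - i%:R * h) `^ b.
    by rewrite diff ler_wpM2l// powm.
  have j3 : 0 <= N * (m%:R * h) `^ a by rewrite mulr_ge0// powR_ge0.
  have := sewing_glue (p0 i) i1 i2 i3 i4 j3 (lexx 0) j1 j2 cm c1.
  rewrite diff add0r mulr0 add0r; apply: close_maps_le; apply: lerD.
  - by rewrite ler_wpM2l ?ler_wpM2l ?half// addr_ge0.
  - by rewrite ler_wpM2l// powm.
  - by rewrite ler_wpM2l ?ler_wpM2l ?half// addr_ge0.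
  - by rewrite ler_wpM2l// powm.
have i1 : i%:R * h <= (i + (m + 1))%:R * h by apply: le_h; clear; lia.
have i2 : (i + (m + 1))%:R * h <= (i + n.+1)%:R * h.
  by apply: le_h; clear -nme; lia.
have i4 : (i + n.+1)%:R * h - i%:R * h <= d by rewrite diff.
have j1 : l12 <= N * ((i + n.+1)%:R * h - i%:R * h) `^ a by rewrite diff.
have j2 : e12 <= M * ((i + n.+1)%:R * h - i%:R * h) `^ b by rewrite diff.
have := sewing_glue (p0 i) i1 i2 iT i4 l120 NqA0 j1 j2 c12 he.
have -> : iter_steps (grid_step nu h) i n.+1 =
  iter_steps (grid_step nu h) (i + (m + 1)) e \o
    (grid_step nu h (i + m) \o iter_steps (grid_step nu h) i m).
  by apply/funext => x; rewrite nme /= iter_steps_add iter_steps_add /=.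
rewrite diff -/A -/B; apply: close_maps_le => //.
apply: le_trans closeB; rewrite lerD2r ler_peMl//.
by rewrite lerDl.
Qed.

End DiscreteSewing.

Section DiscreteBounds.
Context {R : realType} {E : normedModType R}.
Variables (T K a b gam rho : R).

Lemma discrete_bounds : 0 < rho <= 1 -> 1 < a -> a <= b -> 0 < gam ->
  a <= gam + rho * b -> 0 <= K ->
  exists M d : R, [/\ 0 <= M, 0 < d <= 1 &
    forall nu : R -> R -> E -> E, almost_flow T K a b gam rho nu ->
    forall (h : R) i n, 0 <= h -> (i + n)%:R * h <= T -> n%:R * h <= d ->
      let f := iter_steps (grid_step nu h) i n in
      (forall x, `|f x - nu ((i + n)%:R * h) (i%:R * h) x|
                   <= M * (n%:R * h) `^ b) /\
      (forall x y, `|f x - f y| <= 2 * `|x - y|)].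
Proof.
move=> rho01 a1 ab gam0 agr K0.
have [q [eps [M [N [d [[q01 qE e0 ele] [[M0 N0 ME NE] [d01 dP]]]]]]]] :=
  sewing_constants rho a1 gam0 K0.
exists M, d; split=> // nu nuP h i n h0 iT nd /=.
have c := discrete_sewing rho01 a1 ab gam0 agr K0 q01 qE e0 ele M0 N0 ME NE
  d01 dP nuP h0 iT nd.
split; first by case: c.
move=> x y; have nh0 : 0 <= n%:R * h by rewrite mulr_ge0.
have /andP[d0 d1] := d01.
have ih0 : 0 <= i%:R * h by rewrite mulr_ge0.
have diff : (i + n)%:R * h - i%:R * h = n%:R * h.
  by rewrite natrD mulrDl addrAC subrr add0r.
have ile : i%:R * h <= (i + n)%:R * h by rewrite -subr_ge0 diff.
have nh1 : (i + n)%:R * h - i%:R * h <= 1 by rewrite diff (le_trans nd).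
have t := af_tame nuP ih0 ile iT nh1.
rewrite (le_trans (close_maps_lip _ _ c t))// ler_wpM2r// diff.
have := dP _ nh0 nd; have /andP[q0 q1] := q01; lra.
Qed.

End DiscreteBounds.

(** * Passing to the limit along dyadic grids *)

Section GeometricLimit.
Context {R : realType}.
Implicit Types (r C e : R).

Lemma geometric_small r C e : 0 <= r < 1 -> 0 < e ->
  exists n0, forall n, (n0 <= n)%N -> C * r ^+ n <= e.
Proof.
move=> /andP[r0 r1] e0; have : `|r| < 1 by rewrite ger0_norm.
move=> /(cvg_geometric C)/cvgrPdist_le/(_ e e0)[n0 _ h].
exists n0 => n /h /=; rewrite sub0r normrN.
by apply: le_trans; exact: ler_norm.
Qed.

Lemma le_geometric r C x y : 0 <= r < 1 -> (forall n, x <= y + C * r ^+ n) ->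
  x <= y.
Proof.
move=> r01 h; apply/ler_addgt0Pr => e e0.
have [n /(_ n (leqnn n)) hn] := geometric_small C r01 e0.
by rewrite (le_trans (h n))// lerD2l.
Qed.

Lemma geometric_limit (E : completeNormedModType R) (u : nat -> E) C r :
  0 <= r < 1 -> 0 <= C ->
  (forall n, `|u n.+1 - u n| <= C * r ^+ n) ->
  exists l, forall n, `|u n - l| <= C / (1 - r) * r ^+ n.
Proof.
move=> r01 C0 ud; have /andP[r0 r1] := r01.
have dist n k : `|u (n + k)%N - u n| <= C / (1 - r) * r ^+ n * (1 - r ^+ k).
  elim: k => [|k IH]; first by rewrite addn0 subrr normr0 expr0 subrr mulr0.
  rewrite addnS -(subrKA (u (n + k)%N)) (le_trans (ler_normD _ _))//.
  rewrite (le_trans (lerD (ud _) IH))// exprD.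
  rewrite le_eqVlt; apply/orP; left; apply/eqP; rewrite exprS; field.
  by rewrite gt_eqF// subr_gt0.
have dist' n k : (n <= k)%N -> `|u k - u n| <= C / (1 - r) * r ^+ n.
  move=> nk; rewrite -(subnKC nk) (le_trans (dist _ _))// ler_piMr//.
    by rewrite mulr_ge0 ?exprn_ge0// divr_ge0// subr_ge0 ltW.
  by rewrite gerBl exprn_ge0.
have uc : cvgn u.
  apply/cauchy_cvgP/cauchy_ballP => e e0; near_simpl.
  have e40 : 0 < e / 4 by rewrite divr_gt0.
  have [n0 hn0] := geometric_small (C / (1 - r)) r01 e40.
  exists ([set n | (n0 <= n)%N], [set n | (n0 <= n)%N]) => /=.
    by split; exists n0.
  move=> [i j] /= [i0 j0]; rewrite -ball_normE /=.
  rewrite -(subrKA (u n0)) (le_lt_trans (ler_normD _ _))//.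
  have h1 := dist' _ _ i0; have h2 := dist' _ _ j0; rewrite distrC in h2.
  have := hn0 n0 (leqnn n0); lra.
exists (lim (u @ \oo)) => n; rewrite distrC; apply/ler_addgt0Pr => e e0.
have /cvgrPdist_le/(_ e e0)[n0 _ h] := uc.
have /h := leq_maxl n0 n; move=> h1; have h2 := dist' _ _ (leq_maxr n0 n).
rewrite -(subrKA (u (maxn n0 n))) (le_trans (ler_normD _ _))// addrC lerD//.
Unshelve. all: by end_near.
Qed.

End GeometricLimit.

Lemma expr_powR (R : realType) (x c : R) n : 0 <= x -> (x ^+ n) `^ c = (x `^ c) ^+ n.
Proof.
by move=> x0; rewrite -(powR_mulrn n x0) -(powR_mulrn n (powR_ge0 x c)) powRAC.
Qed.

Section DyadicGrid.
Context {R : realType} (d : R).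
Hypothesis d01 : 0 < d <= 1.

Definition mesh (n : nat) : R := d / 2 ^+ n.
Definition grid_index (n : nat) (t : R) : nat := Num.truncn (t / mesh n).

Lemma mesh_gt0 n : 0 < mesh n.
Proof. by case/andP: d01 => d0 _; rewrite divr_gt0// exprn_gt0. Qed.

Lemma mesh_ge0 n : 0 <= mesh n. Proof. exact/ltW/mesh_gt0. Qed.

Lemma meshS n : mesh n = 2 * mesh n.+1.
Proof. by rewrite /mesh exprS; field; rewrite expf_neq0. Qed.

Lemma mesh_pow n c s : 0 <= s -> s <= c -> mesh n `^ c <= (2^-1 `^ s) ^+ n.
Proof.
move=> s0 sc; have /andP[d0 d1] := d01.
have h1 : mesh n <= 2^-1 ^+ n.
  by rewrite /mesh exprVn ler_piMl// invr_ge0 exprn_ge0.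
rewrite -expr_powR ?invr_ge0//.
apply: (@le_trans _ _ ((2^-1 ^+ n) `^ c)).
  by rewrite ge0_ler_powR ?nnegrE ?mesh_ge0 ?exprn_ge0// (le_trans s0).
rewrite ger_powR// exprn_gt0//= exprn_ile1//.
by rewrite invf_le1// ler1n.
Qed.

Lemma grid_index_le n t : 0 <= t -> (grid_index n t)%:R * mesh n <= t.
Proof.
move=> t0; have h0 := mesh_gt0 n; rewrite -ler_pdivlMr//.
by have /andP[] := @truncn_itv _ (t / mesh n) (divr_ge0 t0 (mesh_ge0 n)).
Qed.

Lemma grid_index_gt n t : t < (grid_index n t)%:R * mesh n + mesh n.
Proof.
by have := truncnS_gt (t / mesh n); rewrite ltr_pdivrMr ?mesh_gt0// mulrSr mulrDl mul1r.
Qed.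

Lemma grid_index_mono n s t : s <= t -> (grid_index n s <= grid_index n t)%N.
Proof. by move=> st; apply: le_truncn; rewrite ler_pM2r// invr_gt0 mesh_gt0. Qed.

(** A point is in the left or in the right half of its dyadic interval. *)
Lemma grid_indexS n t : 0 <= t ->
  exists e : bool, grid_index n.+1 t = (2 * grid_index n t + e)%N.
Proof.
move=> t0; have h0 := mesh_gt0 n.+1.
have th0 : 0 <= t / mesh n.+1 by apply: divr_ge0 => //; exact: ltW.
have : (2 * grid_index n t <= grid_index n.+1 t)%N.
  rewrite truncn_ge_nat// ler_pdivlMr// natrM.
  by rewrite (le_trans _ (grid_index_le n t0))// (meshS n); lra.
have : (grid_index n.+1 t < 2 * grid_index n t + 2)%N.
  rewrite truncn_lt_nat// ltr_pdivrMr// natrD natrM.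
  by rewrite (lt_le_trans (grid_index_gt n t))// (meshS n); lra.
move: (grid_index n t) (grid_index n.+1 t) => i j ji ij.
by exists (j != 2 * i)%N; case: eqVneq => /=; lia.
Qed.

End DyadicGrid.

Section Levels.
Context {R : realType} {E : normedModType R}.
Variables (T K a b gam rho M d : R).
Hypothesis b1 : 1 < b.
Hypothesis gam0 : 0 < gam.
Hypothesis K0 : 0 <= K.
Hypothesis d01 : 0 < d <= 1.
Variable nu : R -> R -> E -> E.
Hypothesis nuP : almost_flow T K a b gam rho nu.
Hypothesis discP : forall (h : R) i n,
  0 <= h -> (i + n)%:R * h <= T -> n%:R * h <= d ->
      let f := iter_steps (grid_step nu h) i n in
      (forall x, `|f x - nu ((i + n)%:R * h) (i%:R * h) x|
                   <= M * (n%:R * h) `^ b) /\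
      (forall x y, `|f x - f y| <= 2 * `|x - y|).

Local Notation h := (mesh d).
Local Notation step n := (grid_step nu (h n)).
Local Notation idx := (grid_index d).

Definition block_count : nat := (Num.truncn (T / d)).+1.
(** Below the scale d the compositions are 2-Lipschitz, so over the whole
    interval they are Lipschitz with this constant. *)
Definition flow_lip : R := 2 ^+ block_count.
Local Notation L := flow_lip.

Lemma flow_lip_ge1 : 1 <= L. Proof. by rewrite exprn_ege1// ler1n. Qed.
Lemma flow_lip_ge0 : 0 <= L. Proof. exact: le_trans flow_lip_ge1. Qed.

Lemma steps_lip_blocks n i k m x y : (i + k)%:R * h n <= T -> (k <= m * 2 ^ n)%N ->
  `|iter_steps (step n) i k x - iter_steps (step n) i k y| <= 2 ^+ m * `|x - y|.
Proof.
have h0 := mesh_ge0 d01 n.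
elim: m i k x y => [|m IH] i k x y iT km.
  have -> : k = 0%N by move: km; rewrite mul0n leqn0 => /eqP.
  by rewrite expr0 mul1r.
have [k1|k1] := leqP k (2 ^ n).
  have [|_ /(_ x y) le2] := discP h0 iT.
    rewrite (le_trans (ler_wpM2r h0 (_ : k%:R <= (2 ^ n)%:R)))// ?ler_nat//.
    by rewrite /mesh natrX mulrC divfK// expf_neq0.
  by rewrite (le_trans le2)// ler_wpM2r// exprS ler_peMr// exprn_ege1// ler1n.
have kE : k = (2 ^ n + (k - 2 ^ n))%N by rewrite subnKC// ltnW.
rewrite kE !iter_steps_add; rewrite kE in iT.
rewrite (le_trans (IH _ _ _ _ _ _))//.
- by rewrite -addnA.
- by rewrite leq_subLR -mulSn.
rewrite exprSr -mulrA ler_wpM2l ?exprn_ge0//.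
have iT' : (i + 2 ^ n)%:R * h n <= T.
  by rewrite (le_trans _ iT)// ler_wpM2r// ler_nat leq_add2l leq_addr.
have nd : (2 ^ n)%:R * h n <= d.
  by rewrite /mesh natrX mulrC divfK// expf_neq0.
have [_ le2] := discP h0 iT' nd.
exact: le2.
Qed.

Lemma steps_lip n i k x y : (i + k)%:R * h n <= T ->
  `|iter_steps (step n) i k x - iter_steps (step n) i k y| <= L * `|x - y|.
Proof.
move=> iT; apply: steps_lip_blocks => //; have /andP[d0 d1] := d01.
have h0 := mesh_gt0 d01 n.
rewrite -(ler_nat R) natrM natrX.
have : k%:R * h n <= T.
  by rewrite (le_trans _ iT)// (ler_wpM2r (ltW h0))// ler_nat leq_addl.
rewrite /mesh mulrA ler_pdivrMr ?exprn_gt0// -ler_pdivlMr// => /le_trans; apply.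
by rewrite mulrAC ler_wpM2r ?exprn_ge0// ltW// truncnS_gt.
Qed.

Lemma step_near n k x : k.+1%:R * h n <= T -> `|step n k x - x| <= K * h n `^ gam.
Proof.
move=> kT; have h0 := mesh_ge0 d01 n.
have h1 : h n <= 1.
  case/andP: d01 => d0 d1; rewrite ler_pdivrMr ?exprn_gt0// mul1r (le_trans d1)//.
  by rewrite exprn_ege1// ler1n.
have diff : k.+1%:R * h n - k%:R * h n = h n.
  by rewrite mulrSr mulrDl mul1r addrAC subrr add0r.
have k0 : 0 <= k%:R * h n by rewrite mulr_ge0.
have kk : k%:R * h n <= k.+1%:R * h n by rewrite ler_wpM2r// ler_nat.
have := af_tame nuP k0 kk kT; rewrite diff => /(_ h1) tm.
exact: tame_le tm.
Qed.

(** Each step of a level is replaced by two steps of the next level, at the cost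
    of one defect. *)
Lemma refine_steps n i k x : (i + k)%:R * h n <= T ->
  `|iter_steps (step n.+1) (2 * i) (2 * k) x - iter_steps (step n) i k x|
  <= k%:R * (L * (K * h n `^ b)).
Proof.
have h0 := mesh_ge0 d01 n; have hS := meshS d n.
have hS0 := mesh_ge0 d01 n.+1.
have dbl (m : nat) : (2 * m)%:R * h n.+1 = m%:R * h n.
  by rewrite natrM hS (mulrC 2) mulrA.
(* the steps of the finer level, grouped by two *)
pose F k := iter_steps (step n.+1) (2 * k) 2.
have FE j l y : iter_steps F j l y = iter_steps (step n.+1) (2 * j) (2 * l) y.
  elim: l j y => [|l IH] j y; first by rewrite muln0.
  rewrite (mulnS 2 l) iter_steps_add.
  by rewrite -[LHS]/(iter_steps F j.+1 l (F j y)) IH /F (mulnS 2 j) (addnC 2).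
move=> iT; rewrite -FE; apply: telescoping flow_lip_ge0 x.
- move=> j l x y jl; rewrite !FE; apply: steps_lip.
  by rewrite -mulnDr dbl (le_trans _ iT)// ler_wpM2r// ler_nat.
- move=> l x /andP[_ lik].
  have lT : l.+1%:R * h n <= T by rewrite (le_trans _ iT)// ler_wpM2r// ler_nat.
  have h1 : h n <= 1.
    case/andP: d01 => d0 d1; rewrite ler_pdivrMr ?exprn_gt0// mul1r (le_trans d1)//.
    by rewrite exprn_ege1// ler1n.
  have diff : l.+1%:R * h n - l%:R * h n = h n.
    by rewrite mulrSr mulrDl mul1r addrAC subrr add0r.
  have k0 : 0 <= l%:R * h n by rewrite mulr_ge0.
  have k1 : l%:R * h n <= (2 * l).+1%:R * h n.+1.
    by rewrite -dbl ler_wpM2r// ler_nat.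
  have k2 : (2 * l).+1%:R * h n.+1 <= l.+1%:R * h n.
    by rewrite -dbl ler_wpM2r// ler_nat mulnS.
  have := af_defect nuP k0 k1 k2 lT; rewrite diff => /(_ h1)[].
  move=> /(_ x) + _; rewrite /F /= /grid_step.
  by rewrite -!dbl mulnS.
Qed.

Lemma shift_start n i k x : (i + k.+1)%:R * h n <= T ->
  `|iter_steps (step n) i.+1 k x - iter_steps (step n) i k.+1 x|
  <= L * (K * h n `^ gam).
Proof.
move=> iT; have h0 := mesh_ge0 d01 n.
rewrite /= (le_trans (steps_lip _ _ _)) ?addSnnS//.
rewrite ler_wpM2l ?flow_lip_ge0// distrC step_near// (le_trans _ iT)//.
by rewrite ler_wpM2r// ler_nat addnS ltnS leq_addr.
Qed.

Lemma shift_end n i k x : (i + k.+1)%:R * h n <= T ->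
  `|iter_steps (step n) i k.+1 x - iter_steps (step n) i k x| <= K * h n `^ gam.
Proof.
by move=> iT; rewrite -addn1 iter_steps_add /= step_near// -addnS.
Qed.

(** Rounding both times down to the grid makes the flow property exact at every level. *)
Definition level_flow n (t s : R) : E -> E :=
  iter_steps (step n) (idx n s) (idx n t - idx n s).

Definition level_rate : R := 2^-1 `^ Num.min (b - 1) gam.
Local Notation r := level_rate.

Lemma level_exp_gt0 : 0 < Num.min (b - 1) gam.
Proof. by rewrite lt_min subr_gt0 b1. Qed.

Lemma level_rate01 : 0 <= r < 1.
Proof.
rewrite powR_ge0 /=.
have := @gt0_ltr_powR R _ level_exp_gt0 2^-1 1.
by rewrite powR1; apply; rewrite ?nnegrE ?invf_lt1// ltr1n.
Qed.

(** Passing to the next level refines the grid, and moves each of the two end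
    points by at most one step of the finer grid. *)
Lemma level_flow_cauchy n (s t : R) x : 0 <= s -> s <= t -> t <= T ->
  `|level_flow n.+1 t s x - level_flow n t s x| <= (L * K * (T + 2)) * r ^+ n.
Proof.
move=> s0 st tT; have t0 := le_trans s0 st.
have h0 := mesh_gt0 d01 n; have hS := meshS d n.
have hS0 := mesh_gt0 d01 n.+1.
have L0 := flow_lip_ge0; have L1 := flow_lip_ge1.
have s0' := level_exp_gt0.
have rb : h n `^ (b - 1) <= r ^+ n.
  by apply: mesh_pow => //; [exact: ltW|rewrite ge_min lexx].
have rg : h n.+1 `^ gam <= r ^+ n.
  apply: (@le_trans _ _ (h n `^ gam)).
    by rewrite ge0_ler_powR ?nnegrE ?ltW// hS; lra.
  by apply: mesh_pow => //; [exact: ltW|rewrite ge_min lexx orbT].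
have := grid_indexS d01 n s0; have := grid_indexS d01 n t0.
have := grid_index_mono d01 n.+1 st; have := grid_index_mono d01 n st.
have tI := grid_index_le d01 n t0; have tI' := grid_index_le d01 n.+1 t0.
rewrite /level_flow.
move: tI tI'; move: (idx n s) (idx n t) (idx n.+1 s) (idx n.+1 t) => i j i' j'.
move=> jT j'T ij i'j' [f fE] [e eE].
have jT' : (i + (j - i))%:R * h n <= T by rewrite subnKC// (le_trans jT).
have mT : (j - i)%:R * h n <= T.
  by rewrite (le_trans _ jT')// (ler_wpM2r (ltW h0))// ler_nat leq_addl.
have j'T' : j'%:R * h n.+1 <= T by exact: le_trans tT.
(* the end points of the coarse grid are kept in this comparison and moved
   in the next one *)
have fine : `|iter_steps (step n.+1) (2 * i) (2 * (j - i)) x -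
    iter_steps (step n) i (j - i) x| <= L * K * T * r ^+ n.
  rewrite (le_trans (refine_steps _ jT'))//.
  rewrite -(mulr_powRB1 (ltW h0) (lt_trans ltr01 b1)).
  have -> : (j - i)%:R * (L * (K * (h n * h n `^ (b - 1)))) =
    (L * K) * ((j - i)%:R * h n) * h n `^ (b - 1) by ring.
  apply: ler_pM => //; [|exact: powR_ge0|].
    apply: mulr_ge0; [exact: mulr_ge0|apply: mulr_ge0 => //; exact: ltW].
  by rewrite ler_wpM2l// mulr_ge0.
set g := K * h n.+1 `^ gam.
have g0 : 0 <= g by rewrite mulr_ge0// powR_ge0.
have gL : g <= L * g by rewrite ler_peMl.
have gr : L * g <= L * K * r ^+ n by rewrite -mulrA ler_wpM2l// ler_wpM2l.
suff coarse : `|iter_steps (step n.+1) i' (j' - i') x -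
    iter_steps (step n.+1) (2 * i) (2 * (j - i)) x| <= 2 * (L * g).
  rewrite -(subrKA (iter_steps (step n.+1) (2 * i) (2 * (j - i)) x)).
  by rewrite (le_trans (ler_normD _ _))//; lra.
have bound k : (2 * i + k <= j')%N -> (2 * i + k)%:R * h n.+1 <= T.
  by move=> kj; rewrite (le_trans _ j'T')// (ler_wpM2r (ltW hS0))// ler_nat.
case: e eE => eE; rewrite eE /=.
- have [ij'|ij'] := eqVneq i j.
    have -> : (j' - (2 * i + 1) = 0)%N.
      by clear -ij' fE eE i'j'; case: f fE => fE; lia.
    by rewrite ij' subnn muln0 /= subrr normr0 mulr_ge0// mulr_ge0.
  have [m mE] : exists m, (j - i = m.+1)%N.
    by exists (j - i).-1; clear -ij ij'; lia.
  have -> : (2 * (j - i) = (2 * m).+2)%N by clear -mE; lia.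
  have h1 : (2 * i + (2 * m).+2)%:R * h n.+1 <= T.
    by apply: bound; clear -mE fE; lia.
  have := shift_start x h1; rewrite -/g addn1.
  case: f fE => fE; last first.
    have -> : (j' - (2 * i).+1 = (2 * m).+1)%N by clear -mE fE; lia.
    by move=> /le_trans; apply; rewrite ler_peMl ?ler1n// mulr_ge0.
  have -> : (j' - (2 * i).+1 = (2 * m).+2)%N by clear -mE fE; lia.
  have h2 : ((2 * i).+1 + (2 * m).+2)%:R * h n.+1 <= T.
    by rewrite addSnnS; apply: bound; clear -mE fE; lia.
  have := shift_end x h2; rewrite -/g => k2 k1.
  rewrite -(subrKA (iter_steps (step n.+1) (2 * i).+1 (2 * m).+1 x)).
  rewrite (le_trans (ler_normD _ _))// mulrDl mul1r lerD//.
  exact: le_trans gL.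
- rewrite addn0; case: f fE => fE.
    have -> : (j' - 2 * i = (2 * (j - i)).+1)%N by clear -ij fE; lia.
    have h1 : (2 * i + (2 * (j - i)).+1)%:R * h n.+1 <= T.
      by apply: bound; clear -ij fE; lia.
    have := shift_end x h1; rewrite -/g => /le_trans; apply.
    by rewrite (le_trans gL)// ler_peMl ?ler1n// mulr_ge0.
  have -> : (j' - 2 * i = 2 * (j - i))%N by clear -ij fE; lia.
  by rewrite subrr normr0 mulr_ge0// mulr_ge0.
Qed.

End Levels.

(** The constants L, C and d depend on the constants of the almost flow only;
    this uniformity is what makes the flow continuous in its driver. *)
Lemma sewing (R : realType) (E : completeNormedModType R)
    (T K a b gam rho : R) : 0 < rho <= 1 -> 1 < a -> a <= b -> 0 < gam ->
  a <= gam + rho * b -> 0 <= K -> 0 < T ->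
  exists L C d : R, [/\ 0 <= L, 0 <= C, 0 < d <= 1 &
    forall nu : R -> R -> E -> E, almost_flow T K a b gam rho nu ->
    exists phi : R -> R -> E -> E, [/\ is_flow T phi,
      (forall s t x y, 0 <= s -> s <= t -> t <= T ->
         `|phi t s x - phi t s y| <= L * `|x - y|) &
      forall s t x, 0 <= s -> s <= t -> t <= T -> t - s <= d ->
         `|phi t s x - nu t s x| <= C * (t - s) `^ b]].
Proof.
move=> rho01 a1 ab gam0 agr K0 T0.
have b1 : 1 < b by exact: lt_le_trans ab.
have [M [d [M0 d01 disc]]] := @discrete_bounds _ E T _ _ _ _ _ rho01 a1 ab gam0 agr K0.
have /andP[d0 d1] := d01.
have L0 := @flow_lip_ge0 _ T d; set L := flow_lip T d in L0 *.
exists L, (M * 2 `^ b), (d / 2); split=> //.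
- by rewrite mulr_ge0// powR_ge0.
- by rewrite divr_gt0//= ler_pdivrMr// mul1r (le_trans d1)// ler1n.
move=> nu nuP; have discP := disc nu nuP.
pose Phi n t s := @level_flow _ E d nu n t s.
pose r : R := level_rate b gam.
have r01 : 0 <= r < 1 by exact: level_rate01.
have /andP[r0 r1] := r01.
pose C1 := L * K * (T + 2).
have C10 : 0 <= C1 by rewrite !mulr_ge0// addr_ge0// ltW.
have cau s t x : 0 <= s -> s <= t -> t <= T -> forall n,
    `|Phi n.+1 t s x - Phi n t s x| <= C1 * r ^+ n.
  by move=> s0 st tT n; exact: (level_flow_cauchy b1 gam0 K0 d01 nuP discP).
pose C2 := C1 / (1 - r).
have C20 : 0 <= C2 by rewrite divr_ge0// subr_ge0 ltW.
have /choice[phi phiP] : forall z : R * R * E, exists l : E,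
    0 <= z.1.2 -> z.1.2 <= z.1.1 -> z.1.1 <= T -> forall n,
    `|Phi n z.1.1 z.1.2 z.2 - l| <= C2 * r ^+ n.
  move=> [[t s] x] /=.
  have [s0|s0] := boolP (0 <= s); last by exists 0.
  have [st|st] := boolP (s <= t); last by exists 0.
  have [tT|tT] := boolP (t <= T); last by exists 0.
  by have [l hl] := geometric_limit r01 C10 (cau _ _ x s0 st tT); exists l.
pose ph t s x := phi (t, s, x).
have lim s t x : 0 <= s -> s <= t -> t <= T -> forall n,
    `|Phi n t s x - ph t s x| <= C2 * r ^+ n.
  by move=> s0 st tT; apply: (phiP (t, s, x)).
have Plip n s t x y : 0 <= s -> s <= t -> t <= T ->
    `|Phi n t s x - Phi n t s y| <= L * `|x - y|.
  move=> s0 st tT; apply: (steps_lip d01 discP).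
  rewrite subnKC ?grid_index_mono// (le_trans _ tT)// grid_index_le//.
  exact: le_trans st.
have phid t x : 0 <= t -> t <= T -> ph t t x = x.
  move=> t0 tT; apply/eqP; rewrite -subr_eq0 -normr_le0.
  apply: (le_geometric (C := C2) r01) => n.
  have := lim t t x t0 (lexx t) tT n.
  by rewrite /Phi /level_flow subnn /= distrC add0r.
exists ph; split.
- split=> [t t0 tT x|s u t s0 su ut tT x]; first exact: phid.
  have u0 := le_trans s0 su; have uT := le_trans ut tT.
  have st := le_trans su ut.
  apply/eqP; rewrite -subr_eq0 -normr_le0.
  apply: (le_geometric (C := (L + 2) * C2) r01) => n; rewrite add0r.
  have comp : Phi n t s x = Phi n t u (Phi n u s x).
    rewrite /Phi /level_flow.
    have i1 := grid_index_mono d01 n su; have i2 := grid_index_mono d01 n ut.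
    rewrite -(subnKC i1); set i := grid_index d n s in i1 *.
    set k := (grid_index d n u - i)%N.
    by rewrite addKn -iter_steps_add; congr iter_steps; rewrite /k; clear -i1 i2; lia.
  have h1 := lim s u x s0 su uT n.
  have h2 := lim u t (ph u s x) u0 ut tT n; rewrite distrC in h2.
  have h3 := lim s t x s0 st tT n; rewrite comp in h3.
  have h4 := Plip n u t (ph u s x) (Phi n u s x) u0 ut tT.
  have h5 : L * `|ph u s x - Phi n u s x| <= L * (C2 * r ^+ n).
    by rewrite ler_wpM2l// distrC.
  have -> : ph t u (ph u s x) - ph t s x =
    (ph t u (ph u s x) - Phi n t u (ph u s x)) +
    (Phi n t u (ph u s x) - Phi n t u (Phi n u s x)) +
    (Phi n t u (Phi n u s x) - ph t s x) by vring.
  apply: le_trans (ler_norm3 _ _ _) _.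
  lra.
- move=> s t x y s0 st tT.
  apply: (le_geometric (C := 2 * C2) r01) => n.
  have h1 := lim s t x s0 st tT n; have h2 := lim s t y s0 st tT n.
  rewrite distrC in h1.
  have -> : ph t s x - ph t s y = (ph t s x - Phi n t s x) +
     (Phi n t s x - Phi n t s y) + (Phi n t s y - ph t s y) by vring.
  apply: le_trans (ler_norm3 _ _ _) _.
  have := Plip n s t x y s0 st tT; lra.
move=> s t x s0 st tT tsd; have t0 := le_trans s0 st.
move: (st); rewrite le_eqVlt => /orP[/eqP <-|slt].
  rewrite phid ?(le_trans st)// (af_id nuP) ?(le_trans st)// subrr normr0.
  by rewrite !mulr_ge0// powR_ge0.
have ts0 : 0 < t - s by rewrite subr_gt0.
have half01 : 0 <= (2^-1 : R) < 1 by rewrite invr_ge0 ler0n invf_lt1// ltr1n.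
(* from the level n0 on, the mesh is at most t - s, so that the rounded
   times satisfy s' <= s <= t' <= t *)
have [n0 hn0] := geometric_small d half01 ts0.
apply: (le_geometric (C := K + C2) r01) => k; set n := (n0 + k)%N.
have hle : mesh d n <= t - s.
  by have := hn0 n (leq_addr _ _); rewrite exprVn.
have h0 := mesh_gt0 d01 n.
have rk : r ^+ n <= r ^+ k.
  by rewrite /n exprD ler_piMl ?exprn_ge0// exprn_ile1// ltW.
have hg : mesh d n `^ gam <= r ^+ n.
  apply: (mesh_pow d01); first by apply/ltW/level_exp_gt0.
  by rewrite ge_min lexx orbT.
have h3 := lim s t x s0 st tT n; rewrite distrC in h3.
have ij := grid_index_mono d01 n st.
have t1 := grid_index_le d01 n t0; have t2 := grid_index_gt d01 n t.
have s1 := grid_index_le d01 n s0; have s2 := grid_index_gt d01 n s.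
have h0' := ltW h0.
have jih : (grid_index d n t - grid_index d n s)%:R * mesh d n =
   (grid_index d n t)%:R * mesh d n - (grid_index d n s)%:R * mesh d n.
  by rewrite natrB// mulrBl.
have kd : (grid_index d n t - grid_index d n s)%:R * mesh d n <= d.
  by rewrite jih; clear -t1 t2 s1 s2 hle tsd; lra.
have kT : (grid_index d n s + (grid_index d n t - grid_index d n s))%:R *
    mesh d n <= T by rewrite subnKC// (le_trans t1).
have [h4' _] := discP _ _ _ h0' kT kd; have h4 := h4' x.
rewrite subnKC// jih in h4.
move: h3 h4 t1 t2 s1 s2; rewrite -/(level_flow d nu n t s) -/(Phi n t s).
set t' := (grid_index d n t)%:R * mesh d n.
set s' := (grid_index d n s)%:R * mesh d n.
have s'0 : 0 <= s' by exact: mulr_ge0.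
have s't' : s' <= t' by rewrite ler_wpM2r// ler_nat.
move: (mesh d n) h0 h0' hle hg => h h0 h0' hle hg h3 h4 t1 t2 s1 s2.
have h5 : `|nu t s x - nu t' s' x| <= K * h `^ gam.
  by apply: (af_time nuP) => //; clear -t1 t2 s1 s2 hle d1 tsd; lra.
have h6 : M * (t' - s') `^ b <= M * 2 `^ b * (t - s) `^ b.
  rewrite -mulrA ler_wpM2l// -powRM// ?(ltW ts0)//.
  by rewrite ge0_ler_powR ?nnegrE//; clear -t1 t2 s1 s2 hle ij ts0 s't' b1; lra.
have h7 : K * h `^ gam <= K * r ^+ n by rewrite ler_wpM2l.
have h8 : (K + C2) * r ^+ n <= (K + C2) * r ^+ k by rewrite ler_wpM2l// addr_ge0.
have -> : ph t s x - nu t s x = (ph t s x - Phi n t s x) +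
   (Phi n t s x - nu t' s' x) - (nu t s x - nu t' s' x) by vring.
rewrite (le_trans (ler_normB _ _))// (le_trans (lerD (ler_normD _ _) (lexx _)))//.
lra.
Qed.

(** * Ordinary differential equations *)

Section Velocity.
Context {R : realType} (E : normedModType R).

Lemma is_derive_velocity (y : R^o -> E) (u : R^o) (v : E) :
  has_velocity y u v <-> is_derive u 1 y v.
Proof.
pose q h := h^-1 *: ((y \o shift u) (h *: (1 : R^o)) - y u).
have qE h : h != 0 -> `|v - q h| = `|h|^-1 * `|y (u + h) - y u - h *: v|.
  move=> h0; rewrite -normfV -normrZ [in RHS]scalerBr scalerA mulVf// scale1r.
  by rewrite distrC /q /= /shift /= [h *: _]mulr1 (addrC h).
split=> [yv|[]].
  have c : q h @[h --> 0^'] --> v.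
    apply/cvgrPdist_le => e e0; have [d d0 hd] := yv _ e0.
    exists d => //= h; rewrite /ball_ /= sub0r normrN => hlt hn0.
    rewrite qE// ler_pdivrMl ?normr_gt0// mulrC.
    exact: hd.
  by split; [apply: cvgP; exact: c|apply: cvg_lim => //; exact: c].
move=> dy yv e e0; have c : q h @[h --> 0^'] --> v by rewrite -yv.
have /cvgrPdist_le/(_ e e0)[d /= d0 hd] := c.
exists d => // h hlt; have [->|hn0] := eqVneq h 0.
  by rewrite addr0 scale0r !subrr !normr0 mulr0.
have := hd h; rewrite /ball_ /= sub0r normrN => /(_ hlt hn0).
by rewrite qE// ler_pdivrMl ?normr_gt0// mulrC.
Qed.

End Velocity.

Section EulerFlow.
Context {R : realType} {E : normedModType R} (rho k : R).
Hypothesis rho01 : 0 < rho <= 1.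
Variable F : E -> E.
Hypothesis tF : tame rho k F.

Definition euler_const : R := 2 * k + k * (k + k `^ rho).

(** The defect of the Euler maps is (t-u) times the displacement of F along a
    vector of length O(u-s), so the exponents are 2 and 1 + rho. *)
Lemma euler_almost_flow (T : R) : 
  almost_flow T euler_const (1 + rho) 2 1 rho (fun t s x => x + (t - s) *: F x).
Proof.
have k0 := tame_ge0 tF; have /andP[r0 r1] := rho01.
have kr0 : 0 <= k `^ rho by exact: powR_ge0.
have kk0 : 0 <= k * (k + k `^ rho) by rewrite mulr_ge0// addr_ge0.
split=> [t x _ _|s t s0 st tT ts1|s u t s0 su ut tT ts1|s s' t t' h x s'0 s's st' t't tT ts1 sh th].
- by rewrite subrr scale0r addr0.
- have ts0 : 0 <= t - s by rewrite subr_ge0.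
  have -> : (fun x => x + (t - s) *: F x - x) = (fun x => (t - s) *: F x).
    by apply/funext => x; vring.
  rewrite powRr1//.
  apply: tame_mono (tameZ (t - s) tF); rewrite ger0_norm// mulrC ler_wpM2r//.
  by rewrite /euler_const; lra.
- have us0 : 0 <= u - s by rewrite subr_ge0.
  have tu0 : 0 <= t - u by rewrite subr_ge0.
  have ts0 : 0 <= t - s by rewrite subr_ge0 (le_trans su).
  have defectE x : x + (u - s) *: F x + (t - u) *: F (x + (u - s) *: F x) -
      (x + (t - s) *: F x) = (t - u) *: (F (x + (u - s) *: F x) - F x) by vring.
  have tg := tameZ (u - s) tF.
  rewrite ger0_norm// in tg.
  have usk : (u - s) * k <= (t - s) * k by rewrite ler_wpM2r// lerD2r.
  have tu : t - u <= t - s by lra.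
  split=> [x|x y] /=; rewrite !defectE.
    rewrite normrZ ger0_norm// powR_mulrn// expr2.
    have := tame_lip (x + (u - s) *: F x) x tF; rewrite addrAC subrr add0r => h1.
    have h2 := tame_le x tg.
    have h3 : `|F (x + (u - s) *: F x) - F x| <= k * ((t - s) * k).
      by rewrite (le_trans h1)// ler_wpM2l// (le_trans h2).
    rewrite (le_trans (ler_pM tu0 (normr_ge0 _) tu h3))//.
    have -> : (t - s) * (k * ((t - s) * k)) = (k * k) * ((t - s) * (t - s)) by ring.
    rewrite ler_wpM2r ?mulr_ge0// /euler_const.
    by have := mulr_ge0 k0 kr0; lra.
  have [_ _ pg] := tg; have bg z : `|(u - s) *: F z| <= (t - s) * k.
    by rewrite (le_trans (tame_le z tg)).
  have := fourpt_shift x y tF pg bg => h1.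
  have -> : (t - u) *: (F (x + (u - s) *: F x) - F x) -
     (t - u) *: (F (y + (u - s) *: F y) - F y) = (t - u) *:
    (F (x + (u - s) *: F x) - F x - F (y + (u - s) *: F y) + F y) by vring.
  rewrite normrZ ger0_norm//.
  rewrite (le_trans (ler_pM tu0 (normr_ge0 _) tu h1))// mulrA ler_wpM2r//.
  rewrite powRM// powRD; last by rewrite gt_eqF ?implybT// addr_gt0.
  rewrite powRr1//.
  have h2 : t - s <= (t - s) `^ rho by apply: powR_ge_id => //; rewrite ts0.
  have tr0 : 0 <= (t - s) `^ rho by exact: powR_ge0.
  have h3 : (u - s) * k <= (t - s) `^ rho * k by rewrite (le_trans usk)// ler_wpM2r.
  have h4 : (t - s) * (k * ((u - s) * k + (t - s) `^ rho * k `^ rho)) <=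
     (t - s) * (k * ((t - s) `^ rho * k + (t - s) `^ rho * k `^ rho)).
    by rewrite ler_wpM2l// ler_wpM2l// lerD2r.
  rewrite (le_trans h4)// /euler_const.
  have : 0 <= (t - s) * (t - s) `^ rho * (2 * k) by rewrite !mulr_ge0.
  lra.
have -> : x + (t - s) *: F x - (x + (t' - s') *: F x) =
   ((t - t') - (s - s')) *: F x by vring.
have h0 : 0 <= h by lra.
rewrite normrZ powRr1// mulrC ler_pM//.
  by rewrite (le_trans (tame_le x tF))// /euler_const; lra.
by rewrite ler_norml; apply/andP; split; lra.
Qed.

End EulerFlow.

Section ODE.
Context {R : realType} {E : completeNormedModType R} (rho k : R).
Hypothesis rho01 : 0 < rho <= 1.
Variable F : E -> E.
Hypothesis tF : tame rho k F.

(** The curve is the flow sewn from the Euler maps.  The flow runs over [0, 2] so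
    that the derivative at time 1 is two-sided; on the left of 0 the curve is
    prolonged by its tangent. *)
Lemma ode_solution (x : E) : exists y : R -> E, y 0 = x /\
  forall u : R, 0 <= u <= 1 -> has_velocity y u (F (y u)).
Proof.
have k0 := tame_ge0 tF; have /andP[r0 r1] := rho01.
have Kc0 : 0 <= euler_const rho k.
  by rewrite addr_ge0 ?mulr_ge0// addr_ge0// powR_ge0.
have a1 : 1 < 1 + rho by lra.
have ab : 1 + rho <= 2 by lra.
have agr : 1 + rho <= 1 + rho * 2 by lra.
have [L [C [d [L0 C0 /andP[d0 d1] sew]]]] := @sewing R E 2 (euler_const rho k) (1 + rho) 2 1
  rho rho01 a1 ab ltr01 agr Kc0 (ltr0n _ 2).
have [phi [[phi0 phiC] phiL phiE]] := sew _ (euler_almost_flow rho01 tF 2).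
pose y (u : R) := if u < 0 then x + u *: F x else phi u 0 x.
have y0 : y 0 = x by rewrite /y ltxx phi0// ?lexx// ler0n.
have yE u w : 0 <= u -> u <= w -> w <= 2 -> w - u <= d ->
    `|y w - y u - (w - u) *: F (y u)| <= C * (w - u) ^+ 2.
  move=> u0 uw w2 wu; have w0 := le_trans u0 uw.
  rewrite /y !ltNge u0 w0 /= -(phiC 0 u w)// -powR_mulrn ?subr_ge0//.
  have := phiE u w (phi u 0 x) u0 uw w2 wu.
  by rewrite opprD addrA.
exists y; split=> // u /andP[u0 u1] e e0.
pose c := C + k * (C + k) + 1.
have kC0 : 0 <= k * (C + k) by rewrite mulr_ge0// addr_ge0.
have c0 : 0 < c by rewrite /c; lra.
(* for u > 0 the increments h stay above - u, so that u + h < 0 only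
   happens for u = 0 *)
pose u' : R := if u == 0 then 1 else u.
have u'0 : 0 < u' by rewrite /u'; case: eqVneq => // un0; rewrite lt_neqAle eq_sym un0.
exists (Num.min (Num.min d u') (e / c)).
  by rewrite !lt_min d0 u'0 divr_gt0.
move=> h; rewrite !lt_min => /andP[/andP[hd hu]]; rewrite ltr_pdivlMr// => hc.
have he : c * (`|h| * `|h|) <= e * `|h|.
  by rewrite mulrA ler_wpM2r// mulrC ltW.
have h1 : `|h| <= 1 by lra.
have hh0 : 0 <= `|h| * `|h| by exact: mulr_ge0.
have sqh : h ^+ 2 = `|h| * `|h| by rewrite -expr2 real_normK// num_real.
have [h0|h0] := leP 0 h.
  have := yE u (u + h) u0; rewrite lerDl (addrC u) addrK (addrC h) => /(_ h0).
  rewrite ger0_norm// in hd h1 he hc hh0 sqh *.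
  move=> /(_ _ (ltW hd)) H; rewrite (le_trans (H _))//; first by lra.
  rewrite sqh; apply: le_trans he; rewrite ler_wpM2r// /c; lra.
have [uh0|uh0] := ltP (u + h) 0.
  have u00 : u = 0.
    apply/eqP; apply: contraTT hu => un0; rewrite /u' (negbTE un0) -leNgt.
    by rewrite ltr0_norm//; lra.
  rewrite u00 add0r in uh0 *; rewrite y0 /y uh0.
  have -> : x + h *: F x - x - h *: F x = 0 by vring.
  by rewrite normr0 mulr_ge0// ltW.
have nh : u - (u + h) = `|h| by rewrite ltr0_norm//; lra.
have := yE (u + h) u uh0; rewrite nh => /(_ _ _ (ltW hd)) H.
have {}H : `|y u - y (u + h) - `|h| *: F (y (u + h))| <= C * (`|h| * `|h|).
  by rewrite -expr2; apply: H; lra.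
have Fle : `|y u - y (u + h)| <= (C + k) * `|h|.
  rewrite -(subrK (`|h| *: F (y (u + h))) (y u - _)) (le_trans (ler_normD _ _))//.
  rewrite normrZ normr_id mulrDl lerD//; last first.
    by rewrite mulrC ler_wpM2r// (tame_le _ tF).
  by rewrite (le_trans H)// ler_wpM2l// ler_piMl.
have -> : y (u + h) - y u - h *: F (y u) =
   - (y u - y (u + h) - `|h| *: F (y (u + h))) + `|h| *: (F (y u) - F (y (u + h))).
  by rewrite ltr0_norm//; vring.
rewrite (le_trans (ler_normD _ _))// normrN normrZ normr_id.
have F2 : `|F (y u) - F (y (u + h))| <= k * ((C + k) * `|h|).
  by rewrite (le_trans (tame_lip _ _ tF))// ler_wpM2l.
have := ler_wpM2l (normr_ge0 h) F2.
move: he; rewrite /c; lra.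
Qed.

Lemma time1_map_spec (x : E) : exists y : R -> E, [/\ y 0 = x, y 1 = time1_map F x &
  forall u : R, 0 <= u <= 1 -> has_velocity y u (F (y u))].
Proof.
have [y [y0 yF]] := ode_solution x.
rewrite /time1_map; set A := [set z | _].
have : A (get A).
  apply: (getI (x := y 1)); exists y; split=> // u u0 u1.
  by apply/is_derive_velocity/yF; rewrite u0.
move=> [y' [y'0 y'1 y'F]]; exists y'; split=> // u /andP[u0 u1].
exact/is_derive_velocity/y'F.
Qed.

End ODE.

(** * Davie's maps *)

Section Taylor.
Context {R : realType} (E : normedModType R) (rho : R).
Hypothesis rho01 : 0 < rho <= 1.
Variables (A : E -> E) (k : R).
Hypothesis dA : forall x, differentiable A x.
Hypothesis tDA : tame rho k (Dmap A).

Definition taylor2 (g : E -> E) (x : E) : E := A (x + g x) - A x - Dmap A x (g x).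

Lemma taylor2_le g x m : `|g x| <= m -> `|taylor2 g x| <= k * m ^+ 2.
Proof.
move=> gm; have k0 := tame_ge0 tDA; have m0 := le_trans (normr_ge0 _) gm.
have := @mean_value_ineq _ _ (fun u => A (x + u *: g x) - u *: Dmap A x (g x))
  (k * m ^+ 2).
rewrite /taylor2 !scale1r !scale0r addr0 subr0 [_ - Dmap A x _ - _]addrAC.
apply=> u /andP[u0 u1].
exists ('d A (x + u *: g x) (g x) - Dmap A x (g x)).
  by apply: has_velocityB; [exact: has_velocity_line|exact: has_velocityZ].
rewrite -DmapE// -clin_oppE -clin_addE (le_trans (clin_apply_le _ _))//.
rewrite expr2 mulrA ler_pM//.
rewrite (le_trans (tame_lip _ _ tDA))// ler_wpM2l// addrAC subrr add0r normrZ.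
by rewrite ger0_norm// (le_trans (ler_piMl _ u1)).
Qed.

(** Differentiating the remainder would involve the second derivative of A in two
    orders.  The mean value inequality applied to the difference of the two
    expansions avoids this, and only uses the four-point estimate of the first
    derivative of A. *)
Lemma taylor2_lip g x y l m : 0 <= l -> (forall z, `|g z| <= m) ->
  `|g x - g y| <= l * `|x - y| ->
  `|taylor2 g x - taylor2 g y| <= k * m * (2 * l + m `^ rho) * `|x - y|.
Proof.
move=> l0 gm gl; have k0 := tame_ge0 tDA.
have m0 := le_trans (normr_ge0 _) (gm 0).
have := @mean_value_ineq _ _
  (fun u => (A (x + u *: g x) - u *: Dmap A x (g x)) -
            (A (y + u *: g y) - u *: Dmap A y (g y)))
  (k * m * (2 * l + m `^ rho) * `|x - y|).
rewrite !scale1r !scale0r !addr0 !subr0.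
have -> : A (x + g x) - Dmap A x (g x) - (A (y + g y) - Dmap A y (g y)) -
  (A x - A y) = taylor2 g x - taylor2 g y by rewrite /taylor2; vring.
apply=> u /andP[u0 u1]; set P := x + u *: g x; set Q := y + u *: g y.
exists ('d A P (g x) - Dmap A x (g x) - ('d A Q (g y) - Dmap A y (g y))).
  by apply: has_velocityB; apply: has_velocityB;
    [exact: has_velocity_line|exact: has_velocityZ
    |exact: has_velocity_line|exact: has_velocityZ].
rewrite -!DmapE//.
have -> : Dmap A P (g x) - Dmap A x (g x) - (Dmap A Q (g y) - Dmap A y (g y)) =
  (Dmap A P - Dmap A x - Dmap A Q + Dmap A y) (g x) +
  (Dmap A Q - Dmap A y) (g x - g y).
  move: (Dmap A P) (Dmap A x) (Dmap A Q) (Dmap A y) => M1 M2 M3 M4.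
  by rewrite !clinE; vring.
have ugm z : `|u *: g z| <= m.
  by rewrite normrZ ger0_norm// (le_trans (ler_piMl _ u1)).
have e (z v : E) : z + v - z = v by vring.
have h1 : `|Dmap A P - Dmap A x - Dmap A Q + Dmap A y| <=
    k * (l * `|x - y| + m `^ rho * `|x - y|).
  have [_ _ pD] := tDA.
  have px : `|P - x| <= m by rewrite e.
  have qy : `|Q - y| <= m by rewrite e.
  apply: le_trans (pD P x Q y m px qy) _.
  rewrite ler_wpM2l// lerD2r.
  have -> : P - x - Q + y = u *: (g x - g y) by rewrite /P /Q; vring.
  by rewrite normrZ ger0_norm// (le_trans (ler_piMl _ u1)).
have h2 : `|Dmap A Q - Dmap A y| <= k * m.
  by rewrite (le_trans (tame_lip _ _ tDA))// ler_wpM2l// e.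
rewrite (le_trans (ler_normD _ _))//.
have h3 := le_trans (clin_apply_le _ (g x)) (ler_pM (normr_ge0 _) (normr_ge0 _) h1 (gm x)).
have h4 := le_trans (clin_apply_le _ (g x - g y)) (ler_pM (normr_ge0 _) (normr_ge0 _) h2 gl).
rewrite (le_trans (lerD h3 h4))// le_eqVlt; apply/orP; left; apply/eqP; ring.
Qed.

End Taylor.

Section Davie.
Context {R : realType} {E : normedModType R} (rho K : R).
Hypothesis rho01 : 0 < rho <= 1.
Hypothesis K1 : 1 <= K.
Implicit Types (A B C D V W : E -> E) (v : R).

(** Second derivative of the integral curves of A. *)
Definition accel A (x : E) : E := Dmap A x (A x).

Definition davie A C (x : E) : E := x + (A x + C x + 2^-1 *: accel A x).

(** The increments V_ts and W_ts of a driver satisfy this with v = (t-s)^(1/p). *)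
Definition rough_field v A C : Prop :=
  [/\ forall x, differentiable A x, tame rho (K * v) A,
      tame rho (K * v) (Dmap A) & tame rho (K * v ^+ 2) C].

Lemma rough_field_mono v v' A C : 0 <= v -> v <= v' -> rough_field v A C ->
  rough_field v' A C.
Proof.
move=> v0 vv' [dA tA tD tC]; have K0 : 0 <= K by exact: le_trans K1.
split=> //.
- by apply: tame_mono tA; rewrite ler_wpM2l.
- by apply: tame_mono tD; rewrite ler_wpM2l.
by apply: tame_mono tC; rewrite ler_wpM2l// lerXn2r// nnegrE// (le_trans v0).
Qed.

Lemma accel_tame v A C : rough_field v A C ->
  tame rho (6 * K ^+ 2 * v ^+ 2) (accel A).
Proof.
move=> [_ tA tD _]; have := tame_apply rho01 tD tA.
by have -> : 6 * (K * v) * (K * v) = 6 * K ^+ 2 * v ^+ 2 by ring.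
Qed.

Lemma davie_tail_tame v A C : rough_field v A C ->
  tame rho (4 * K ^+ 2 * v ^+ 2) (fun x => C x + 2^-1 *: accel A x).
Proof.
move=> f; have tU := accel_tame f; case: f => _ _ _ tC.
apply: tame_mono (tameD tC (tameZ 2^-1 tU)).
rewrite ger0_norm ?invr_ge0//.
have : K * v ^+ 2 <= K ^+ 2 * v ^+ 2.
  by rewrite ler_wpM2r ?sqr_ge0// expr2 ler_peMl// (le_trans ler01).
lra.
Qed.

Lemma davie_tame v A C : 0 <= v <= 1 -> rough_field v A C ->
  tame rho (5 * K ^+ 2 * v) (fun x => A x + C x + 2^-1 *: accel A x).
Proof.
move=> /andP[v0 v1] f; have := davie_tail_tame f; case: f => _ tA _ _ tt.
have -> : (fun x => A x + C x + 2^-1 *: accel A x) =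
  (fun x => A x + (C x + 2^-1 *: accel A x)) by apply/funext => x; rewrite addrA.
apply: tame_mono (tameD tA tt).
have K0 : 0 <= K by exact: le_trans K1.
have : K * v <= K ^+ 2 * v by rewrite ler_wpM2r// expr2 ler_peMl.
have : K ^+ 2 * v ^+ 2 <= K ^+ 2 * v.
  by rewrite ler_wpM2l ?sqr_ge0// expr2 ler_piMl.
lra.
Qed.

(** Expansion to second order of the composition of the maps of (A, C) and of
    (B, D). *)
Definition davie2 A B C D (x : E) : E :=
  x + (A x + B x + C x + D x + 2^-1 *: accel A x + 2^-1 *: accel B x +
       Dmap A x (B x)).

(** The difference is a Taylor remainder of A, the product of DA by the part of
    second order of the inner step, and the displacements of C and of accel A
    along the inner step.  Each is of order v^3, with a Lipschitz constant of
    order v^2 v^rho. *)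
Lemma davie_comp v A B C D : 0 <= v <= 1 ->
  rough_field v A C -> rough_field v B D ->
  close_maps (200 * K ^+ 5 * v ^+ 3) (200 * K ^+ 5 * (v ^+ 2 * v `^ rho))
    (davie A C \o davie B D) (davie2 A B C D).
Proof.
move=> v01 fA fB; have /andP[v0 v1] := v01; have /andP[r0 r1] := rho01.
have K_ge1 := K1.
have K0 : 0 <= K by exact: le_trans K1.
pose g x := B x + D x + 2^-1 *: accel B x.
have tg : tame rho (5 * K ^+ 2 * v) g := davie_tame v01 fB.
have tt := davie_tail_tame fB; set t := (fun x => _ + _) in tt.
have tU := accel_tame fA.
case: (fA) => dA tA tDA tC.
have tP := tame_apply rho01 tDA tt.
have defectE x : davie A C (davie B D x) - davie2 A B C D x =
    taylor2 A g x + Dmap A x (t x) + (C (x + g x) - C x) +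
    2^-1 *: (accel A (x + g x) - accel A x).
  rewrite /davie /davie2 /taylor2 -/(g x).
  have -> : Dmap A x (g x) = Dmap A x (B x) + Dmap A x (t x).
    by rewrite /g /t !clinE; vring.
  move: (A (x + g x)) (C (x + g x)) (accel A (x + g x)) => a1 c1 u1.
  move: (Dmap A x (t x)) (Dmap A x (B x)) => d1 d2.
  by rewrite /g; vring.
have gm x := tame_le x tg.
set m := 5 * K ^+ 2 * v in gm.
have m0 : 0 <= m by rewrite /m !mulr_ge0// exprn_ge0.
have K2 : 1 <= K ^+ 2 by rewrite exprn_ege1.
have vw : v <= v `^ rho by exact: powR_ge_id.
have w0 : 0 <= v `^ rho by exact: powR_ge0.
have mr : m `^ rho <= 5 * K ^+ 2 * v `^ rho.
  rewrite /m powRM//; last by lra.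
  rewrite ler_wpM2r//.
  by rewrite ler1_powR//; lra.
have sh x : x + g x - x = g x by vring.
(* all the powers of K are absorbed in the fifth one *)
have K3 : K ^+ 3 <= K ^+ 5 by rewrite ler_weXn2l.
have K4 : K ^+ 4 <= K ^+ 5 by rewrite ler_weXn2l.
have v3 : 0 <= v ^+ 3 by rewrite exprn_ge0.
have K50 : 0 <= K ^+ 5 by rewrite exprn_ge0.
have vv0 : 0 <= v ^+ 2 by rewrite exprn_ge0.
split=> [x|x y]; rewrite ?defectE.
  have b1 : `|taylor2 A g x| <= K * v * m ^+ 2 := taylor2_le dA tDA (gm x).
  have b2 := tame_le x tP.
  have b3 : `|C (x + g x) - C x| <= K * v ^+ 2 * m.
    rewrite (le_trans (tame_lip _ _ tC))// sh ler_wpM2l//.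
    by rewrite mulr_ge0.
  have b4 : `|2^-1 *: (accel A (x + g x) - accel A x)| <=
      2^-1 * (6 * K ^+ 2 * v ^+ 2 * m).
    rewrite normrZ ger0_norm ?invr_ge0// ler_wpM2l ?invr_ge0//.
    rewrite (le_trans (tame_lip _ _ tU))// sh ler_wpM2l//.
    by rewrite !mulr_ge0// exprn_ge0.
  apply: le_trans (ler_norm4 _ _ _ _) _.
  apply: le_trans (lerD (lerD (lerD b1 b2) b3) b4) _.
  have -> : K * v * m ^+ 2 + 6 * (K * v) * (4 * K ^+ 2 * v ^+ 2) +
      K * v ^+ 2 * m + 2^-1 * (6 * K ^+ 2 * v ^+ 2 * m) =
    (25 * K ^+ 5 + 24 * K ^+ 3 + 5 * K ^+ 3 + 15 * K ^+ 4) * v ^+ 3.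
    by rewrite /m; field.
  by rewrite ler_wpM2r//; lra.
have [_ _ pg] := tg.
have b1 : `|taylor2 A g x - taylor2 A g y| <=
    K * v * m * (2 * m + m `^ rho) * `|x - y|.
  by apply: (taylor2_lip dA tDA m0 gm); exact: tame_lip tg.
have b2 := tame_lip x y tP.
have b3 := fourpt_shift x y tC pg gm.
have b4 := fourpt_shift x y tU pg gm.
have -> : taylor2 A g x + Dmap A x (t x) + (C (x + g x) - C x) +
    2^-1 *: (accel A (x + g x) - accel A x) -
   (taylor2 A g y + Dmap A y (t y) + (C (y + g y) - C y) +
    2^-1 *: (accel A (y + g y) - accel A y)) =
  (taylor2 A g x - taylor2 A g y) + (Dmap A x (t x) - Dmap A y (t y)) +
  (C (x + g x) - C x - C (y + g y) + C y) +
  2^-1 *: (accel A (x + g x) - accel A x - accel A (y + g y) + accel A y)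
  by vring.
apply: le_trans (ler_norm4 _ _ _ _) _.
rewrite normrZ ger0_norm ?invr_ge0//.
have b4' : 2^-1 * `|accel A (x + g x) - accel A x - accel A (y + g y) + accel A y|
    <= 2^-1 * (6 * K ^+ 2 * v ^+ 2 * (m + m `^ rho) * `|x - y|).
  by rewrite ler_wpM2l ?invr_ge0.
apply: le_trans (lerD (lerD (lerD b1 b2) b3) b4') _.
have -> : K * v * m * (2 * m + m `^ rho) * `|x - y| +
    6 * (K * v) * (4 * K ^+ 2 * v ^+ 2) * `|x - y| +
    K * v ^+ 2 * (m + m `^ rho) * `|x - y| +
    2^-1 * (6 * K ^+ 2 * v ^+ 2 * (m + m `^ rho) * `|x - y|) =
  (K * v * m * (2 * m + m `^ rho) + 24 * K ^+ 3 * v ^+ 3 +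
   (K + 3 * K ^+ 2) * v ^+ 2 * (m + m `^ rho)) * `|x - y| by field.
rewrite ler_wpM2r//.
set w := v `^ rho in vw w0 mr *.
have mw : m <= 5 * K ^+ 2 * w by rewrite /m ler_wpM2l// mulr_ge0// exprn_ge0.
have h1 : K * v * m * (2 * m + m `^ rho) <= K * v * m * (15 * K ^+ 2 * w).
  rewrite ler_wpM2l//; first by rewrite !mulr_ge0.
  lra.
have h2 : 24 * K ^+ 3 * v ^+ 3 <= 24 * K ^+ 3 * (v ^+ 2 * w).
  rewrite ler_wpM2l//; first by rewrite mulr_ge0// exprn_ge0.
  by rewrite exprSr ler_wpM2l.
have h3 : (K + 3 * K ^+ 2) * v ^+ 2 * (m + m `^ rho) <=
    (K + 3 * K ^+ 2) * v ^+ 2 * (10 * K ^+ 2 * w).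
  rewrite ler_wpM2l//; last by lra.
  by rewrite mulr_ge0// addr_ge0// mulr_ge0// exprn_ge0.
apply: le_trans (lerD (lerD h1 h2) h3) _.
have -> : K * v * m * (15 * K ^+ 2 * w) + 24 * K ^+ 3 * (v ^+ 2 * w) +
    (K + 3 * K ^+ 2) * v ^+ 2 * (10 * K ^+ 2 * w) =
  (75 * K ^+ 5 + 24 * K ^+ 3 + 10 * K ^+ 3 + 30 * K ^+ 4) * (v ^+ 2 * w).
  by rewrite /m; ring.
by rewrite ler_wpM2r ?mulr_ge0//; lra.
Qed.

End Davie.

(** * Families of rough fields satisfying Chen's relation *)

Section TimeOne.
Context {R : realType} {E : completeNormedModType R} (rho K : R).
Hypothesis rho01 : 0 < rho <= 1.
Hypothesis K1 : 1 <= K.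

(** Along a solution y, three successive mean value inequalities give
    y_u - x = O(v), y_u - x - u A(x) = O(v^2), and then the claim. *)
Lemma time1_davie (v : R) (A C : E -> E) x : 0 <= v <= 1 ->
  rough_field rho K v A C ->
  `|time1_map (A \+ C) x - davie A C x| <= 9 * K ^+ 3 * v ^+ 3.
Proof.
move=> /andP[v0 v1] [dA tA tDA tC].
have K_ge1 := K1; have K0 : 0 <= K by exact: le_trans K1.
have tF := tameD tA tC.
have [y [y0 y1 yF]] := time1_map_spec rho01 tF x.
have vv : v ^+ 2 <= v by rewrite expr2 ler_piMl.
have vv0 : 0 <= v ^+ 2 by exact: sqr_ge0.
have Kv0 : 0 <= K * v by exact: mulr_ge0.
have KK : K <= K ^+ 2 by rewrite expr2 ler_peMl.
have Kvv : K * v ^+ 2 <= K * v by rewrite ler_wpM2l.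
have Fle z : `|A z + C z| <= 2 * (K * v).
  by rewrite (le_trans (tame_le z tF))//; lra.
have y01 u : 0 <= u <= 1 -> `|y u - x| <= 2 * (K * v).
  move=> u01; have := mean_value_ineq_at (y := y) (M := 2 * (K * v)) u01.
  rewrite y0 => /(_ _)/le_trans; apply; last first.
    by rewrite ler_piMr//; [rewrite mulr_ge0|case/andP: u01].
  by move=> w w01; exists (A (y w) + C (y w)); [exact: yF|exact: Fle].
have y02 u : 0 <= u <= 1 -> `|y u - x - u *: A x| <= 3 * (K ^+ 2 * v ^+ 2).
  move=> u01; have := mean_value_ineq_at (y := fun u => y u - x - u *: A x)
    (M := 3 * (K ^+ 2 * v ^+ 2)) u01.
  rewrite y0 scale0r !subr0 subrr subr0 => /(_ _)/le_trans; apply; last first.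
    rewrite ler_piMr//; last by case/andP: u01.
    by rewrite !mulr_ge0// exprn_ge0.
  move=> w w01; exists (A (y w) + C (y w) - 0 - A x).
    apply: has_velocityB; last exact: has_velocityZ.
    by apply: has_velocityB; [exact: yF|exact: has_velocity_cst].
  rewrite subr0 addrAC (le_trans (ler_normD _ _))//.
  have h1 : `|A (y w) - A x| <= K * v * (2 * (K * v)).
    by rewrite (le_trans (tame_lip _ _ tA))// ler_wpM2l// y01.
  have h2 : K * v ^+ 2 <= K ^+ 2 * v ^+ 2 by rewrite ler_wpM2r.
  by have := tame_le (y w) tC; lra.
pose g u := y u - x - u *: (A x + C x) - (u ^+ 2 / 2) *: accel A x.
have := @mean_value_ineq _ _ g (9 * K ^+ 3 * v ^+ 3).
have -> : g 1 - g 0 = time1_map (A \+ C) x - davie A C x.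
  rewrite /g y1 y0 scale0r expr0n/= mul0r scale0r !subr0 subrr subr0 expr1n.
  by rewrite mul1r scale1r /davie; vring.
apply=> u u01; exists (A (y u) + C (y u) - 0 - (A x + C x) - u *: accel A x).
  apply: has_velocityB; last exact: has_velocity_sqr.
  apply: has_velocityB; last exact: has_velocityZ.
  by apply: has_velocityB; [exact: yF|exact: has_velocity_cst].
have -> : A (y u) + C (y u) - 0 - (A x + C x) - u *: accel A x =
  taylor2 A (fun=> y u - x) x + Dmap A x (y u - x - u *: A x) + (C (y u) - C x).
  rewrite /taylor2 /accel subrKC.
  move: (Dmap A x) (A (y u)) (C (y u)) => M1 a1 c1.
  by rewrite !clinE; vring.
have h1 : `|taylor2 A (fun=> y u - x) x| <= K * v * (2 * (K * v)) ^+ 2.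
  by apply: (taylor2_le dA tDA); exact: y01.
have h2 : `|Dmap A x (y u - x - u *: A x)| <= K * v * (3 * (K ^+ 2 * v ^+ 2)).
  rewrite (le_trans (clin_apply_le _ _))// ler_pM//; last exact: y02.
  exact: tame_le tDA.
have h3 : `|C (y u) - C x| <= K * v ^+ 2 * (2 * (K * v)).
  by rewrite (le_trans (tame_lip _ _ tC))// ler_wpM2l ?y01// mulr_ge0.
apply: le_trans (ler_norm3 _ _ _) _.
apply: le_trans (lerD (lerD h1 h2) h3) _.
have -> : K * v * (2 * (K * v)) ^+ 2 + K * v * (3 * (K ^+ 2 * v ^+ 2)) +
    K * v ^+ 2 * (2 * (K * v)) = 7 * K ^+ 3 * v ^+ 3 + 2 * (K * (K * v ^+ 3)).
  by ring.
have v3 : 0 <= v ^+ 3 by rewrite exprn_ge0.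
have : K * (K * v ^+ 3) <= K ^+ 2 * (K * v ^+ 3).
  by rewrite ler_wpM2r// mulr_ge0.
have -> : K ^+ 2 * (K * v ^+ 3) = K ^+ 3 * v ^+ 3 by ring.
lra.
Qed.

End TimeOne.

Section DriverFields.
Context {R : realType} {E : normedModType R}.
Variables (T p rho K : R).

(** What remains of a rough driver once Chen's relation has been read on vector
    fields. *)
Record driver_fields (V W : R -> R -> E -> E) : Prop := DriverFields {
  df_field : forall s t : R, 0 <= s -> s <= t -> t <= T -> t - s <= 1 ->
    rough_field rho K ((t - s) `^ p^-1) (V t s) (W t s);
  df_diff : forall (s t : R) x, 0 <= s -> s <= t -> t <= T ->
    differentiable (V t s) x;
  df_add : forall (s u t : R) x, 0 <= s -> s <= u -> u <= t -> t <= T ->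
    V t s x = V t u x + V u s x;
  df_chen : forall (s u t : R) x, 0 <= s -> s <= u -> u <= t -> t <= T ->
    W t s x = W t u x + W u s x +
      2^-1 *: (Dmap (V t u) x (V u s x) - Dmap (V u s) x (V t u x))
}.

Definition davie_family (V W : R -> R -> E -> E) (t s : R) : E -> E :=
  davie (V t s) (W t s).

End DriverFields.

Lemma sub_of_addE (G : zmodType) (a b c d e : G) :
  e = a + b -> e = c + d -> a - d = c - b.
Proof. by move=> -> /(canRL (addrK _)) ->; rewrite addrAC addrK. Qed.

Lemma sub_of_addDE (R : realType) (E : normedModType R) (a b c d e f g : E) :
  e = a + b + f -> e = c + d + g -> a - d = c - b + g - f.
Proof.
move=> -> h; have -> : a = c + d + g - b - f by rewrite -h; vring.
by vring.
Qed.

Lemma davie_perturb (R : realType) (E : normedModType R) (K k : R)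
    (x v1 v2 v3 v4 w1 w2 w3 w4 : E) (d1 d2 d3 d4 : clin E E) :
  1 <= K -> 0 <= k -> v3 - v4 = v2 - v1 -> d3 - d4 = d2 - d1 ->
  w3 - w4 = w2 - w1 + 2^-1 *: (d2 v4 - d4 v2) - 2^-1 *: (d3 v1 - d1 v3) ->
  `|v1| <= K * k -> `|v2| <= K * k -> `|v3| <= K -> `|v4| <= K ->
  `|d1| <= K * k -> `|d2| <= K * k -> `|d3| <= K -> `|d4| <= K ->
  `|w1| <= K * k -> `|w2| <= K * k ->
  `|(x + (v3 + w3 + 2^-1 *: d3 v3)) - (x + (v4 + w4 + 2^-1 *: d4 v4))|
    <= 8 * K ^+ 2 * k.
Proof.
move=> K1 k0 eV eD eW hv1 hv2 hv3 hv4 hd1 hd2 hd3 hd4 hw1 hw2.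
have K0 : 0 <= K by exact: le_trans K1.
have kl : K <= K ^+ 2 by rewrite expr2 ler_peMl.
have norm2 (u w : E) : `|2^-1 *: (u - w)| <= 2^-1 * (`|u| + `|w|).
  by rewrite normrZ ger0_norm ?invr_ge0// ler_wpM2l ?invr_ge0// ler_normB.
have eU : d3 v3 - d4 v4 = (d3 - d4) v3 + d4 (v3 - v4) by rewrite !clinE; vring.
have -> : x + (v3 + w3 + 2^-1 *: d3 v3) - (x + (v4 + w4 + 2^-1 *: d4 v4)) =
  (v3 - v4) + (w3 - w4) + 2^-1 *: (d3 v3 - d4 v4) by vring.
have dbl : 2 * K * k = K * k + K * k by ring.
have b1 : `|v3 - v4| <= 2 * K * k.
  by rewrite eV dbl (le_trans (ler_normB _ _))// lerD.
have b2 : `|d3 - d4| <= 2 * K * k.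
  by rewrite eD dbl (le_trans (ler_normB _ _))// lerD.
have b3 : `|d3 v3 - d4 v4| <= 2 * K * k * K + K * (2 * K * k).
  by rewrite eU (le_trans (ler_normD _ _))// lerD// clin_apply_bound.
have b4 : `|w3 - w4| <= 2 * K * k + 2 * (K * K * k).
  rewrite eW (le_trans (ler_normB _ _))//.
  rewrite (le_trans (lerD (ler_normD _ _) (lexx _)))//.
  rewrite (le_trans (lerD (lerD (ler_normB _ _) (norm2 _ _)) (norm2 _ _)))//.
  have half (u w : R) : u <= K * K * k -> w <= K * K * k ->
      2^-1 * (u + w) <= K * K * k.
    by move=> uK wK; rewrite ler_pdivrMl// mulr_natl mulr2n lerD.
  have -> : 2 * K * k + 2 * (K * K * k) =
    K * k + K * k + K * K * k + K * K * k by ring.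
  have e1 : K * k * K = K * K * k by ring.
  rewrite !lerD// half//.
  - by rewrite -e1 clin_apply_bound.
  - by rewrite -mulrA clin_apply_bound.
  - by rewrite -mulrA clin_apply_bound.
  - by rewrite -e1 clin_apply_bound.
apply: le_trans (ler_norm3 _ _ _) _.
rewrite normrZ (ger0_norm (_ : 0 <= 2^-1)) ?invr_ge0//.
have b5 : 2^-1 * `|d3 v3 - d4 v4| <= 2 * (K ^+ 2 * k).
  rewrite ler_pdivrMl// (le_trans b3)// le_eqVlt; apply/orP; left; apply/eqP.
  by ring.
apply: le_trans (lerD (lerD b1 b4) b5) _.
have : K * k <= K ^+ 2 * k by rewrite ler_wpM2r.
by rewrite expr2; lra.
Qed.

Section DavieFamily.
Context {R : realType} {E : normedModType R}.
Variables (T p rho K : R).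
Hypothesis rho01 : 0 < rho <= 1.
Hypothesis K1 : 1 <= K.
Hypothesis p0 : 0 < p.
Variables (V W : R -> R -> E -> E).
Hypothesis VW : driver_fields T p rho K V W.

Lemma DmapD (f g : E -> E) x : differentiable f x -> differentiable g x ->
  Dmap (fun x => f x + g x) x = Dmap f x + Dmap g x.
Proof.
move=> df dg; have dfg : differentiable (f + g) x by exact: differentiableD.
apply/val_inj/funext => v.
have -> : val (Dmap f x + Dmap g x) v = 'd f x v + 'd g x v.
  by rewrite -(DmapE v df) -(DmapE v dg).
by rewrite -[LHS]/(Dmap (f + g) x v) DmapE// diffD.
Qed.

Lemma df_Dadd (s u t : R) x : 0 <= s -> s <= u -> u <= t -> t <= T ->
  Dmap (V t s) x = Dmap (V t u) x + Dmap (V u s) x.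
Proof.
move=> s0 su ut tT.
have -> : V t s = (fun x => V t u x + V u s x).
  by apply/funext => z; exact: (df_add VW z s0 su ut tT).
rewrite DmapD//; apply: (df_diff VW) => //.
- exact: le_trans su.
- exact: le_trans tT.
Qed.

Lemma davie2_driver (s u t : R) x : 0 <= s -> s <= u -> u <= t -> t <= T ->
  davie2 (V t u) (V u s) (W t u) (W u s) x = davie_family V W t s x.
Proof.
move=> s0 su ut tT; rewrite /davie2 /davie_family /davie /accel.
rewrite (df_Dadd x s0 su ut tT) (df_add VW x s0 su ut tT).
rewrite (df_chen VW x s0 su ut tT).
move: (Dmap (V t u) x) (Dmap (V u s) x) (V t u x) (V u s x) => M1 M2 a b.
move: (W t u x) (W u s x) => c d; rewrite !clinE; vfield => //.
Qed.

Let K0 : 0 <= K. Proof. exact: le_trans K1. Qed.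

Lemma rate_powers (z : R) : 0 <= z ->
  (z `^ p^-1) ^+ 3 = z `^ (3 / p) /\
  (z `^ p^-1) ^+ 2 * (z `^ p^-1) `^ rho = z `^ ((2 + rho) / p).
Proof.
move=> z0; have r0 : 0 < rho by case/andP: rho01.
split; first by rewrite -powR_mulrn ?powR_ge0// -powRrM mulrC.
rewrite -powR_mulrn ?powR_ge0// -!powRrM -powRD.
  by congr (_ `^ _); field; rewrite gt_eqF.
apply/implyP => /eqP h; have : 0 < p^-1 * 2%:R + p^-1 * rho.
  by rewrite addr_gt0// mulr_gt0// invr_gt0.
by rewrite h ltxx.
Qed.

Lemma rate_mono (z z' : R) : 0 <= z -> z <= z' -> z `^ p^-1 <= z' `^ p^-1.
Proof.
move=> z0 zz; rewrite ge0_ler_powR ?nnegrE ?invr_ge0 ?(ltW p0)//.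
exact: le_trans zz.
Qed.

Lemma rate01 (z : R) : 0 <= z -> z <= 1 -> 0 <= z `^ p^-1 <= 1.
Proof.
by move=> z0 z1; rewrite powR_ge0 /=; have := rate_mono z0 z1; rewrite powR1.
Qed.

(** Additivity and Chen's relation express the increments of V and W in their two
    times through their values over the short intervals [s', s] and [t', t]. *)
Lemma davie_family_time (s s' t t' h : R) x : 0 <= s' -> s' <= s -> s <= t' ->
  t' <= t -> t <= T -> t - s' <= 1 -> s - s' <= h -> t - t' <= h ->
  `|davie_family V W t s x - davie_family V W t' s' x| <=
    8 * K ^+ 2 * h `^ p^-1.
Proof.
move=> s'0 s's st' t't tT ts1 sh th.
have K_ge1 := K1.
have s0 : 0 <= s by lra. have t'0 : 0 <= t' by lra.
have st : s <= t by lra. have s't' : s' <= t' by lra.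
have sT : s <= T by lra. have t'T : t' <= T by lra.
have [ts1' ts1'' ss1 tt1] : [/\ t - s <= 1, t' - s' <= 1, s - s' <= 1 & t - t' <= 1].
  by split; lra.
set k := h `^ p^-1; have k0 : 0 <= k by exact: powR_ge0.
have kl : K <= K ^+ 2 by rewrite expr2 ler_peMl.
have small (a b : R) : 0 <= a -> a <= b -> b <= T -> b - a <= 1 -> b - a <= h ->
    [/\ `|V b a x| <= K * k, `|Dmap (V b a) x| <= K * k & `|W b a x| <= K * k].
  move=> a0 ab bT ba1 bah; have ba0 : 0 <= b - a by lra.
  have [_ tV tD tW] := df_field VW a0 ab bT ba1.
  have /andP[v0 v1] := rate01 ba0 ba1.
  have vk : (b - a) `^ p^-1 <= k by exact: rate_mono.
  split.
  - by rewrite (le_trans (tame_le x tV))// ler_wpM2l.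
  - by rewrite (le_trans (tame_le x tD))// ler_wpM2l.
  - rewrite (le_trans (tame_le x tW))// ler_wpM2l// (le_trans _ vk)//.
    by rewrite expr2 ler_piMl.
have big (a b : R) : 0 <= a -> a <= b -> b <= T -> b - a <= 1 ->
    `|V b a x| <= K /\ `|Dmap (V b a) x| <= K.
  move=> a0 ab bT ba1; have ba0 : 0 <= b - a by lra.
  have [_ tV tD tW] := df_field VW a0 ab bT ba1.
  have /andP[v0 v1] := rate01 ba0 ba1.
  by split; [apply: le_trans (tame_le x tV) _|apply: le_trans (tame_le x tD) _];
    rewrite ler_piMr.
have [v1 d1 w1] : [/\ `|V s s' x| <= K * k, `|Dmap (V s s') x| <= K * k &
  `|W s s' x| <= K * k] by exact: small.
have [v2 d2 w2] : [/\ `|V t t' x| <= K * k, `|Dmap (V t t') x| <= K * k &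
  `|W t t' x| <= K * k] by exact: small.
have [v3 d3] : `|V t s x| <= K /\ `|Dmap (V t s) x| <= K by exact: big.
have [v4 d4] : `|V t' s' x| <= K /\ `|Dmap (V t' s') x| <= K.
  exact: big.
have eV : V t s x - V t' s' x = V t t' x - V s s' x.
  have h1 := df_add VW x s'0 s's st tT.
  have h2 := df_add VW x s'0 s't' t't tT.
  exact: sub_of_addE h1 h2.
have eD : Dmap (V t s) x - Dmap (V t' s') x = Dmap (V t t') x - Dmap (V s s') x.
  have h1 := df_Dadd x s'0 s's st tT.
  have h2 := df_Dadd x s'0 s't' t't tT.
  exact: sub_of_addE h1 h2.
have eW : W t s x - W t' s' x = W t t' x - W s s' x +
  2^-1 *: (Dmap (V t t') x (V t' s' x) - Dmap (V t' s') x (V t t' x)) -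
  2^-1 *: (Dmap (V t s) x (V s s' x) - Dmap (V s s') x (V t s x)).
  have h1 := df_chen VW x s'0 s's st tT.
  have h2 := df_chen VW x s'0 s't' t't tT.
  exact: sub_of_addDE h1 h2.
exact: (davie_perturb x K_ge1 k0 eV eD eW v1 v2 v3 v4 d1 d2 d3 d4 w1 w2).
Qed.

(** By Chen's relation the expansion [davie2] of nu_tu o nu_us is exactly nu_ts. *)
Lemma davie_almost_flow :
  almost_flow T (200 * K ^+ 5) ((2 + rho) / p) (3 / p) p^-1 rho
    (davie_family V W).
Proof.
have K_ge1 := K1.
have K2 : 1 <= K ^+ 2 by rewrite exprn_ege1.
have K25 : K ^+ 2 <= K ^+ 5 by rewrite ler_weXn2l.
split=> [t x t0 tT|s t s0 st tT ts1|s u t s0 su ut tT ts1|s s' t t' h x s'0 s's st' t't tT ts1 sh th].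
- have tt1 : t - t <= 1 by rewrite subrr ler01.
  have [_ tV tD tW] := df_field VW t0 (lexx t) tT tt1.
  have z0 : (t - t) `^ p^-1 = 0 by rewrite subrr powR0// invr_eq0 gt_eqF.
  rewrite z0 in tV tD tW.
  have V0 : V t t x = 0.
    by apply/eqP; rewrite -normr_le0 (le_trans (tame_le x tV))// mulr0.
  have W0 : W t t x = 0.
    by apply/eqP; rewrite -normr_le0 (le_trans (tame_le x tW))// expr0n mulr0.
  by rewrite /davie_family /davie /accel V0 W0 linear0 scaler0 !addr0.
- have ts0 : 0 <= t - s by rewrite subr_ge0.
  have f := df_field VW s0 st tT ts1.
  have v01 := rate01 ts0 ts1; have /andP[v0 v1] := v01.
  have := davie_tame rho01 K1 v01 f.
  have -> : (fun x => davie_family V W t s x - x) =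
    (fun x => V t s x + W t s x + 2^-1 *: accel (V t s) x).
    by apply/funext => x; rewrite /davie_family /davie addrAC subrr add0r.
  by apply: tame_mono; rewrite ler_wpM2r//; lra.
- have ts0 : 0 <= t - s by lra.
  have v01 := rate01 ts0 ts1.
  have uT : u <= T by lra. have u0 : 0 <= u by lra.
  have us0 : 0 <= u - s by lra. have tu0 : 0 <= t - u by lra.
  have us1 : u - s <= 1 by lra. have tu1 : t - u <= 1 by lra.
  have fA := df_field VW u0 ut tT tu1.
  have fB := df_field VW s0 su uT us1.
  have {}fA : rough_field rho K ((t - s) `^ p^-1) (V t u) (W t u).
    by apply: rough_field_mono fA => //; [exact: powR_ge0|apply: rate_mono => //; lra].
  have {}fB : rough_field rho K ((t - s) `^ p^-1) (V u s) (W u s).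
    by apply: rough_field_mono fB => //; [exact: powR_ge0|apply: rate_mono => //; lra].
  have [<- <-] := rate_powers ts0.
  have [c1 c2] := davie_comp rho01 K1 v01 fA fB.
  have dE x : davie2 (V t u) (V u s) (W t u) (W u s) x = davie_family V W t s x.
    exact: davie2_driver.
  split=> [x|x y]; rewrite -!dE; [exact: c1|exact: c2].
apply: le_trans (davie_family_time x s'0 s's st' t't tT ts1 sh th) _.
by rewrite ler_wpM2r ?powR_ge0//; lra.
Qed.

End DavieFamily.

(** * Bounds extracted from the Hoelder norms *)

Section CnormBound.
Context {R : realType} {E F : normedModType R}.
Implicit Types (f g : E -> F) (n : nat) (rho K : R).

(** Pointwise content of a bound on the norm of C^(n+rho).  The factor 2 extends
    the Hoelder estimate to all distances. *)
Definition Cbound n rho K f : Prop :=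
  [/\ ntimes_differentiable n f,
      forall i x, (i <= n)%N -> `|iterDmap f i x| <= K &
      forall x y, `|iterDmap f n x - iterDmap f n y| <= 2 * K * `|x - y| `^ rho].

Lemma supnorm_ge (G : normedModType R) (g : E -> G) x : (`|g x|%:E <= supnorm g)%E.
Proof. by apply: ereal_sup_ubound; exists x. Qed.

Lemma supnorm_ge0 (G : normedModType R) (g : E -> G) : (0 <= supnorm g)%E.
Proof. by rewrite (le_trans _ (supnorm_ge g 0))// lee_fin. Qed.

Lemma holder_seminorm_ge0 rho (G : normedModType R) (g : E -> G) :
  (0 <= holder_seminorm rho g)%E.
Proof. by apply: ereal_sup_ubound; left. Qed.

Lemma Cnorm_Cbound n rho K f : 0 < rho <= 1 -> (Cnorm n rho f <= K%:E)%E ->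
  Cbound n rho K f.
Proof.
move=> /andP[r0 r1]; rewrite /Cnorm; case: asboolP => [df|//] fK.
have sum0 : (0 <= \sum_(i < n.+1) supnorm (iterDmap f i))%E.
  by apply: sume_ge0 => i _; exact: supnorm_ge0.
have hold : (holder_seminorm rho (iterDmap f n) <= K%:E)%E.
  by rewrite (le_trans _ fK)// leeDr.
have bd i x : (i <= n)%N -> `|iterDmap f i x| <= K.
  move=> ilen; rewrite -lee_fin (le_trans (supnorm_ge (iterDmap f i) x))//.
  rewrite (le_trans _ fK)// (le_trans _ (leeDl _ (holder_seminorm_ge0 _ _)))//.
  have iln : (i < n.+1)%N by [].
  rewrite (bigD1 (Ordinal iln))//= leeDl// sume_ge0// => j _.
  exact: supnorm_ge0.
split=> // x y; have K0 : 0 <= K by exact: le_trans (bd n 0 (leqnn n)).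
have [->|xy] := eqVneq x y.
  by rewrite !subrr normr0 mulr_ge0 ?powR_ge0// mulr_ge0.
have xy0 : 0 < `|x - y| by rewrite normr_gt0 subr_eq0.
have [xy1|xy1] := leP `|x - y| 1.
  have : ((`|iterDmap f n x - iterDmap f n y| / `|x - y| `^ rho)%:E <= K%:E)%E.
    rewrite (le_trans _ hold)//; apply: ereal_sup_ubound; right.
    by exists (x, y) => //=; rewrite xy0.
  rewrite lee_fin ler_pdivrMr ?powR_gt0// => /le_trans; apply.
  by rewrite ler_wpM2r ?powR_ge0//; lra.
apply: (@le_trans _ _ (2 * K)).
  rewrite (le_trans (ler_normB _ _))//.
  by have := bd n x (leqnn n); have := bd n y (leqnn n); lra.
by rewrite ler_peMr ?mulr_ge0// powR_ge_one// ltW.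
Qed.

Lemma iterDmapB n f g : ntimes_differentiable n f -> ntimes_differentiable n g ->
  forall i, (i <= n)%N ->
    iterDmap (f \- g) i = (fun x => iterDmap f i x - iterDmap g i x).
Proof.
move=> df dg; elim=> [|i IH] iln //.
apply/funext => x; apply/val_inj/funext => v.
have di := df i iln x; have dj := dg i iln x.
have -> : val (iterDmap f i.+1 x - iterDmap g i.+1 x) v =
    'd (iterDmap f i) x v - 'd (iterDmap g i) x v.
  by rewrite -(DmapE v di) -(DmapE v dj).
rewrite [LHS]/= (IH (ltnW iln)).
have dB : differentiable (iterDmap f i - iterDmap g i) x.
  exact: differentiableB.
by rewrite -[LHS]/(Dmap (iterDmap f i - iterDmap g i) x v) (DmapE v dB) diffB.
Qed.

Lemma CboundB n rho K K' f g : Cbound n rho K f -> Cbound n rho K' g ->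
  Cbound n rho (K + K') (f \- g).
Proof.
move=> [df bf hf] [dg bg hg]; have e := iterDmapB df dg.
split=> [i iln x|i x iln|x y].
- rewrite (e i (ltnW iln)).
  by apply: differentiableB; [exact: df|exact: dg].
- by rewrite e// (le_trans (ler_normB _ _))// lerD ?bf ?bg.
rewrite !e//.
have -> : iterDmap f n x - iterDmap g n x - (iterDmap f n y - iterDmap g n y) =
  (iterDmap f n x - iterDmap f n y) - (iterDmap g n x - iterDmap g n y).
  move: (iterDmap f n x) (iterDmap g n x) (iterDmap f n y) (iterDmap g n y).
  by move=> a b c d; vring.
by rewrite (le_trans (ler_normB _ _))// mulrDr mulrDl lerD.
Qed.

End CnormBound.

Section CboundTame.
Context {R : realType} {E F : normedModType R} (rho K : R).
Hypothesis rho01 : 0 < rho <= 1.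
Implicit Types f : E -> F.

Lemma Cbound_ge0 n f : Cbound n rho K f -> 0 <= K.
Proof. by move=> [_ b _]; exact: le_trans (b 0%N 0 isT). Qed.

Lemma Cbound1_tame f : Cbound 1 rho K f -> tame rho (2 * K) f.
Proof.
move=> bf; have K0 := Cbound_ge0 bf; case: bf => df bf hf.
have K2 : K <= 2 * K by lra.
split; first exact: mulr_ge0.
  by move=> x; rewrite (le_trans (bf 0%N x isT)).
apply: C1_fourpt => //.
- by move=> x; exact: (df 0%N isT).
- by move=> x; rewrite (le_trans (bf 1%N x isT)).
Qed.

(** The derivative of f is bounded and Lipschitz, hence Hoelder, which gives the
    four-point estimate of f; that of the derivative uses the second derivative. *)
Lemma Cbound2_tame f : Cbound 2 rho K f ->
  [/\ forall x, differentiable f x, tame rho (2 * K) f & tame rho (2 * K) (Dmap f)].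
Proof.
move=> bf; have K0 := Cbound_ge0 bf; case: bf => df bf hf.
have K2 : K <= 2 * K by lra.
have K20 : 0 <= 2 * K by exact: mulr_ge0.
have d0 x : differentiable f x by exact: (df 0%N isT).
have d1 x : differentiable (Dmap f) x by exact: (df 1%N isT).
have b0 x : `|f x| <= K by exact: (bf 0%N).
have b1 x : `|Dmap f x| <= K by exact: (bf 1%N).
have b2 x : `|Dmap (Dmap f) x| <= K by exact: (bf 2%N).
have hD x y : `|Dmap f x - Dmap f y| <= 2 * K * `|x - y| `^ rho.
  apply: interpolate_powR => //.
    by rewrite (le_trans (ler_normB _ _))// mulr_natl mulr2n lerD.
  by rewrite (le_trans (lip_of_Dmap d1 b2 x y))// ler_wpM2r.
split=> //; split=> //.
- by move=> x; exact: le_trans (b0 x) K2.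
- by apply: C1_fourpt => // x; exact: le_trans (b1 x) K2.
- by move=> x; exact: le_trans (b1 x) K2.
- by apply: C1_fourpt => // x; exact: le_trans (b2 x) K2.
Qed.

End CboundTame.

(** * Test functions and Chen's relation for vector fields *)

Section TestFunctions.
Context {R : realType} {E : normedModType R}.
Implicit Types (l : clin E R^o) (x : E).

Lemma norming_clin x0 : exists l, l x0 = `|x0|.
Proof.
have [f [flin fb fx]] := norming_functional x0.
pose fL := GRing.isLinear.Build _ _ _ _ f flin.
pose g : {linear E -> R^o} := HB.pack f fL.
have fc : continuous f.
  apply/(@linear_bounded_continuous _ _ _ g)/bounded_funP => r.
  by exists r => x xr; rewrite (le_trans (fb x)).
have fcl : f \in @contlin R E R^o by apply/asboolP.
by exists (Clin fcl).
Qed.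

Lemma clin_separates x y : (forall l, l x = l y) -> x = y.
Proof.
move=> h; have [l lx] := norming_clin (x - y).
apply/eqP; rewrite -subr_eq0 -normr_eq0 -lx.
by rewrite clinD clinN h subrr.
Qed.

Lemma clin_diff (F : normedModType R) (l : clin E F) x :
  differentiable l x /\ 'd l x = l :> (E -> F).
Proof.
split; first by apply: linear_differentiable; exact: clin_continuous.
by apply: diff_lin; exact: clin_continuous.
Qed.

Lemma Dmap_clin (F : normedModType R) (l : clin E F) x : Dmap l x = l.
Proof.
have [dl e] := clin_diff l x; apply/val_inj/funext => v.
by rewrite -[LHS]/(Dmap l x v) DmapE// e.
Qed.

Lemma Dmap_cst (F : normedModType R) (c : F) (x : E) : Dmap (fun _ : E => c) x = 0.
Proof.
apply/val_inj/funext => v.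
by rewrite -[LHS]/(Dmap (cst c) x v) DmapE// diff_cst.
Qed.

Lemma is_C2_clin l : is_Cn 2 (l : E -> R^o).
Proof.
have D1 : Dmap (l : E -> R^o) = fun=> l by apply/funext => x; exact: Dmap_clin.
have D2 : Dmap (Dmap (l : E -> R^o)) = fun=> 0.
  by apply/funext => x; rewrite D1 Dmap_cst.
split=> [[|[|//]] _ x|]; rewrite /=.
- by have [] := clin_diff l x.
- by rewrite D1; exact: differentiable_cst.
- by rewrite D2 => x; exact: cvg_cst.
Qed.

(** For c = l x the derivative of this function vanishes at x, so that at x a
    second order operator is read through its principal part only. *)
Definition centered_sqr l (c : R) (x : E) : R^o := (l x - c) * (l x - c).

Lemma centered_sqr_diff l c x : differentiable (centered_sqr l c) x /\
  forall h, 'd (centered_sqr l c) x h = 2 * (l x - c) * l h.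
Proof.
have [dl e] := clin_diff l x.
have dk : differentiable ((l : E -> R) - cst c) x by exact: differentiableB.
have ek : 'd ((l : E -> R) - cst c) x = l :> (E -> R).
  by rewrite diffB// diff_cst e; apply/funext => h; exact: (subr0 (l h : R)).
split; first exact: (differentiableM dk dk).
move=> h; rewrite (_ : centered_sqr l c = ((l : E -> R) - cst c) * ((l : E -> R) - cst c))//.
rewrite (diffM dk dk) ek.
by rewrite -[LHS]/((l x - c) * l h + (l x - c) * l h); ring.
Qed.

Lemma is_C2_centered_sqr l c : is_Cn 2 (centered_sqr l c).
Proof.
pose k (x : E) : R^o := 2 * (l x - c).
have D1 : Dmap (centered_sqr l c) = fun x => k x *: l.
  apply/funext => x; have [dx ex] := centered_sqr_diff l c x.
  apply/val_inj/funext => h.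
  by rewrite -[LHS]/(Dmap (centered_sqr l c) x h) DmapE// ex.
have kE : k = (2 : R) *: ((l : E -> R^o) - cst c) by [].
have dk x : differentiable k x.
  by rewrite kE; apply: differentiableZ; apply: differentiableB => //;
    case: (clin_diff l x).
have ek x h : 'd k x h = 2 * l h.
  have [dl e] := clin_diff l x.
  rewrite kE diffZ; last exact: differentiableB.
  by rewrite diffB// diff_cst e -[LHS]/(2 * (l h - 0)) subr0.
have d1 x : differentiable (fun x => k x *: l) x by exact: differentiableZl.
have D2 x h : Dmap (Dmap (centered_sqr l c)) x h = (2 * l h) *: l.
  by rewrite D1 DmapE// diffZl// ek.
split=> [[|[|//]] _ x|]; rewrite /=.
- by have [] := centered_sqr_diff l c x.
- by rewrite D1.
- have -> : Dmap (Dmap (centered_sqr l c)) = fun=> Dmap (Dmap (centered_sqr l c)) 0.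
    by apply/funext => x; apply/val_inj/funext => h; rewrite [LHS]D2 [RHS]D2.
  by move=> x; exact: cvg_cst.
Qed.

Lemma vfop_clin (V : E -> E) l : vfop V (l : E -> R^o) = fun x => l (V x).
Proof. by apply/funext => x; rewrite /vfop; have [_ ->] := clin_diff l x. Qed.

Lemma vfop2_clin (V U : E -> E) l x : differentiable V x ->
  vfop U (vfop V (l : E -> R^o)) x = l (Dmap V x (U x)).
Proof.
move=> dV; rewrite vfop_clin /vfop DmapE//.
have [dl e] := clin_diff l (V x).
by rewrite -[fun x => l (V x)]/((l : E -> R^o) \o V) diff_comp//= e.
Qed.

Lemma vfop2_centered_sqr (V : E -> E) l x : differentiable V x ->
  vfop V (vfop V (centered_sqr l (l x))) x = 2 * (l (V x) * l (V x)).
Proof.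
move=> dV; pose k (z : E) : R := 2 * (l z - l x).
have -> : vfop V (centered_sqr l (l x)) = (k * ((l : E -> R) \o V) : E -> R).
  apply/funext => z; rewrite /vfop; have [_ ->] := centered_sqr_diff l (l x) z.
  by [].
have kE : k = (2 : R) *: ((l : E -> R^o) - cst (l x)) by [].
have [dl e] := clin_diff l x; have [dl' e'] := clin_diff l (V x).
have dk : differentiable k x.
  by rewrite kE; apply: differentiableZ; apply: differentiableB.
have dm : differentiable ((l : E -> R) \o V) x by exact: differentiable_comp.
rewrite /vfop (diffM dk dm).
have ek h : 'd k x h = 2 * l h.
  rewrite kE diffZ; last exact: differentiableB.
  by rewrite diffB// diff_cst e -[LHS]/(2 * (l h - 0)) subr0.
rewrite -[LHS]/(k x * ('d ((l : E -> R) \o V) x (V x)) + l (V x) * 'd k x (V x)).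
by rewrite ek /k subrr mulr0 mul0r add0r; ring.
Qed.

End TestFunctions.

Lemma chen_functional (R : realType) (E : normedModType R) (l : clin E R^o)
    (A B : clin E E) (a b w1 w2 : E) (v v1 v2 : R) :
  v1 - 2^-1 * l (A a) = l w1 -> v2 - 2^-1 * l (B b) = l w2 ->
  v = v1 + l (A b) + v2 ->
  v - 2^-1 * l ((A + B) (a + b)) = l (w1 + w2 + 2^-1 *: (A b - B a)).
Proof.
move=> h1 h2 ->; rewrite !clinE -h1 -h2 -[_ *: _]/(2^-1 * (l (A b) - l (B a))).
by field.
Qed.

Section FromRoughDriver.
Context {R : realType} {E : normedModType R} (T p rho : R).
Hypothesis rho01 : 0 < rho <= 1.
Hypothesis p0 : 0 < p.
Variable D : rough_driver E T p rho.
Local Notation V := (rd_V D).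
Local Notation W := (rd_W D).

Lemma rd_W_clin (s t : R) (l : clin E R^o) x : 0 <= s -> s <= t -> t <= T ->
  rd_VV D t s l x - 2^-1 * l (Dmap (V t s) x (V t s x)) = l (W t s x).
Proof.
move=> s0 st tT; have := rd_WE D s0 st tT (is_C2_clin l) x.
rewrite vfop2_clin; last exact: rd_V_diff.
by move=> ->; rewrite vfop_clin.
Qed.

Lemma rd_chen_clin (s u t : R) (l : clin E R^o) x :
  0 <= s -> s <= u -> u <= t -> t <= T ->
  rd_VV D t s l x =
    rd_VV D t u l x + l (Dmap (V t u) x (V u s x)) + rd_VV D u s l x.
Proof.
move=> s0 su ut tT; rewrite (rd_chen D s0 su ut tT (is_C2_clin l) x).
rewrite vfop2_clin//; apply: rd_V_diff => //; exact: le_trans su.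
Qed.

(** For s = u = t Chen's relation gives VV_tt = - V_tt V_tt, while VV_tt and
    1/2 V_tt V_tt differ by a first order operator.  The test function
    (l - l x)^2, whose derivative vanishes at x, turns this into l(V_tt x)^2 = 0
    for a norming l. *)
Lemma rd_V_diag t x : 0 <= t -> t <= T -> V t t x = 0.
Proof.
move=> t0 tT; have [l lE] := norming_clin (V t t x).
have dV := rd_V_diff D t0 (lexx t) tT x.
have C2f := is_C2_centered_sqr l (l x).
have := rd_chen D t0 (lexx t) (lexx t) tT C2f x.
have := rd_WE D t0 (lexx t) tT C2f x.
rewrite (vfop2_centered_sqr l dV).
have -> : vfop (W t t) (centered_sqr l (l x)) x = 0.
  rewrite /vfop; have [_ ->] := centered_sqr_diff l (l x) x.
  by rewrite subrr mulr0 mul0r.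
rewrite lE; move: (rd_VV D t t _ x) => a ha hb.
have : `|V t t x| * `|V t t x| = 0 by lra.
by move=> /eqP; rewrite mulf_eq0 orbb normr_eq0 => /eqP.
Qed.

Lemma rd_W_diag t x : 0 <= t -> t <= T -> W t t x = 0.
Proof.
move=> t0 tT; apply: clin_separates => l.
have := rd_W_clin l x t0 (lexx t) tT.
have := rd_chen_clin l x t0 (lexx t) (lexx t) tT.
rewrite (rd_V_diag x t0 tT) !linear0 mulr0 subr0 addr0 => h <-.
by apply: (addIr (rd_VV D t t l x)); rewrite -h add0r.
Qed.

Lemma rd_V_add_le (s u t : R) x : 0 <= s -> s <= u -> u <= t -> t <= T ->
  V t s x = V t u x + V u s x.
Proof.
move=> s0 su ut tT.
have [su'|us'] := ltP s u; last first.
  have <- : s = u by apply/le_anti; rewrite su.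
  by rewrite (rd_V_diag x s0) ?addr0// (le_trans su)// (le_trans ut).
have [ut'|tu'] := ltP u t; first exact: rd_V_add.
have -> : t = u by apply/le_anti; rewrite tu'.
by rewrite rd_V_diag ?add0r// ?(le_trans s0)// (le_trans ut).
Qed.

(** On a linear functional l the product V_us V_tu l is l o (DV_tu V_us), without
    any second derivative, so Chen's relation becomes an identity between
    vectors. *)
Lemma rd_chen_W (s u t : R) x : 0 <= s -> s <= u -> u <= t -> t <= T ->
  W t s x = W t u x + W u s x +
      2^-1 *: (Dmap (V t u) x (V u s x) - Dmap (V u s) x (V t u x)).
Proof.
move=> s0 su ut tT; apply: clin_separates => l.
have st := le_trans su ut; have u0 := le_trans s0 su; have uT := le_trans ut tT.
have dV1 := rd_V_diff D s0 su uT x.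
have dV2 := rd_V_diff D u0 ut tT x.
have VE : V t s = (fun z => V t u z + V u s z).
  by apply/funext => z; exact: rd_V_add_le.
have := rd_W_clin l x s0 st tT; rewrite VE (DmapD dV2 dV1) => <-.
exact: (chen_functional (rd_W_clin l x u0 ut tT) (rd_W_clin l x s0 su uT)
  (rd_chen_clin l x s0 su ut tT)).
Qed.

Lemma sup_incr_ge (F : R -> R -> \bar R) (s t : R) : 0 <= s -> s < t -> t <= T ->
  (F t s <= sup_incr T F)%E.
Proof.
move=> s0 st tT; apply: ereal_sup_ubound; exists (s, t) => //=.
by rewrite s0 st tT.
Qed.

Lemma le_pdiv_rate (x : \bar R) (z q K : R) : 0 < z ->
  (x * ((z `^ q)^-1)%:E <= K%:E)%E -> (x <= (K * z `^ q)%:E)%E.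
Proof.
move=> z0; have zq := powR_gt0 q z0.
by rewrite lee_pdivrMr.
Qed.

Definition driver_bounded (K : R) : Prop := forall s t : R,
  0 <= s -> s < t -> t <= T ->
  Cbound 2 rho (K * (t - s) `^ p^-1) (V t s) /\
  Cbound 1 rho (K * ((t - s) `^ p^-1) ^+ 2) (W t s).

Lemma rate_sqr (z : R) : z `^ (2 / p) = (z `^ p^-1) ^+ 2.
Proof. by rewrite -powR_mulrn ?powR_ge0// -powRrM mulrC. Qed.

Lemma driver_bounded_ex : exists2 K, 1 <= K & driver_bounded K.
Proof.
have majorant (x : \bar R) : (x < +oo)%E -> exists2 K : R, 1 <= K & (x <= K%:E)%E.
  case: x => [r _|//|_]; last by exists 1 => //; rewrite leNye.
  exists (Num.max 1 r); first by rewrite le_max lexx.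
  by rewrite lee_fin le_max lexx orbT.
have [K1 K11 hK1] := majorant _ (rd_V_fin D).
have [K2 K21 hK2] := majorant _ (rd_W_fin D).
exists (Num.max K1 K2); first by rewrite le_max K11.
move=> s t s0 st tT; have ts : 0 < t - s by rewrite subr_gt0.
split; apply: Cnorm_Cbound => //.
  rewrite -div1r; apply: le_pdiv_rate => //.
  apply: le_trans (le_trans (sup_incr_ge _ s0 st tT) hK1) _.
  by rewrite lee_fin le_max lexx.
rewrite -rate_sqr; apply: le_pdiv_rate => //.
apply: le_trans (le_trans (sup_incr_ge _ s0 st tT) hK2) _.
by rewrite lee_fin le_max lexx orbT.
Qed.

Lemma rough_driver_fields K : driver_bounded K ->
  driver_fields T p rho (2 * K) V W.
Proof.
move=> bK; split.
- move=> s t s0; rewrite le_eqVlt => /orP[/eqP <- sT _|st tT _].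
    have z0 : (s - s) `^ p^-1 = 0 by rewrite subrr powR0// invr_eq0 gt_eqF.
    have V0 : V s s = (fun=> 0) by apply/funext => x; exact: rd_V_diag.
    rewrite /rough_field z0 expr0n /= !mulr0 V0; split.
    + by move=> x; exact: differentiable_cst.
    + exact: tame0.
    + by apply: tame0 => x; exact: Dmap_cst.
    + by apply: tame0 => x; exact: rd_W_diag.
  have [b2 b1] := bK s t s0 st tT.
  have [dV tV tD] := Cbound2_tame rho01 b2.
  have tW := Cbound1_tame rho01 b1.
  by split=> //; rewrite -mulrA.
- by move=> s t x s0 st tT; exact: rd_V_diff.
- exact: rd_V_add_le.
- exact: rd_chen_W.
Qed.

End FromRoughDriver.

Section DriverDistance.
Context {R : realType} {E : normedModType R} (T p rho : R).
Hypothesis rho01 : 0 < rho <= 1.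
Variables D D' : rough_driver E T p rho.

Lemma driver_dist_bound (e : R) : (driver_dist D D' < e%:E)%E ->
  forall s t : R, 0 <= s -> s < t -> t <= T ->
  Cbound 2 rho (e * (t - s) `^ p^-1) (rd_V D t s \- rd_V D' t s) /\
  Cbound 1 rho (e * ((t - s) `^ p^-1) ^+ 2) (rd_W D t s \- rd_W D' t s).
Proof.
move=> /ltW De s t s0 st tT; have ts : 0 < t - s by rewrite subr_gt0.
have := le_trans (sup_incr_ge _ s0 st tT) De.
rewrite ge_max => /andP[h1 h2].
split; apply: Cnorm_Cbound => //.
  by rewrite -div1r; exact: le_pdiv_rate.
by rewrite -rate_sqr; exact: le_pdiv_rate.
Qed.

(** The bounds are uniform over a ball of drivers; this is where the distance of
    the drivers controls the constants of the second flow. *)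
Lemma driver_bounded_dist (K e : R) : (driver_dist D D' < e%:E)%E ->
  driver_bounded D K -> driver_bounded D' (K + e).
Proof.
move=> De bK s t s0 st tT; have [b2 b1] := bK s t s0 st tT.
have [c2 c1] := driver_dist_bound De s0 st tT.
have sub (f g : E -> E) : f \- (f \- g) = g.
  by apply/funext => x /=; rewrite opprB addrC subrK.
split; rewrite mulrDl.
  by rewrite -(sub (rd_V D t s) (rd_V D' t s)); exact: CboundB.
by rewrite -(sub (rd_W D t s) (rd_W D' t s)); exact: CboundB.
Qed.

End DriverDistance.

(** * Telescoping comparison of flows and time reversal *)

Section FlowComparison.
Context {R : realType} {E : normedModType R} (T : R).
Implicit Types (phi psi : R -> R -> E -> E).

Definition flow_lipschitz phi (L : R) : Prop := forall s t x y,
  0 <= s -> s <= t -> t <= T -> `|phi t s x - phi t s y| <= L * `|x - y|.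

Definition flow_close (b d C : R) phi (nu : R -> R -> E -> E) : Prop :=
  forall s t x, 0 <= s -> s <= t -> t <= T -> t - s <= d ->
    `|phi t s x - nu t s x| <= C * (t - s) `^ b.

Definition flow_step phi (s h : R) (k : nat) : E -> E :=
  phi (s + k.+1%:R * h) (s + k%:R * h).

Lemma iter_flow_step phi s h i k x : is_flow T phi -> 0 <= s -> 0 <= h ->
  s + (i + k)%:R * h <= T ->
  iter_steps (flow_step phi s h) i k x =
    phi (s + (i + k)%:R * h) (s + i%:R * h) x.
Proof.
move=> [phi0 phiC] s0 h0.
have p0 (m : nat) : 0 <= s + m%:R * h by rewrite addr_ge0// mulr_ge0.
have ple (m n : nat) : (m <= n)%N -> s + m%:R * h <= s + n%:R * h.
  by move=> mn; rewrite lerD2l ler_wpM2r// ler_nat.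
elim: k i x => [|k IH] i x iT /=; first by rewrite addn0 phi0// -(addn0 i).
rewrite IH ?addSnnS// /flow_step phiC// ?ple//.
by rewrite addnS ltnS leq_addr.
Qed.

Lemma flow_compare phi psi (L e : R) (n : nat) s t x : (0 < n)%N ->
  is_flow T phi -> is_flow T psi -> 0 <= L -> flow_lipschitz phi L ->
  0 <= s -> s <= t -> t <= T ->
  (forall s' t' y, 0 <= s' -> s' <= t' -> t' <= T -> t' - s' = (t - s) / n%:R ->
     `|phi t' s' y - psi t' s' y| <= e) ->
  `|phi t s x - psi t s x| <= n%:R * (L * e).
Proof.
move=> n0 fphi fpsi L0 phiL s0 st tT he.
set h := (t - s) / n%:R.
have h0 : 0 <= h by rewrite divr_ge0// subr_ge0.
have nh : n%:R * h = t - s by rewrite mulrC divfK// pnatr_eq0 -lt0n.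
have p0 (m : nat) : 0 <= s + m%:R * h by rewrite addr_ge0// mulr_ge0.
have ple (m k : nat) : (m <= k)%N -> s + m%:R * h <= s + k%:R * h.
  by move=> mk; rewrite lerD2l ler_wpM2r// ler_nat.
have tE : s + n%:R * h = t by rewrite nh subrKC.
have pT (m : nat) : (m <= n)%N -> s + m%:R * h <= T.
  by move=> mn; rewrite (le_trans (ple _ _ mn))// tE.
have steps (f : R -> R -> E -> E) : is_flow T f ->
    f t s x = iter_steps (flow_step f s h) 0 n x.
  by move=> ff; rewrite iter_flow_step// ?add0n ?pT// mul0r addr0 tE.
rewrite !steps//; apply: telescoping => //.
- move=> j k y z jk; rewrite add0n in jk; rewrite !iter_flow_step ?pT//.
  by apply: phiL => //; [rewrite ple// leq_addr|exact: pT].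
move=> k y /andP[_ kn]; rewrite add0n in kn; apply: he => //.
- exact: ple.
- exact: pT.
by rewrite mulrSr mulrDl mul1r addrA [X in X - _]addrC addrK.
Qed.

(** As b > 1, the total error n (1/n)^b of n steps tends to 0. *)
Lemma fine_mesh (b d C e : R) : 0 < T -> 1 < b -> 0 < d -> 0 <= C -> 0 < e ->
  exists n : nat, [/\ (0 < n)%N, T / n%:R <= d &
    n%:R * (C * (T / n%:R) `^ b) <= e].
Proof.
move=> T0 b1 d0 C0 e0; have b10 : 0 < b - 1 by rewrite subr_gt0.
have TC1 : 0 < T * C + 1 by rewrite ltr_wpDl// mulr_ge0// ltW.
have c0 : 0 < e / (T * C + 1) by rewrite divr_gt0.
have [d' /andP[d'0 _] hd'] := small_power b10 c0.
pose m := Num.min d d'; have m0 : 0 < m by rewrite lt_min d0.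
pose n := (Num.truncn (T / m)).+1.
have n0 : 0 < n%:R :> R by rewrite ltr0n.
have Tnm : T / n%:R <= m.
  by rewrite ler_pdivrMr// mulrC -ler_pdivrMr// ltW// truncnS_gt.
have Tn0 : 0 <= T / n%:R by rewrite divr_ge0// ltW.
exists n; split=> //; first by rewrite (le_trans Tnm)// ge_min lexx.
rewrite -(mulr_powRB1 Tn0 (lt_trans ltr01 b1)).
have -> : n%:R * (C * (T / n%:R * (T / n%:R) `^ (b - 1))) =
   (T * C) * (T / n%:R) `^ (b - 1) by field; rewrite gt_eqF.
have h1 : (T / n%:R) `^ (b - 1) <= e / (T * C + 1).
  rewrite (le_trans _ hd')// ge0_ler_powR ?nnegrE ?(ltW b10) ?(ltW d'0)//.
  by rewrite (le_trans Tnm)// ge_min lexx orbT.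
have TC0 : 0 <= T * C by rewrite mulr_ge0// ltW.
rewrite (le_trans (ler_wpM2l TC0 h1))// mulrA ler_pdivrMr// mulrC ler_pM2l//.
by rewrite lerDl.
Qed.

Lemma flow_unique (b d C d' C' L : R) phi psi nu : 0 < T -> 1 < b ->
  is_flow T phi -> is_flow T psi -> 0 <= L -> flow_lipschitz phi L ->
  0 < d -> 0 <= C -> flow_close b d C phi nu ->
  0 < d' -> 0 <= C' -> flow_close b d' C' psi nu ->
  forall s t x, 0 <= s -> s <= t -> t <= T -> phi t s x = psi t s x.
Proof.
move=> T0 b1 fphi fpsi L0 phiL d0 C0 cphi d'0 C'0 cpsi s t x s0 st tT.
apply/eqP; rewrite -subr_eq0 -normr_le0; apply/ler_addgt0Pr => e e0.
have dd : 0 < Num.min d d' by rewrite lt_min d0.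
have LC : 0 <= L * (C + C') by rewrite mulr_ge0// addr_ge0.
have [n [n0 nd ne]] := fine_mesh T0 b1 dd LC e0.
rewrite add0r (le_trans _ ne)// -mulrA.
apply: (flow_compare x n0 fphi fpsi L0 phiL s0 st tT) => s' t' y s'0 st' t'T ts'.
have tsT : t' - s' <= T / n%:R.
  by rewrite ts' ler_wpM2r ?invr_ge0//; lra.
have /andP[td td'] : (t' - s' <= d) && (t' - s' <= d').
  by rewrite -le_min (le_trans tsT).
have h1 := cphi s' t' y s'0 st' t'T td.
have h2 := cpsi s' t' y s'0 st' t'T td'; rewrite distrC in h2.
rewrite -(subrKA (nu t' s' y)) (le_trans (ler_normD _ _))//.
rewrite (le_trans (lerD h1 h2))// -mulrDl ler_wpM2l ?addr_ge0//.
rewrite ge0_ler_powR ?nnegrE ?subr_ge0 ?(le_trans ler01 (ltW b1))//.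
by rewrite divr_ge0// ltW.
Qed.

Lemma flow_bounded (d B L : R) phi : 0 < T -> is_flow T phi -> 0 <= L ->
  flow_lipschitz phi L -> 0 < d ->
  (forall s t x, 0 <= s -> s <= t -> t <= T -> t - s <= d ->
     `|phi t s x - x| <= B) ->
  exists B', forall s t x, 0 <= s -> s <= t -> t <= T -> `|phi t s x - x| <= B'.
Proof.
move=> T0 fphi L0 phiL d0 hB.
have [n [n0 nd _]] := fine_mesh T0 (ltr1n R 2) d0 (lexx 0) ltr01.
exists (n%:R * (L * B)) => s t x s0 st tT.
have fid : is_flow T (fun _ _ => id : E -> E) by split.
apply: (flow_compare x n0 fphi fid L0 phiL s0 st tT) => s' t' y s'0 st' t'T ts'.
apply: hB => //; rewrite ts' (le_trans _ nd)// ler_wpM2r ?invr_ge0//; lra.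
Qed.

(** Telescoping for psi o phi: peel off the last step of phi together with the
    first step of psi, which invert each other up to the errors of phi and psi
    and the defect of nur o nu. *)
Lemma flow_inverse (b d C c K L : R) phi psi nu nur : 0 < T -> 1 < b ->
  is_flow T phi -> is_flow T psi -> 0 <= L -> flow_lipschitz psi L ->
  0 < d -> 0 <= C -> 0 <= c -> 0 <= K ->
  flow_close b d C phi nu -> flow_close b d C psi nur ->
  (forall s t x y, 0 <= s -> s <= t -> t <= T -> t - s <= d ->
     `|nur t s x - nur t s y| <= K * `|x - y|) ->
  (forall s t x, 0 <= s -> s <= t -> t <= T -> t - s <= d ->
     `|nur (T - s) (T - t) (nu t s x) - x| <= c * (t - s) `^ b) ->
  forall s t x, 0 <= s -> s <= t -> t <= T ->
    psi (T - s) (T - t) (phi t s x) = x.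
Proof.
move=> T0 b1 [phi0 phiC] [psi0 psiC] L0 psiL d0 C0 c0 K0 cphi cpsi nurL nurnu
  s t x s0 st tT.
apply/eqP; rewrite -subr_eq0 -normr_le0; apply/ler_addgt0Pr => e e0.
have LC : 0 <= L * (C + K * C + c) by rewrite mulr_ge0// !addr_ge0// mulr_ge0.
have [n [n0 nd ne]] := fine_mesh T0 b1 d0 LC e0.
rewrite add0r (le_trans _ ne)//; set hT := (T / n%:R) `^ b.
set h := (t - s) / n%:R.
have h0 : 0 <= h by rewrite divr_ge0// subr_ge0.
have nh : n%:R * h = t - s by rewrite mulrC divfK// pnatr_eq0 -lt0n.
have p0 (m : nat) : 0 <= s + m%:R * h by rewrite addr_ge0// mulr_ge0.
have ple (m k : nat) : (m <= k)%N -> s + m%:R * h <= s + k%:R * h.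
  by move=> mk; rewrite lerD2l ler_wpM2r// ler_nat.
have tE : s + n%:R * h = t by rewrite nh subrKC.
have pT (m : nat) : (m <= n)%N -> s + m%:R * h <= T.
  by move=> mn; rewrite (le_trans (ple _ _ mn))// tE.
have hTn : h <= T / n%:R by rewrite ler_wpM2r ?invr_ge0//; lra.
have hd : h <= d by exact: le_trans nd.
have hb : h `^ b <= hT.
  rewrite ge0_ler_powR ?nnegrE ?(le_trans ler01 (ltW b1))//.
  by rewrite divr_ge0// ltW.
have rd (u u' : R) : T - u - (T - u') = u' - u by ring.
have rle (u u' : R) : u <= u' -> T - u' <= T - u by move=> uu; lra.
have rT (u : R) : 0 <= u -> T - u <= T by move=> uu; lra.
have r0 (u : R) : u <= T -> 0 <= T - u by rewrite subr_ge0.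
have sT : s <= T by exact: le_trans tT.
suff ind k : (k <= n)%N ->
   `|psi (T - s) (T - (s + k%:R * h)) (phi (s + k%:R * h) s x) - x| <=
   k%:R * (L * (C + K * C + c) * hT).
  by have := ind n (leqnn n); rewrite tE.
elim: k => [_|k IH kn].
  by rewrite !mul0r addr0 phi0// psi0 ?subrr ?normr0 ?r0 ?rT.
have ku := ple _ _ (leqnSn k); set u := s + k%:R * h in IH ku *.
set u' := s + k.+1%:R * h in ku *.
have uu : u' - u = h by rewrite /u' /u mulrSr mulrDl mul1r; ring.
have u'T : u' <= T by exact: pT.
have uT : u <= T by exact: le_trans u'T.
have u0 : 0 <= u by exact: p0.
have u'0 : 0 <= u' by exact: p0.
have su : s <= u by rewrite lerDl mulr_ge0.
have uud : u' - u <= d by rewrite uu.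
have uud' : T - u - (T - u') <= d by rewrite rd.
rewrite -(phiC s u u')// -(psiC (T - u') (T - u) (T - s)) ?r0 ?rle ?rT//.
set z := phi u s x; set y := psi (T - u) (T - u') (phi u' u z).
rewrite -(subrKA (psi (T - s) (T - u) z)) (le_trans (ler_normD _ _))//.
rewrite -natr1 mulrDl mul1r addrC lerD//; first exact/IH/ltnW.
apply: le_trans (psiL _ _ _ _ (r0 _ uT) (rle _ _ su) (rT _ s0)) _.
rewrite -mulrA ler_wpM2l//.
have h1 := cpsi _ _ (phi u' u z) (r0 _ u'T) (rle _ _ ku) (rT _ u0) uud'.
have h2 := nurL _ _ (phi u' u z) (nu u' u z) (r0 _ u'T) (rle _ _ ku) (rT _ u0) uud'.
have h3 := cphi _ _ z u0 ku u'T uud.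
have h4 := nurnu _ _ z u0 ku u'T uud.
rewrite rd uu in h1; rewrite uu in h3 h4.
have -> : y - z = (y - nur (T - u) (T - u') (phi u' u z)) +
   (nur (T - u) (T - u') (phi u' u z) - nur (T - u) (T - u') (nu u' u z)) +
   (nur (T - u) (T - u') (nu u' u z) - z) by vring.
apply: le_trans (ler_norm3 _ _ _) _.
have h3' := ler_wpM2l K0 h3.
apply: (@le_trans _ _ ((C + K * C + c) * h `^ b)).
  rewrite !mulrDl -mulrA; apply: lerD => //; apply: lerD => //.
  exact: le_trans h3'.
by rewrite ler_wpM2l// !addr_ge0// mulr_ge0.
Qed.

End FlowComparison.

Section TimeReversal.
Context {R : realType} {E : normedModType R}.
Variables (T p rho K : R).
Hypothesis rho01 : 0 < rho <= 1.
Hypothesis K1 : 1 <= K.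

Definition time_reversal (V : R -> R -> E -> E) (t s : R) (x : E) : E :=
  - V (T - s) (T - t) x.

Lemma DmapN (f : E -> E) x : differentiable f x ->
  Dmap (fun x => - f x) x = - Dmap f x.
Proof.
move=> df; have dNf : differentiable (- f) x by exact: differentiableN.
apply/val_inj/funext => v.
have -> : val (- Dmap f x) v = - 'd f x v by rewrite -(DmapE v df).
by rewrite -[LHS]/(Dmap (- f) x v) DmapE// diffN.
Qed.

Lemma rough_fieldN v (A C : E -> E) : rough_field rho K v A C ->
  rough_field rho K v (fun x => - A x) (fun x => - C x).
Proof.
move=> [dA tA tD tC]; split; [|exact: tameN| |exact: tameN].
  by move=> x; exact: differentiableN.
have -> : Dmap (fun x => - A x) = fun x => - Dmap A x.
  by apply/funext => x; exact: DmapN.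
exact: tameN.
Qed.

(** Reversal exchanges the roles of the two intervals and changes the signs; the
    bracket is insensitive to the signs and changes sign under the exchange. *)
Lemma chen_reversal (P Q : clin E E) (p1 q1 w1 w2 w : E) :
  w = w1 + w2 + 2^-1 *: (P q1 - Q p1) ->
  - w = - w2 - w1 + 2^-1 *: ((- Q) (- p1) - (- P) (- q1)).
Proof. by move=> ->; rewrite !clinE; vring. Qed.

Lemma driver_fields_reversal (V W : R -> R -> E -> E) :
  driver_fields T p rho K V W ->
  driver_fields T p rho K (time_reversal V) (time_reversal W).
Proof.
move=> VW.
have r0 (u : R) : u <= T -> 0 <= T - u by rewrite subr_ge0.
have rle (u u' : R) : u <= u' -> T - u' <= T - u by move=> uu; lra.
have rT (u : R) : 0 <= u -> T - u <= T by move=> uu; lra.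
have rd (u u' : R) : T - u - (T - u') = u' - u by ring.
split.
- move=> s t s0 st tT ts1; have ts' : T - s - (T - t) <= 1 by rewrite rd.
  have := df_field VW (r0 _ tT) (rle _ _ st) (rT _ s0) ts'.
  by rewrite rd; exact: rough_fieldN.
- move=> s t x s0 st tT; apply: differentiableN.
  exact: (df_diff VW x (r0 _ tT) (rle _ _ st) (rT _ s0)).
- move=> s u t x s0 su ut tT.
  have := df_add VW x (r0 _ tT) (rle _ _ ut) (rle _ _ su) (rT _ s0).
  by rewrite /time_reversal => ->; rewrite opprD addrC.
move=> s u t x s0 su ut tT.
have uT : u <= T by exact: le_trans tT.
have u0 : 0 <= u by exact: le_trans su.
have d1 := df_diff VW x (r0 _ tT) (rle _ _ ut) (rT _ u0).
have d2 := df_diff VW x (r0 _ uT) (rle _ _ su) (rT _ s0).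
rewrite /time_reversal (DmapN d1) (DmapN d2).
exact: (chen_reversal (df_chen VW x (r0 _ tT) (rle _ _ ut) (rle _ _ su) (rT _ s0))).
Qed.

Lemma davie2_opp (v x w : E) (M : clin E E) :
  x + (- v + v + - w + w + 2^-1 *: (- M) (- v) + 2^-1 *: M v + (- M) v) = x.
Proof. by rewrite !clinE; vfield. Qed.

(** The second order expansion of the composition with the opposite fields is the
    identity, since accel (- A) = accel A. *)
Lemma davie_oppK v (A C : E -> E) x : 0 <= v <= 1 -> rough_field rho K v A C ->
  `|davie (fun x => - A x) (fun x => - C x) (davie A C x) - x| <=
    200 * K ^+ 5 * v ^+ 3.
Proof.
move=> v01 f; have [h _] := davie_comp rho01 K1 v01 (rough_fieldN f) f.
have := h x; rewrite /davie2 /accel DmapN ?davie2_opp//.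
by case: f.
Qed.

End TimeReversal.

(** * The flow of a rough driver *)

Section RoughFlow.
Context {R : realType} {E : completeNormedModType R} (T p rho : R).
Hypothesis T0 : 0 < T.
Hypothesis p2 : 2 <= p.
Hypothesis p3 : p < 3.
Hypothesis rho_gt : p - 2 < rho.
Hypothesis rho1 : rho <= 1.
Hypothesis rho_gt_p3 : p / 3 < rho.

Local Notation b := (3 / p).

Lemma rho_range : 0 < rho <= 1.
Proof. by rewrite rho1 andbT (le_lt_trans _ rho_gt)// subr_ge0. Qed.

Lemma p_gt0 : 0 < p. Proof. by rewrite (lt_le_trans _ p2). Qed.

Lemma b_gt1 : 1 < b. Proof. by rewrite ltr_pdivlMr ?p_gt0// mul1r. Qed.

Lemma davie_const_ge0 (K : R) : 1 <= K -> 0 <= 200 * K ^+ 5.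
Proof.
by move=> K1; apply: mulr_ge0; [exact: ler0n|apply: exprn_ge0; exact: le_trans K1].
Qed.

(** The exponents are a = (2 + rho)/p, b = 3/p and gam = 1/p.  Here a > 1 is the
    hypothesis rho > p - 2, and a <= gam + rho b amounts to rho >= 1/2, which
    follows from rho > p/3. *)
Lemma rough_flow (K : R) : 1 <= K -> exists L C d : R,
  [/\ 0 <= L, 0 <= C, 0 < d <= 1 & forall V W : R -> R -> E -> E,
    driver_fields T p rho K V W -> exists phi, [/\ is_flow T phi,
      flow_lipschitz T phi L & flow_close T b d C phi (davie_family V W)]].
Proof.
move=> K1; move: (p2) (p3) (rho_gt) (rho1) (rho_gt_p3) (p_gt0) =>
  p2' p3' rho_gt' rho1' rho_gt_p3' p0.
have a1 : 1 < (2 + rho) / p by rewrite ltr_pdivlMr//; lra.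
have ab : (2 + rho) / p <= b by rewrite ler_pM2r ?invr_gt0//; lra.
have gam0 : 0 < p^-1 by rewrite invr_gt0.
have agr : (2 + rho) / p <= p^-1 + rho * b.
  have -> : p^-1 + rho * b = (1 + 3 * rho) / p by field; rewrite gt_eqF.
  by rewrite ler_pM2r//; lra.
have K50 := davie_const_ge0 K1.
have [L [C [d [L0 C0 d01 sew]]]] :=
  @sewing R E T (200 * K ^+ 5) _ _ _ _ rho_range a1 ab gam0 agr K50 T0.
exists L, C, d; split=> // V W VW.
have [phi [fphi Lphi Cphi]] := sew _ (davie_almost_flow rho_range K1 p0 VW).
by exists phi.
Qed.

Lemma supnorm_leP (g : E -> E) (c : R) :
  (supnorm g <= c%:E)%E <-> forall x, `|g x| <= c.
Proof.
split=> [h x|h]; first by rewrite -lee_fin (le_trans (supnorm_ge g x)).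
by apply: ge_ereal_sup => _ [x _ <-]; rewrite lee_fin.
Qed.

Lemma mu_davie (D : rough_driver E T p rho) (K s t : R) x : 1 <= K ->
  driver_fields T p rho K (rd_V D) (rd_W D) ->
  0 <= s -> s <= t -> t <= T -> t - s <= 1 ->
  `|mu_map D t s x - davie_family (rd_V D) (rd_W D) t s x| <=
    9 * K ^+ 3 * (t - s) `^ b.
Proof.
move=> K1 VW s0 st tT ts1; have ts0 : 0 <= t - s by rewrite subr_ge0.
have v01 := rate01 p_gt0 ts0 ts1.
have := time1_davie rho_range K1 x v01 (df_field VW s0 st tT ts1).
by have [-> _] := rate_powers rho_range p_gt0 ts0.
Qed.

Lemma solution_flowP (D : rough_driver E T p rho) (K : R) phi : 1 <= K ->
  driver_fields T p rho K (rd_V D) (rd_W D) ->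
  solution_flow D phi <-> is_flow T phi /\ exists d C : R,
    [/\ 0 < d, 0 <= C &
      flow_close T b d C phi (davie_family (rd_V D) (rd_W D))].
Proof.
move=> K1 VW; have K30 : 0 <= 9 * K ^+ 3.
  by rewrite mulr_ge0// exprn_ge0// (le_trans ler01).
split=> [[fphi [d [C [d0 C0 h]]]]|[fphi [d [C [d0 C0 h]]]]]; split=> //.
  exists (Num.min d 1), (C + 9 * K ^+ 3); split.
  - by rewrite lt_min d0 ltr01.
  - by rewrite addr_ge0// ltW.
  move=> s t x s0 st tT; rewrite le_min => /andP[tsd ts1].
  have /supnorm_leP/(_ x) h1 := h s t s0 st tT tsd.
  have h2 := mu_davie x K1 VW s0 st tT ts1.
  rewrite -(subrKA (mu_map D t s x)) (le_trans (ler_normD _ _))// mulrDl.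
  exact: lerD h1 h2.
exists (Num.min d 1), (C + 9 * K ^+ 3 + 1); split.
- by rewrite lt_min d0 ltr01.
- by rewrite ltr_wpDl// addr_ge0.
move=> s t s0 st tT; rewrite le_min => /andP[tsd ts1].
apply/supnorm_leP => x /=.
have h1 := h s t x s0 st tT tsd.
have h2 := mu_davie x K1 VW s0 st tT ts1; rewrite distrC in h2.
rewrite -(subrKA (davie_family (rd_V D) (rd_W D) t s x)).
rewrite (le_trans (ler_normD _ _))// (le_trans (lerD h1 h2))// -mulrDl.
by rewrite ler_wpM2r ?powR_ge0// lerDl.
Qed.

Lemma lipschitz_Cnorm0 (phi : E -> E) (L B : R) : 0 <= L ->
  (forall x y, `|phi x - phi y| <= L * `|x - y|) ->
  (forall x, `|phi x - x| <= B) ->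
  (Cnorm 0 rho (phi \- id)%R <= (B + (L + 1))%:E)%E.
Proof.
move=> L0 phiL phiB; rewrite /Cnorm asboolT; last by move=> i; rewrite ltn0.
rewrite big_ord1 EFinD leeD//; first exact/supnorm_leP.
apply: ge_ereal_sup => _ [->|[[x y] /= /andP[xy0 xy1] <-]].
  by rewrite lee_fin addr_ge0.
rewrite lee_fin ler_pdivrMr ?powR_gt0//.
have -> : phi x - x - (phi y - y) = (phi x - phi y) - (x - y) by vring.
rewrite (le_trans (ler_normB _ _))// (le_trans (lerD (phiL x y) (lexx _)))//.
rewrite -[X in _ + X]mul1r -mulrDl ler_wpM2l ?addr_ge0//.
by rewrite powR_ge_id// ?rho_range// normr_ge0.
Qed.

Lemma lipschitz_continuous (phi : E -> E) (L : R) : 0 <= L ->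
  (forall x y, `|phi x - phi y| <= L * `|x - y|) -> continuous phi.
Proof.
move=> L0 phiL x; apply/cvgrPdist_le => e e0.
have eL : 0 < e / (L + 1) by rewrite divr_gt0// ltr_wpDl.
near=> y; rewrite (le_trans (phiL x y))//.
have : `|x - y| <= e / (L + 1) by near: y; exact: cvgr_dist_le.
rewrite ler_pdivlMr ?ltr_wpDl// => /(le_trans _); apply.
by rewrite mulrC ler_wpM2l// lerDl.
Unshelve. all: by end_near. Qed.

Lemma davie_family_near (V W : R -> R -> E -> E) (K s t : R) x : 1 <= K ->
  driver_fields T p rho K V W -> 0 <= s -> s <= t -> t <= T -> t - s <= 1 ->
  `|davie_family V W t s x - x| <= 200 * K ^+ 5.
Proof.
move=> K1 VW s0 st tT ts1; have ts0 : 0 <= t - s by rewrite subr_ge0.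
have nuP := davie_almost_flow rho_range K1 p_gt0 VW.
have := tame_le x (af_tame nuP s0 st tT ts1) => /le_trans; apply.
have /andP[_ v1] := rate01 p_gt0 ts0 ts1.
exact: ler_piMr (davie_const_ge0 K1) v1.
Qed.

Lemma rough_flow_cancel (V W : R -> R -> E -> E) (K L C d : R)
    (phi psi : R -> R -> E -> E) : 1 <= K -> driver_fields T p rho K V W ->
  0 <= L -> 0 <= C -> 0 < d <= 1 ->
  is_flow T phi -> is_flow T psi -> flow_lipschitz T psi L ->
  flow_close T b d C phi (davie_family V W) ->
  flow_close T b d C psi (davie_family (time_reversal T V) (time_reversal T W)) ->
  forall s t x, 0 <= s -> s <= t -> t <= T ->
    psi (T - s) (T - t) (phi t s x) = x.
Proof.
move=> K1 VW L0 C0 /andP[d0 d1] fphi fpsi Lpsi Cphi Cpsi.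
have VWr := driver_fields_reversal VW.
have nuP := davie_almost_flow rho_range K1 p_gt0 VWr.
have K50 := davie_const_ge0 K1.
have KL0 : 0 <= 1 + 200 * K ^+ 5 by rewrite addr_ge0.
apply: (flow_inverse T0 b_gt1 fphi fpsi L0 Lpsi d0 C0 K50 KL0 Cphi Cpsi).
  move=> s t x y s0 st tT tsd; have ts1 := le_trans tsd d1.
  have ts0 : 0 <= t - s by rewrite subr_ge0.
  rewrite (le_trans (tame_id_lip _ _ (af_tame nuP s0 st tT ts1)))//.
  have /andP[_ v1] := rate01 p_gt0 ts0 ts1.
  by rewrite ler_wpM2r// lerD2l ler_piMr.
move=> s t x s0 st tT tsd; have ts1 := le_trans tsd d1.
have ts0 : 0 <= t - s by rewrite subr_ge0.
have v01 := rate01 p_gt0 ts0 ts1.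
have := davie_oppK rho_range K1 x v01 (df_field VW s0 st tT ts1).
have [-> _] := rate_powers rho_range p_gt0 ts0.
by rewrite /davie_family /time_reversal !subKr.
Qed.

Lemma time_reversalK (V : R -> R -> E -> E) :
  time_reversal T (time_reversal T V) = V.
Proof.
apply/funext => t; apply/funext => s; apply/funext => x.
by rewrite /time_reversal !subKr opprK.
Qed.

(** Reversing time twice gives the driver back, so that the flow of the reversed
    driver is an inverse on both sides. *)
Lemma rough_flow_holder_homeos (V W : R -> R -> E -> E) (K L C d : R)
    (phi psi : R -> R -> E -> E) : 1 <= K -> driver_fields T p rho K V W ->
  0 <= L -> 0 <= C -> 0 < d <= 1 ->
  is_flow T phi -> is_flow T psi ->
  flow_lipschitz T phi L -> flow_lipschitz T psi L ->
  flow_close T b d C phi (davie_family V W) ->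
  flow_close T b d C psi (davie_family (time_reversal T V) (time_reversal T W)) ->
  uniformly_holder_homeos T rho phi.
Proof.
move=> K1 VW L0 C0 d01 fphi fpsi Lphi Lpsi Cphi Cpsi.
have /andP[d0 d1] := d01.
have VWr := driver_fields_reversal VW.
have r0 (u : R) : u <= T -> 0 <= T - u by rewrite subr_ge0.
have rle (u u' : R) : u <= u' -> T - u' <= T - u by move=> uu; lra.
have rT (u : R) : 0 <= u -> T - u <= T by move=> uu; lra.
have near (V' W' f : R -> R -> E -> E) : driver_fields T p rho K V' W' ->
    flow_close T b d C f (davie_family V' W') ->
    forall s t x, 0 <= s -> s <= t -> t <= T -> t - s <= d ->
    `|f t s x - x| <= C + 200 * K ^+ 5.
  move=> VW' Cf s t x s0 st tT tsd; have ts1 := le_trans tsd d1.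
  have ts0 : 0 <= t - s by rewrite subr_ge0.
  rewrite -(subrKA (davie_family V' W' t s x)) (le_trans (ler_normD _ _))//.
  apply: lerD; last exact: (davie_family_near x K1 VW' s0 st tT ts1).
  rewrite (le_trans (Cf s t x s0 st tT tsd))// ler_piMr//.
  have := @ge0_ler_powR _ b _ (t - s) 1.
  by rewrite powR1; apply; rewrite ?nnegrE// (le_trans ler01 (ltW b_gt1)).
have [B1 hB1] := flow_bounded T0 fphi L0 Lphi d0 (near _ _ _ VW Cphi).
have [B2 hB2] := flow_bounded T0 fpsi L0 Lpsi d0 (near _ _ _ VWr Cpsi).
have inv1 := rough_flow_cancel K1 VW L0 C0 d01 fphi fpsi Lpsi Cphi Cpsi.
have Cphi' : flow_close T b d C phi (davie_family
    (time_reversal T (time_reversal T V)) (time_reversal T (time_reversal T W))).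
  by rewrite !time_reversalK.
have inv2 := rough_flow_cancel K1 VWr L0 C0 d01 fpsi fphi Lphi Cpsi Cphi'.
exists (Num.max B1 B2 + (L + 1)) => s t s0 st tT.
have l1 x y : `|phi t s x - phi t s y| <= L * `|x - y| by exact: Lphi.
have l2 x y : `|psi (T - s) (T - t) x - psi (T - s) (T - t) y| <= L * `|x - y|.
  by apply: Lpsi; [exact: r0|exact: rle|exact: rT].
exists (psi (T - s) (T - t)); split; [split|split].
- by move=> x; exact: inv1.
- move=> x; have := inv2 (T - t) (T - s) x (r0 _ tT) (rle _ _ st) (rT _ s0).
  by rewrite !subKr.
- exact: lipschitz_continuous l1.
- exact: lipschitz_continuous l2.
- apply: lipschitz_Cnorm0 => // x.
  by rewrite (le_trans (hB1 s t x s0 st tT))// le_max lexx.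
- apply: lipschitz_Cnorm0 => // x.
  have := hB2 (T - t) (T - s) x (r0 _ tT) (rle _ _ st) (rT _ s0).
  by move=> /le_trans; apply; rewrite le_max lexx orbT.
Qed.

Lemma davie_diff (x a a' c c' : E) (M M' : clin E E) (K e : R) : 0 <= e ->
  `|a - a'| <= e -> `|c - c'| <= e -> `|M - M'| <= e -> `|a| <= K ->
  `|M'| <= K ->
  `|(x + (a + c + 2^-1 *: M a)) - (x + (a' + c' + 2^-1 *: M' a'))| <=
    (2 + K) * e.
Proof.
move=> e0 ha hc hM aK MK.
have -> : x + (a + c + 2^-1 *: M a) - (x + (a' + c' + 2^-1 *: M' a')) =
  (a - a') + (c - c') + 2^-1 *: ((M - M') a + M' (a - a')).
  by rewrite !clinE; vring.
apply: le_trans (ler_norm3 _ _ _) _.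
rewrite normrZ (ger0_norm (_ : 0 <= 2^-1)) ?invr_ge0//.
have h1 := clin_apply_bound hM aK; have h2 := clin_apply_bound MK ha.
have h3 := le_trans (ler_normD ((M - M') a) (M' (a - a'))) (lerD h1 h2).
lra.
Qed.

Lemma davie_family_dist (D D' : rough_driver E T p rho) (K e s t : R) x :
  1 <= K -> 0 <= e -> (driver_dist D D' < e%:E)%E ->
  driver_fields T p rho K (rd_V D) (rd_W D) ->
  driver_fields T p rho K (rd_V D') (rd_W D') ->
  0 <= s -> s < t -> t <= T -> t - s <= 1 ->
  `|davie_family (rd_V D) (rd_W D) t s x -
    davie_family (rd_V D') (rd_W D') t s x| <= (2 + K) * e.
Proof.
move=> K1 e0 De VW VW' s0 st tT ts1; have st' := ltW st.
have ts0 : 0 <= t - s by rewrite subr_ge0.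
have K0 : 0 <= K by exact: le_trans K1.
have /andP[v0 v1] := rate01 p_gt0 ts0 ts1.
have [[_ bV _] [_ bW _]] := driver_dist_bound rho_range De s0 st tT.
have [dV tV _ _] := df_field VW s0 st' tT ts1.
have [dV' _ tD' _] := df_field VW' s0 st' tT ts1.
have ev : e * (t - s) `^ p^-1 <= e by rewrite ler_piMr.
have ev2 : e * ((t - s) `^ p^-1) ^+ 2 <= e by rewrite ler_piMr// exprn_ile1.
have Kv : K * (t - s) `^ p^-1 <= K by rewrite ler_piMr.
have DB : Dmap (rd_V D t s \- rd_V D' t s) x =
    Dmap (rd_V D t s) x - Dmap (rd_V D' t s) x.
  have := DmapD (dV x) (differentiableN (dV' x)).
  by rewrite DmapN.
apply: davie_diff => //.
- exact: le_trans (bV 0%N x isT) ev.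
- exact: le_trans (bW 0%N x isT) ev2.
- by rewrite -DB; exact: le_trans (bV 1%N x isT) ev.
- exact: le_trans (tame_le x tV) Kv.
- exact: le_trans (tame_le x tD') Kv.
Qed.

End RoughFlow.

Lemma Cbound_mono (R : realType) (E F : normedModType R) n (rho K K' : R)
  (f : E -> F) : K <= K' -> Cbound n rho K f -> Cbound n rho K' f.
Proof.
move=> KK [df bf hf]; split=> // [i x iln|x y].
  exact: le_trans (bf i x iln) KK.
by rewrite (le_trans (hf x y))// ler_wpM2r ?powR_ge0// ler_wpM2l.
Qed.

Lemma driver_bounded_mono (R : realType) (E : normedModType R) (T p rho : R)
    (D : rough_driver E T p rho) (K K' : R) : K <= K' ->
  driver_bounded D K -> driver_bounded D K'.
Proof.
move=> KK bK s t s0 st tT; have [b2 b1] := bK s t s0 st tT.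
by split; [apply: Cbound_mono b2|apply: Cbound_mono b1];
  rewrite ler_wpM2r ?sqr_ge0 ?powR_ge0.
Qed.

Theorem theorem5 (R : realType) (E : completeNormedModType R) (T p rho : R)
    (T_gt0 : 0 < T) (p_ge2 : 2 <= p) (p_lt3 : p < 3)
    (rho_gt : p - 2 < rho) (rho_le1 : rho <= 1) (rho_gt_p3 : p / 3 < rho)
    (V : rough_driver E T p rho) :
  (exists phi : R -> R -> E -> E,
    [/\ solution_flow V phi,
        (forall psi : R -> R -> E -> E, solution_flow V psi ->
          forall s t : R, 0 <= s -> s <= t -> t <= T ->
          forall x : E, psi t s x = phi t s x) &
        uniformly_holder_homeos T rho phi]) /\
  (forall phi : R -> R -> E -> E, solution_flow V phi ->
    forall eps : R, 0 < eps -> exists2 eta : R, 0 < eta &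
      forall (V' : rough_driver E T p rho) (phi' : R -> R -> E -> E),
        solution_flow V' phi' -> (driver_dist V V' < eta%:E)%E ->
        forall s t : R, 0 <= s -> s <= t -> t <= T ->
          (supnorm (phi' t s \- phi t s)%R <= eps%:E)%E).
Proof.
have p0 := p_gt0 p_ge2; have rho01 := rho_range p_ge2 rho_gt rho_le1.
have b1 := b_gt1 p_ge2 p_lt3.
have [K0 K01 bK0] := driver_bounded_ex rho01 V.
(* this K also bounds every driver at distance at most 1 from V *)
pose K := 2 * (K0 + 1); have K1 : 1 <= K by rewrite /K; lra.
have VW : driver_fields T p rho K (rd_V V) (rd_W V).
  apply: (rough_driver_fields rho01 p0).
  by apply: driver_bounded_mono bK0; rewrite lerDl.
have [L [C [d [L0 C0 d01 flow]]]] :=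
  rough_flow (E := E) T_gt0 p_ge2 p_lt3 rho_gt rho_le1 rho_gt_p3 K1.
have /andP[d0 d1] := d01.
have [phi [fphi Lphi Cphi]] := flow _ _ VW.
(* the Lipschitz flow of a driver with these bounds is its only solution *)
have uniq (D : rough_driver E T p rho) f psi :
    driver_fields T p rho K (rd_V D) (rd_W D) ->
    is_flow T f -> flow_lipschitz T f L ->
    flow_close T (3 / p) d C f (davie_family (rd_V D) (rd_W D)) ->
    solution_flow D psi -> forall s t x, 0 <= s -> s <= t -> t <= T ->
    f t s x = psi t s x.
  move=> fD ff Lf Cf.
  move=> /(solution_flowP p_ge2 rho_gt rho_le1 _ K1 fD)[fpsi [d' [C' [d'0 C'0 cpsi]]]].
  move=> s t x; exact: (flow_unique T_gt0 b1 ff fpsi L0 Lf d0 C0 Cf d'0 C'0 cpsi).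
split.
  exists phi; split.
  - by apply/(solution_flowP p_ge2 rho_gt rho_le1 _ K1 VW); split=> //; exists d, C.
  - by move=> psi spsi s t s0 st tT x; rewrite (uniq V phi psi).
  have VWr := driver_fields_reversal VW.
  have [psi [fpsi Lpsi Cpsi]] := flow _ _ VWr.
  exact: (rough_flow_holder_homeos T_gt0 p_ge2 p_lt3 rho_gt rho_le1 K1 VW L0 C0 d01
    fphi fpsi Lphi Lpsi Cphi Cpsi).
move=> phi0 sphi0 eps eps0.
have eps2 : 0 < eps / 2 by rewrite divr_gt0.
have LC : 0 <= L * (2 * C) by rewrite !mulr_ge0.
have [n [n0 nd ne]] := fine_mesh T_gt0 b1 d0 LC eps2.
have n0' : 0 < n%:R :> R by rewrite ltr0n.
(* the number n of steps is fixed first, then the radius eta *)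
pose c := n%:R * (L * (2 + K)) + 1.
have c0 : 0 < c.
  by rewrite ltr_wpDl// !mulr_ge0// addr_ge0// (le_trans ler01).
pose eta := Num.min 1 (eps / 2 / c).
have eta0 : 0 < eta by rewrite lt_min ltr01 divr_gt0.
exists eta => // V' phi' sphi' dist s t s0 st tT.
have bK' : driver_bounded V' (K0 + 1).
  apply: driver_bounded_mono (driver_bounded_dist rho01 dist bK0).
  by rewrite lerD2l ge_min lexx.
have VW' := rough_driver_fields rho01 p0 bK'; rewrite -/K in VW'.
have [psi [fpsi Lpsi Cpsi]] := flow _ _ VW'.
apply/supnorm_leP => x /=.
rewrite -(uniq V' psi phi')// -(uniq V phi phi0)//.
move: st; rewrite le_eqVlt => /orP[/eqP st|st].
  have sT : s <= T by rewrite st.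
  case: fpsi fphi => psi0 _ [phi00 _].
  by rewrite -st psi0// phi00// subrr normr0 ltW.
pose e := 2 * C * (T / n%:R) `^ (3 / p) + (2 + K) * eta.
have step s' t' y : 0 <= s' -> s' <= t' -> t' <= T -> t' - s' = (t - s) / n%:R ->
    `|psi t' s' y - phi t' s' y| <= e.
  move=> s'0 st' t'T ts'.
  have s't' : s' < t' by rewrite -subr_gt0 ts' divr_gt0// subr_gt0.
  have tsT : t' - s' <= T / n%:R.
    by rewrite ts' ler_wpM2r ?invr_ge0// lerBlDr (le_trans tT)// lerDl.
  have tsd := le_trans tsT nd.
  have h1 := Cpsi s' t' y s'0 st' t'T tsd.
  have h2 := Cphi s' t' y s'0 st' t'T tsd; rewrite distrC in h2.
  have h3 := davie_family_dist p_ge2 rho_gt rho_le1 y K1 (ltW eta0) dist VW VW'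
    s'0 s't' t'T (le_trans tsd d1); rewrite distrC in h3.
  have h4 : C * (t' - s') `^ (3 / p) <= C * (T / n%:R) `^ (3 / p).
    rewrite ler_wpM2l// ge0_ler_powR ?nnegrE ?subr_ge0//.
      by rewrite (le_trans ler01)// ltW.
    by rewrite divr_ge0// ltW.
  have tri (y1 y2 y3 y4 : E) :
      `|y1 - y4| <= `|y1 - y2| + (`|y2 - y3| + `|y3 - y4|).
    by rewrite (le_trans (ler_distD y2 _ _))// lerD2l ler_distD.
  apply: le_trans (tri _ (davie_family (rd_V V') (rd_W V') t' s' y)
    (davie_family (rd_V V) (rd_W V) t' s' y) _) _.
  rewrite (le_trans (lerD h1 (lerD h3 h2)))// addrCA addrC /e lerD2r.
  have -> : 2 * C * (T / n%:R) `^ (3 / p) =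
    C * (T / n%:R) `^ (3 / p) + C * (T / n%:R) `^ (3 / p) by ring.
  exact: lerD.
rewrite (le_trans (flow_compare x n0 fpsi fphi L0 Lpsi s0 (ltW st) tT step))//.
have hc : c * eta <= eps / 2.
  by rewrite -ler_pdivlMl// mulrC ge_min lexx orbT.
have -> : n%:R * (L * e) = n%:R * (L * (2 * C) * (T / n%:R) `^ (3 / p)) +
    (c * eta - eta) by rewrite /e /c; ring.
by have := ltW eta0; lra.
Qed.
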